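(* There is an isomorphism of $\mathbb C$-linear monoidal categories $\Gamma:\mathcal Sp(\mathcal Perm)\to\mathcal Perm$ determined by $$m_{k,l}\mapsto\nabla_{k,l}:M^{k,l}\to M^{k+l},\qquad s_{k,l}\mapsto\Delta_{k,l}:M^{k+l}\to M^{k,l}$$ (with a sequence $\lambda$ sent to $M^\lambda$). In particular, the morphisms of $\mathcal Perm$ are generated, under composition, linear combinations and the monoidal product $\circ$, by the morphisms $\nabla_{k,l}$ and $\Delta_{k,l}$.
   Context: The category $\mathcal Perm$. For a composition $\lambda=(\lambda_1,\dots,\lambda_n)$ of $d\in\mathbb N$ (written $\lambda\vDash d$), $S_\lambda\le S_d$ is the Young subgroup $S_{\{1,\dots,\lambda_1\}}\times S_{\{\lambda_1+1,\dots,\lambda_1+\lambda_2\}}\times\cdots$, and $M^\lambda=M^\lambda_d:=\mathbb C[S_\lambda\backslash S_d]$ is the right permutation $\mathbb C[S_d]$-module. $\mathcal Perm$ has objects $M^\lambda_d$ for all $d\in\mathbb N$, $\lambda\vDash d$; $\operatorname{Hom}(M^\lambda_d,M^\mu_{d'})=\operatorname{Hom}_{S_d}(M^\lambda_d,M^\mu_d)$ if $d=d'$ and $0$ otherwise. It is monoidal via $X\circ Y=\operatorname{Ind}_{S_d\times S_{d'}}^{S_{d+d'}}(X\boxtimes Y)$, for which $M^\lambda_d\circ M^\mu_{d'}=M^{(\lambda,\mu)}_{d+d'}$, $(\lambda,\mu)$ being the concatenation. For $k,l\ge0$ put $\nabla_{k,l}:M^{k,l}\to M^{k+l}=\mathbb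 C$, $\sum_g c_g\,S_{k,l}g\mapsto\sum_g c_g$ (sum over right cosets), and $\Delta_{k,l}:M^{k+l}=\mathbb C\to M^{k,l}$, $1\mapsto\frac1{k!\,l!}\sum_{g\in S_{k+l}}S_{k,l}g$. The category $\mathcal Sp(\mathcal Perm)$. It is the $\mathbb C$-linear strict monoidal category whose objects are finite sequences of nonnegative integers with monoidal product concatenation; sequences which differ only by the deletion of entries equal to $0$ are identified. Morphisms $\lambda\to\mu$ are $\mathbb C$-linear combinations of planar diagrams (read from bottom to top, up to planar isotopy keeping edges oriented upwards) with bottom boundary $\lambda$ and top boundary $\mu$, whose strands are labelled by positive integers and whose vertices are merges $m_{k,l}:(k,l)\to(k+l)$ (a strand labelled $k$ on the left and one labelled $l$ on the right fuse into one labelled $k+l$) and splits $s_{k,l}:(k+l)\to(k,l)$. Composition is vertical, and the monoidal product $\otimes$ horizontal, juxtaposition. Equivalently, morphisms are generated monoidally by the $m_{k,l}$ and $s_{k,l}$. Strands with label $0$ are removed (so $m_{k,0},m_{0,k},s_{k,0},s_{0,k}$ are identities), and any diagram containing a negatively labelled strand is $0$. Put $F^{(s)}_{k,l}=(1_{k-s}\otimes m_{s,l})(s_{k-s,s}\otimes1_l):(k,l)\to(k-s,l+s)$ and $E^{(r)}_{k,l}=(m_{k,r}\otimes1_{l-r})(1_k\otimes s_{r,l-r}):(k,l)\to(k+r,l-r)$. The defining relations are: (1) $m_{k+l,m}(m_{k,l}\otimes1_m)=m_{k,l+m}(1_k\otimes m_{l,m})$; (2) $(s_{k,l}\otimes1_m)s_{k+l,m}=(1_k\otimes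 s_{l,m})s_{k,l+m}$; (3) $m_{k,l}s_{k,l}=\binom{k+l}{l}1_{k+l}$; (4) for all $k,l,r,s\in\mathbb Z$, $E^{(r)}_{k-s,l+s}F^{(s)}_{k,l}=\sum_{t\ge0}\binom{k-l+r-s}{t}F^{(s-t)}_{k+r-t,\,l-r+t}E^{(r-t)}_{k,l}$ (generalized binomial coefficients). *)

(* Defs.v *)
From HB Require Import structures.
From mathcomp Require Import all_boot all_order all_fingroup all_algebra.
From mathcomp Require Import boolp zify ring.

Set Implicit Arguments.
Unset Strict Implicit.
Unset Printing Implicit Defensive.

Import GRing.Theory.
Local Open Scope ring_scope.
Local Open Scope quotient_scope.

(* K-linear strict monoidal categories; [mcomp g f] is "g after f".
   Because the monoidal product is strict, the two sides of an associativity or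
   unit law for morphisms have boundaries that are equal but not convertible;
   such laws are stated as equalities of [arrow]s, i.e. of morphisms packed
   with their source and target. *)
Record lmcat_data (K : fieldType) := LMCatData {
  mob : Type;
  mhom : mob -> mob -> lmodType K;
  mid : forall a, mhom a a;
  mcomp : forall a b c, mhom b c -> mhom a b -> mhom a c;
  munit : mob;
  mprod : mob -> mob -> mob;
  mtens : forall a b c d,
    mhom a b -> mhom c d -> mhom (mprod a c) (mprod b d) }.

Arguments mid {K _} a.
Arguments mcomp {K _ a b c} g f.
Arguments munit {K _}.
Arguments mprod {K _} a b.
Arguments mtens {K _ a b c d} f g.

Definition arrow (K : fieldType) (C : lmcat_data K) : Type :=
  {ab : mob C * mob C & mhom ab.1 ab.2}.

Definition Arr (K : fieldType) (C : lmcat_data K) (a b : mob C)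
    (f : mhom a b) : arrow C :=
  existT (fun ab : mob C * mob C => mhom ab.1 ab.2 : Type) (a, b) f.

Record lmcat_axioms (K : fieldType) (C : lmcat_data K) : Prop := LMCatAxioms {
  mcompA : forall (a b c d : mob C)
      (h : mhom c d) (g : mhom b c) (f : mhom a b),
    mcomp h (mcomp g f) = mcomp (mcomp h g) f;
  mcomp1f : forall (a b : mob C) (f : mhom a b), mcomp (mid b) f = f;
  mcompf1 : forall (a b : mob C) (f : mhom a b), mcomp f (mid a) = f;
  mcomp_linl : forall (a b c : mob C) (f : mhom a b) (k : K) (g g' : mhom b c),
    mcomp (k *: g + g') f = k *: mcomp g f + mcomp g' f;
  mcomp_linr : forall (a b c : mob C) (g : mhom b c) (k : K) (f f' : mhom a b),
    mcomp g (k *: f + f') = k *: mcomp g f + mcomp g f';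
  mprodA : forall a b c : mob C, mprod a (mprod b c) = mprod (mprod a b) c;
  mprod1o : forall a : mob C, mprod munit a = a;
  mprodo1 : forall a : mob C, mprod a munit = a;
  mtens_linl : forall (a b c d : mob C) (g : mhom c d) (k : K)
      (f f' : mhom a b),
    mtens (k *: f + f') g = k *: mtens f g + mtens f' g;
  mtens_linr : forall (a b c d : mob C) (f : mhom a b) (k : K)
      (g g' : mhom c d),
    mtens f (k *: g + g') = k *: mtens f g + mtens f g';
  mtens1 : forall a b : mob C, mtens (mid a) (mid b) = mid (mprod a b);
  mtens_comp : forall (a b c a' b' c' : mob C) (g : mhom b c) (f : mhom a b)
      (g' : mhom b' c') (f' : mhom a' b'),
    mtens (mcomp g f) (mcomp g' f') = mcomp (mtens g g') (mtens f f');
  mtensA : forall (a b c a' b' c' : mob C) (f : mhom a a') (g : mhom b b')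
      (h : mhom c c'),
    Arr (mtens f (mtens g h)) = Arr (mtens (mtens f g) h);
  mtens1f : forall (a b : mob C) (f : mhom a b),
    Arr (mtens (mid munit) f) = Arr f;
  mtensf1 : forall (a b : mob C) (f : mhom a b),
    Arr (mtens f (mid munit)) = Arr f }.

Record lmcat (K : fieldType) := LMCat {
  lmdata :> lmcat_data K;
  lmaxioms : lmcat_axioms lmdata }.

Record lmfunctor (K : fieldType) (C D : lmcat K) := LMFunctor {
  fob : mob C -> mob D;
  fmor : forall a b : mob C, {linear mhom a b -> mhom (fob a) (fob b)};
  fmor_id : forall a : mob C, fmor a a (mid a) = mid (fob a);
  fmor_comp : forall (a b c : mob C) (g : mhom b c) (f : mhom a b),
    fmor a c (mcomp g f) = mcomp (fmor b c g) (fmor a b f);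
  fob_unit : fob munit = munit;
  fob_prod : forall a b : mob C, fob (mprod a b) = mprod (fob a) (fob b);
  fmor_tens : forall (a b c d : mob C) (f : mhom a b) (g : mhom c d),
    Arr (fmor _ _ (mtens f g)) = Arr (mtens (fmor a b f) (fmor c d g)) }.

(* G is inverse to F also on objects, since arrows carry their boundaries. *)
Definition lmiso (K : fieldType) (C D : lmcat K) (F : lmfunctor C D) : Prop :=
  exists G : lmfunctor D C,
    (forall (a b : mob C) (f : mhom a b), Arr (fmor G _ _ (fmor F _ _ f)) = Arr f)
    /\
    (forall (a b : mob D) (f : mhom a b), Arr (fmor F _ _ (fmor G _ _ f)) = Arr f).

(* The closure of a family of arrows under composition, linear combinations and
   the monoidal product.  Identities are not thrown in. *)
Inductive generated (K : fieldType) (C : lmcat K) (S : arrow C -> Prop) :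
    arrow C -> Prop :=
  | gen_base x : S x -> generated S x
  | gen_zero (a b : mob C) : generated S (Arr (0 : mhom a b))
  | gen_lin (a b : mob C) (k : K) (f g : mhom a b) :
      generated S (Arr f) -> generated S (Arr g) ->
      generated S (Arr (k *: f + g))
  | gen_comp (a b c : mob C) (g : mhom b c) (f : mhom a b) :
      generated S (Arr g) -> generated S (Arr f) ->
      generated S (Arr (mcomp g f))
  | gen_tens (a b c d : mob C) (f : mhom a b) (g : mhom c d) :
      generated S (Arr f) -> generated S (Arr g) ->
      generated S (Arr (mtens f g)).

(* Sequences of nonnegative integers up to deletion of zero entries, each
   represented by its unique zero-free member. *)
Record composition := Composition { parts :> seq nat; _ : 0%N \notin parts }.

HB.instance Definition _ := [isSub of composition for parts].
HB.instance Definition _ := [Equality of composition by <:].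

Lemma strip_subproof (s : seq nat) : 0%N \notin [seq x <- s | x != 0%N].
Proof. by rewrite mem_filter eqxx. Qed.

Definition strip (s : seq nat) : composition := Composition (strip_subproof s).

Lemma cat_subproof (a b : composition) : 0%N \notin a ++ b.
Proof. by case: a b => [a a0] [b b0]; rewrite mem_cat negb_or /= a0. Qed.

Definition catc (a b : composition) : composition :=
  Composition (cat_subproof a b).

Lemma stripK (a : composition) : strip a = a.
Proof.
by apply/val_inj/all_filterP/allP => x; apply: contraTneq => ->; case: a.
Qed.

Lemma strip_cat (s t : seq nat) : strip (s ++ t) = catc (strip s) (strip t).
Proof. by apply: val_inj; rewrite /= filter_cat. Qed.

Lemma sumn_strip (s : seq nat) : sumn (strip s) = sumn s.
Proof. by elim: s => //= x s <-; case: eqP => [->|]. Qed.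

Lemma catcA (a b c : composition) : catc a (catc b c) = catc (catc a b) c.
Proof. by apply: val_inj; rewrite /= catA. Qed.

Lemma catc0 (a : composition) : catc a (strip [::]) = a.
Proof. by apply: val_inj; rewrite /= cats0. Qed.

Lemma cat0c (a : composition) : catc (strip [::]) a = a.
Proof. exact: val_inj. Qed.

Inductive diag (K : Type) : Type :=
  | Id of composition
  | Merge of nat & nat
  | Split of nat & nat
  | Comp of diag K & diag K
  | Tens of diag K & diag K
  | Zero of composition & composition
  | Add of diag K & diag K
  | Scale of K & diag K.

Arguments Id {K} a.
Arguments Merge {K} k l.
Arguments Split {K} k l.
Arguments Zero {K} a b.

Section Diagrams.
Variable K : fieldType.
Implicit Types (f g h : diag K) (a b c d : composition).

Fixpoint src f : composition :=
  match f with
  | Id a => a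
  | Merge k l => strip [:: k; l]
  | Split k l => strip [:: (k + l)%N]
  | Comp _ f => src f
  | Tens f g => catc (src f) (src g)
  | Zero a _ => a
  | Add f _ => src f
  | Scale _ f => src f
  end.

Fixpoint tgt f : composition :=
  match f with
  | Id a => a
  | Merge k l => strip [:: (k + l)%N]
  | Split k l => strip [:: k; l]
  | Comp g _ => tgt g
  | Tens f g => catc (tgt f) (tgt g)
  | Zero _ b => b
  | Add f _ => tgt f
  | Scale _ f => tgt f
  end.

Fixpoint wf f : bool :=
  match f with
  | Comp g f => [&& wf g, wf f & tgt f == src g]
  | Tens f g => wf f && wf g
  | Add f g => [&& wf f, wf g, src f == src g & tgt f == tgt g]
  | Scale _ f => wf f
  | _ => true
  end.

Definition typed a b f : bool := [&& wf f, src f == a & tgt f == b].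

Local Notation "g \after f" := (Comp g f) (at level 50, left associativity).
Local Notation "f \beside g" := (Tens f g) (at level 40, left associativity).
Local Notation "1_ s" := (Id (strip s)) (at level 5, s at level 0).

(* The diagrams F^(s)_{k,l} and E^(r)_{k,l} with integer labels.  If some strand
   label is negative the diagram is zero; its nominal boundary is then
   irrelevant, and is obtained by taking absolute values. *)
Definition iob (k l : int) : composition := strip [:: `|k|%N; `|l|%N].

Definition Fdiag (s k l : int) : diag K :=
  if [&& 0 <= s, 0 <= k, 0 <= l, 0 <= k - s & 0 <= l + s] then
    (1_[:: `|k - s|%N] \beside Merge `|s|%N `|l|%N)
      \after (Split `|k - s|%N `|s|%N \beside 1_[:: `|l|%N])
  else Zero (iob k l) (iob (k - s) (l + s)).

Definition Ediag (r k l : int) : diag K :=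
  if [&& 0 <= r, 0 <= k, 0 <= l, 0 <= k + r & 0 <= l - r] then
    (Merge `|k|%N `|r|%N \beside 1_[:: `|l - r|%N])
      \after (1_[:: `|k|%N] \beside Split `|r|%N `|l - r|%N)
  else Zero (iob k l) (iob (k + r) (l - r)).

Definition gbinom (n : int) (t : nat) : K :=
  (\prod_(i < t) (n - i%:Z)%:~R) / t`!%:R.

(* The terms with t > s vanish because F^(s - t) does, so the sum over all
   t >= 0 is cut at |s|. *)
Definition EF_rhs (k l r s : int) : diag K :=
  \big[@Add K/Zero (iob k l) (iob (k - s + r) (l + s - r))]_(t < `|s|%N.+1)
    Scale (gbinom (k - l + r - s) t)
      (Fdiag (s - t%:Z) (k + r - t%:Z) (l - r + t%:Z) \after Ediag (r - t%:Z) k l).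

(* [deq a b f g]: f and g are equal as morphisms a -> b of Sp(Perm). *)
Inductive deq : composition -> composition -> diag K -> diag K -> Prop :=
  | deq_refl a b f : typed a b f -> deq a b f f
  | deq_sym a b f g : deq a b f g -> deq a b g f
  | deq_trans a b f g h : deq a b f g -> deq a b g h -> deq a b f h
  | deq_comp a b c g g' f f' :
      deq b c g g' -> deq a b f f' -> deq a c (g \after f) (g' \after f')
  | deq_tens a b c d f f' g g' :
      deq a b f f' -> deq c d g g' ->
      deq (catc a c) (catc b d) (f \beside g) (f' \beside g')
  | deq_add a b f f' g g' :
      deq a b f f' -> deq a b g g' -> deq a b (Add f g) (Add f' g')
  | deq_scale a b k f f' : deq a b f f' -> deq a b (Scale k f) (Scale k f')
  | deq_addA a b f g h : typed a b f -> typed a b g -> typed a b h ->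
      deq a b (Add f (Add g h)) (Add (Add f g) h)
  | deq_addC a b f g : typed a b f -> typed a b g ->
      deq a b (Add f g) (Add g f)
  | deq_add0 a b f : typed a b f -> deq a b (Add (Zero a b) f) f
  | deq_scale0 a b f : typed a b f -> deq a b (Scale 0 f) (Zero a b)
  | deq_scale1 a b f : typed a b f -> deq a b (Scale 1 f) f
  | deq_scaleA a b k l f : typed a b f ->
      deq a b (Scale k (Scale l f)) (Scale (k * l) f)
  | deq_scaleDl a b k l f : typed a b f ->
      deq a b (Scale (k + l) f) (Add (Scale k f) (Scale l f))
  | deq_scaleDr a b k f g : typed a b f -> typed a b g ->
      deq a b (Scale k (Add f g)) (Add (Scale k f) (Scale k g))
  | deq_compA a b c d h g f : typed c d h -> typed b c g -> typed a b f ->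
      deq a d (h \after (g \after f)) ((h \after g) \after f)
  | deq_comp1f a b f : typed a b f -> deq a b (Id b \after f) f
  | deq_compf1 a b f : typed a b f -> deq a b (f \after Id a) f
  | deq_compDl a b c g g' f : typed b c g -> typed b c g' -> typed a b f ->
      deq a c (Add g g' \after f) (Add (g \after f) (g' \after f))
  | deq_compDr a b c g f f' : typed b c g -> typed a b f -> typed a b f' ->
      deq a c (g \after Add f f') (Add (g \after f) (g \after f'))
  | deq_compZl a b c k g f : typed b c g -> typed a b f ->
      deq a c (Scale k g \after f) (Scale k (g \after f))
  | deq_compZr a b c k g f : typed b c g -> typed a b f ->
      deq a c (g \after Scale k f) (Scale k (g \after f))
  | deq_tens1 a b : deq (catc a b) (catc a b) (Id a \beside Id b) (Id (catc a b))
  | deq_tens_comp a b c a' b' c' g f g' f' :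
      typed b c g -> typed a b f -> typed b' c' g' -> typed a' b' f' ->
      deq (catc a a') (catc c c')
        ((g \after f) \beside (g' \after f')) ((g \beside g') \after (f \beside f'))
  | deq_tensA a a' b b' c c' f g h :
      typed a a' f -> typed b b' g -> typed c c' h ->
      deq (catc a (catc b c)) (catc a' (catc b' c'))
        (f \beside (g \beside h)) ((f \beside g) \beside h)
  | deq_tens1f a b f : typed a b f -> deq a b (1_[::] \beside f) f
  | deq_tensf1 a b f : typed a b f -> deq a b (f \beside 1_[::]) f
  | deq_tensDl a b c d f f' g : typed a b f -> typed a b f' -> typed c d g ->
      deq (catc a c) (catc b d) (Add f f' \beside g) (Add (f \beside g) (f' \beside g))
  | deq_tensDr a b c d f g g' : typed a b f -> typed c d g -> typed c d g' ->
      deq (catc a c) (catc b d) (f \beside Add g g') (Add (f \beside g) (f \beside g'))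
  | deq_tensZl a b c d k f g : typed a b f -> typed c d g ->
      deq (catc a c) (catc b d) (Scale k f \beside g) (Scale k (f \beside g))
  | deq_tensZr a b c d k f g : typed a b f -> typed c d g ->
      deq (catc a c) (catc b d) (f \beside Scale k g) (Scale k (f \beside g))
  (* strands labelled 0 are removed *)
  | deq_merge0r k : deq (strip [:: k]) (strip [:: k]) (Merge k 0) 1_[:: k]
  | deq_merge0l k : deq (strip [:: k]) (strip [:: k]) (Merge 0 k) 1_[:: k]
  | deq_split0r k : deq (strip [:: k]) (strip [:: k]) (Split k 0) 1_[:: k]
  | deq_split0l k : deq (strip [:: k]) (strip [:: k]) (Split 0 k) 1_[:: k]
  | deq_mergeA k l m :
      deq (strip [:: k; l; m]) (strip [:: (k + l + m)%N])
        (Merge (k + l) m \after (Merge k l \beside 1_[:: m]))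
        (Merge k (l + m) \after (1_[:: k] \beside Merge l m))
  | deq_splitA k l m :
      deq (strip [:: (k + l + m)%N]) (strip [:: k; l; m])
        ((Split k l \beside 1_[:: m]) \after Split (k + l) m)
        ((1_[:: k] \beside Split l m) \after Split k (l + m))
  | deq_merge_split k l :
      deq (strip [:: (k + l)%N]) (strip [:: (k + l)%N])
        (Merge k l \after Split k l)
        (Scale 'C(k + l, l)%:R 1_[:: (k + l)%N])
  | deq_EF k l r s :
      deq (iob k l) (iob (k - s + r) (l + s - r))
        (Ediag r (k - s) (l + s) \after Fdiag s k l)
        (EF_rhs k l r s).

End Diagrams.

Section Typing.
Variable K : fieldType.

Lemma typedP (a b : composition) (f : diag K) :
  reflect [/\ wf f, src f = a & tgt f = b] (typed a b f).
Proof.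
by apply: (iffP and3P) => -[? /eqP ? /eqP ?].
Qed.

Lemma typed_comp (a b c : composition) (g f : diag K) :
  typed b c g -> typed a b f -> typed a c (Comp g f).
Proof.
move=> /typedP[wg <- <-] /typedP[wf <- eb].
by apply/typedP; rewrite /= wg wf eb eqxx.
Qed.

Lemma typed_tens (a b c d : composition) (f g : diag K) :
  typed a b f -> typed c d g -> typed (catc a c) (catc b d) (Tens f g).
Proof.
by move=> /typedP[wf <- <-] /typedP[wg <- <-]; apply/typedP; rewrite /= wg wf.
Qed.

Lemma typed_add (a b : composition) (f g : diag K) :
  typed a b f -> typed a b g -> typed a b (Add f g).
Proof.
move=> /typedP[wf <- <-] /typedP[wg eg eg']; apply/typedP.
by rewrite /= wg wf eg eg' !eqxx.
Qed.

Lemma typed_zero (a b : composition) : typed a b (Zero a b : diag K).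
Proof. by apply/typedP. Qed.

Lemma typed_scale (a b : composition) (k : K) (f : diag K) :
  typed a b f -> typed a b (Scale k f).
Proof. by []. Qed.

Lemma typed_id (a : composition) : typed a a (Id a : diag K).
Proof. exact/typedP. Qed.

Lemma Ediag_typed (r k l : int) :
  typed (iob k l) (iob (k + r) (l - r)) (Ediag K r k l).
Proof.
rewrite /Ediag; case: ifP => [/and5P[r0 k0 l0 kr0 lr0]|_]; last exact: typed_zero.
by apply/typedP; rewrite /= -!strip_cat /= eqxx; split=> //; congr (strip [:: _; _]); lia.
Qed.

Lemma Fdiag_typed (s k l : int) :
  typed (iob k l) (iob (k - s) (l + s)) (Fdiag K s k l).
Proof.
rewrite /Fdiag; case: ifP => [/and5P[r0 k0 l0 kr0 lr0]|_]; last exact: typed_zero.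
by apply/typedP; rewrite /= -!strip_cat /= eqxx; split=> //; congr (strip [:: _; _]); lia.
Qed.

Lemma EF_rhs_typed (k l r s : int) :
  typed (iob k l) (iob (k - s + r) (l + s - r)) (EF_rhs K k l r s).
Proof.
rewrite /EF_rhs; elim/big_ind: _ => [|f g|t _]; first exact: typed_zero.
  exact: typed_add.
apply: typed_scale; apply: typed_comp (Ediag_typed _ _ _).
have := Fdiag_typed (s - t%:Z) (k + r - t%:Z) (l - r + t%:Z).
by congr (typed (iob _ _) (iob _ _) _); ring.
Qed.

Lemma strip0 (s : seq nat) : strip (0%N :: s) = strip s.
Proof. exact: val_inj. Qed.

Lemma strip_r0 (k : nat) : strip [:: k; 0%N] = strip [:: k].
Proof. exact: val_inj. Qed.

Lemma deq_typed (a b : composition) (f g : diag K) :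
  deq a b f g -> typed a b f /\ typed a b g.
Proof.
elim=> {a b f g} *;
  repeat match goal with H : _ /\ _ |- _ => destruct H end;
  repeat match goal with H : is_true (typed _ _ _) |- _ =>
     move/typedP: H => [? ? ?] end; subst;
  try by split; apply/typedP; rewrite /= -?catcA ?cat0c ?catc0 ?stripK; 
    repeat match goal with H : src _ = _ |- _ => rewrite ?H; clear H 
      | H : tgt _ = _ |- _ => rewrite ?H; clear H 
      | H : is_true (wf _) |- _ => rewrite ?H; clear H end; rewrite ?eqxx.
- by split; apply/typedP => //=; rewrite addn0 strip_r0.
- by split; apply/typedP => //=; rewrite add0n strip0.
- by split; apply/typedP => //=; rewrite addn0 strip_r0.
- by split; apply/typedP => //=; rewrite add0n strip0.
- by split; apply/typedP; rewrite /= -!strip_cat /= ?addnA ?eqxx.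
- by split; apply/typedP; rewrite /= -!strip_cat /= ?addnA ?eqxx.
- split; last exact: EF_rhs_typed.
  exact: typed_comp (Ediag_typed _ _ _) (Fdiag_typed _ _ _).
Qed.
End Typing.

Definition tdiag (K : fieldType) (a b : composition) : Type :=
  {f : diag K | typed a b f}.

HB.instance Definition _ (K : fieldType) (a b : composition) :=
  gen_eqMixin (tdiag K a b).
HB.instance Definition _ (K : fieldType) (a b : composition) :=
  gen_choiceMixin (tdiag K a b).

Section SpHom.
Variables (K : fieldType) (a b : composition).
Implicit Types (f g : tdiag K a b).

Definition deqb f g : bool := `[< deq a b (sval f) (sval g) >].

Lemma deqb_refl : reflexive deqb.
Proof. by move=> f; apply/asboolP/deq_refl/(svalP f). Qed.

Lemma deqb_sym : symmetric deqb.
Proof. by move=> f g; apply/asboolP/asboolP; apply: deq_sym. Qed.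

Lemma deqb_trans : transitive deqb.
Proof.
by move=> g f h /asboolP fg /asboolP gh; apply/asboolP; apply: deq_trans fg gh.
Qed.

Canonical deqb_equiv := EquivRel deqb deqb_refl deqb_sym deqb_trans.

Definition sphom : Type := {eq_quot deqb}.

HB.instance Definition _ := Choice.on sphom.

Definition spcls (f : diag K) (tf : typed a b f) : sphom :=
  \pi_({eq_quot deqb}) (exist _ f tf).

Definition sprep (f : sphom) : diag K := sval (generic_quotient.repr (f : {eq_quot deqb})).

Lemma sprep_typed (f : sphom) : typed a b (sprep f).
Proof. by rewrite /sprep; case: (generic_quotient.repr _). Qed.

Lemma spclsP (f g : diag K) (tf : typed a b f) (tg : typed a b g) :
  spcls tf = spcls tg <-> deq a b f g.
Proof.
by split=> [/eqquotP/asboolP//|fg]; apply/eqquotP/asboolP.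
Qed.

Lemma sprepK (f : sphom) : spcls (sprep_typed f) = f.
Proof.
rewrite -[RHS](@reprK _ {eq_quot deqb}) /spcls; congr (\pi_({eq_quot deqb}) _).
exact: val_inj.
Qed.

Lemma sprep_cls (f : diag K) (tf : typed a b f) : deq a b (sprep (spcls tf)) f.
Proof. by rewrite -(spclsP (sprep_typed _)) sprepK. Qed.

Lemma sphom_eq (f g : sphom) : deq a b (sprep f) (sprep g) -> f = g.
Proof. by move=> /spclsP fg; rewrite -(sprepK f) -(sprepK g). Qed.

Definition spzero : sphom := spcls (typed_zero K a b).
Definition spadd (f g : sphom) : sphom :=
  spcls (typed_add (sprep_typed f) (sprep_typed g)).
Definition spscale (k : K) (f : sphom) : sphom :=
  spcls (typed_scale k (sprep_typed f)).
Definition spopp (f : sphom) : sphom := spscale (-1) f.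

Local Notation dr := (deq_refl (sprep_typed _)).

Lemma spaddA : associative spadd.
Proof.
move=> f g h; apply/spclsP.
apply: deq_trans (deq_add dr (sprep_cls _)) _.
apply: deq_trans (deq_sym (deq_add (sprep_cls _) dr)).
by apply: deq_addA; apply: sprep_typed.
Qed.

Lemma spaddC : commutative spadd.
Proof. by move=> f g; apply/spclsP; apply: deq_addC; apply: sprep_typed. Qed.

Lemma spadd0 : left_id spzero spadd.
Proof.
move=> f; rewrite -[RHS]sprepK; apply/spclsP.
apply: deq_trans (deq_add (sprep_cls _) dr) _.
by apply: deq_add0; apply: sprep_typed.
Qed.

Lemma spscaleDl' (f : sphom) (k l : K) :
  spscale (k + l) f = spadd (spscale k f) (spscale l f).
Proof.
apply/spclsP; apply: deq_trans (deq_sym (deq_add (sprep_cls _) (sprep_cls _))).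
by apply: deq_scaleDl; apply: sprep_typed.
Qed.

Lemma spscale1 : left_id 1 spscale.
Proof.
by move=> f; rewrite -[RHS]sprepK; apply/spclsP/deq_scale1/sprep_typed.
Qed.

Lemma spscale0 (f : sphom) : spscale 0 f = spzero.
Proof. by apply/spclsP/deq_scale0/sprep_typed. Qed.

Lemma spaddN : left_inverse spzero spopp spadd.
Proof.
by move=> f; rewrite -{2}(spscale1 f) -spscaleDl' addrC subrr spscale0.
Qed.

HB.instance Definition _ :=
  GRing.isZmodule.Build sphom spaddA spaddC spadd0 spaddN.

Lemma spscaleA (k l : K) (f : sphom) :
  spscale k (spscale l f) = spscale (k * l) f.
Proof.
apply/spclsP; apply: deq_trans (deq_scale _ (sprep_cls _)) _.
by apply: deq_scaleA; apply: sprep_typed.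
Qed.

Lemma spscaleDr : right_distributive spscale +%R.
Proof.
move=> k f g; apply/spclsP; apply: deq_trans (deq_scale _ (sprep_cls _)) _.
apply: deq_trans (deq_sym (deq_add (sprep_cls _) (sprep_cls _))).
by apply: deq_scaleDr; apply: sprep_typed.
Qed.

Lemma spscaleDl (f : sphom) : {morph spscale^~ f : k l / k + l}.
Proof. exact: spscaleDl'. Qed.

HB.instance Definition _ :=
  GRing.Zmodule_isLmodule.Build K sphom spscaleA spscale1 spscaleDr spscaleDl.

End SpHom.

Section SpCat.
Variable K : fieldType.
Local Notation dr := (deq_refl (sprep_typed _)).
Local Notation tr := (sprep_typed _).

Definition spid (a : composition) : sphom K a a := spcls (typed_id K a).

Definition spcomp (a b c : composition) (g : sphom K b c) (f : sphom K a b) :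
    sphom K a c :=
  spcls (typed_comp (sprep_typed g) (sprep_typed f)).

Definition sptens (a b c d : composition) (f : sphom K a b) (g : sphom K c d) :
    sphom K (catc a c) (catc b d) :=
  spcls (typed_tens (sprep_typed f) (sprep_typed g)).

Definition sp_data : lmcat_data K :=
  @LMCatData K composition (fun a b => sphom K a b : lmodType K)
    spid spcomp (strip [::]) catc sptens.

Lemma sp_lin (a b : composition) (k : K) (f g : sphom K a b) :
  deq a b (sprep (k *: f + g)) (Add (Scale k (sprep f)) (sprep g)).
Proof.
apply: deq_trans (sprep_cls _) _; apply: deq_add dr; exact: sprep_cls.
Qed.

Lemma sp_linP (a b : composition) (k : K) (f g : sphom K a b) (h : diag K)
    (th : typed a b h) :
  deq a b h (Add (Scale k (sprep f)) (sprep g)) -> spcls th = k *: f + g.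
Proof.
move=> hE; rewrite -[RHS]sprepK; apply/spclsP.
exact: deq_trans hE (deq_sym (sp_lin _ _ _)).
Qed.

Lemma sp_Arr (a b a' b' : composition) (f : sphom K a b) (g : sphom K a' b') :
  a = a' -> b = b' -> deq a b (sprep f) (sprep g) ->
  @Arr K sp_data a b f = @Arr K sp_data a' b' g.
Proof. by move=> ea eb; subst => /sphom_eq ->. Qed.

Lemma sp_axioms : lmcat_axioms sp_data.
Proof.
split=> /=.
- move=> a b c d h g f; apply/spclsP.
  apply: deq_trans (deq_comp dr (sprep_cls _)) _.
  apply: deq_trans (deq_sym (deq_comp (sprep_cls _) dr)).
  exact: deq_compA tr tr tr.
- move=> a b f; rewrite -[RHS]sprepK; apply/spclsP.
  apply: deq_trans (deq_comp (sprep_cls _) dr) _; exact: deq_comp1f tr.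
- move=> a b f; rewrite -[RHS]sprepK; apply/spclsP.
  apply: deq_trans (deq_comp dr (sprep_cls _)) _; exact: deq_compf1 tr.
- move=> a b c f k g g'; apply: sp_linP.
  apply: deq_trans (deq_comp (sp_lin _ _ _) dr) _.
  apply: deq_trans (deq_compDl (typed_scale _ tr) tr tr) _.
  apply: deq_add (deq_sym (sprep_cls _)).
  by apply: deq_trans (deq_compZl _ tr tr) (deq_scale _ (deq_sym (sprep_cls _))).
- move=> a b c g k f f'; apply: sp_linP.
  apply: deq_trans (deq_comp dr (sp_lin _ _ _)) _.
  apply: deq_trans (deq_compDr tr (typed_scale _ tr) tr) _.
  apply: deq_add (deq_sym (sprep_cls _)).
  by apply: deq_trans (deq_compZr _ tr tr) (deq_scale _ (deq_sym (sprep_cls _))).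
- exact: catcA.
- exact: cat0c.
- exact: catc0.
- move=> a b c d g k f f'; apply: sp_linP.
  apply: deq_trans (deq_tens (sp_lin _ _ _) dr) _.
  apply: deq_trans (deq_tensDl (typed_scale _ tr) tr tr) _.
  apply: deq_add (deq_sym (sprep_cls _)).
  by apply: deq_trans (deq_tensZl _ tr tr) (deq_scale _ (deq_sym (sprep_cls _))).
- move=> a b c d f k g g'; apply: sp_linP.
  apply: deq_trans (deq_tens dr (sp_lin _ _ _)) _.
  apply: deq_trans (deq_tensDr tr (typed_scale _ tr) tr) _.
  apply: deq_add (deq_sym (sprep_cls _)).
  by apply: deq_trans (deq_tensZr _ tr tr) (deq_scale _ (deq_sym (sprep_cls _))).
- move=> a b; apply/spclsP.
  by apply: deq_trans (deq_tens (sprep_cls _) (sprep_cls _)) _; apply: deq_tens1.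
- move=> a b c a' b' c' g f g' f'; apply/spclsP.
  apply: deq_trans (deq_tens (sprep_cls _) (sprep_cls _)) _.
  apply: deq_trans (deq_sym (deq_comp (sprep_cls _) (sprep_cls _))).
  exact: deq_tens_comp tr tr tr tr.
- move=> a b c a' b' c' f g h; apply: sp_Arr; [exact: catcA|exact: catcA|].
  apply: deq_trans (sprep_cls _) _.
  apply: deq_trans (deq_tens dr (sprep_cls _)) _.
  apply: deq_trans (deq_tensA tr tr tr) _.
  rewrite !catcA; apply: deq_sym; apply: deq_trans (sprep_cls _) _.
  exact: deq_tens (sprep_cls _) dr.
- move=> a b f; apply: sp_Arr; [exact: cat0c|exact: cat0c|].
  apply: deq_trans (sprep_cls _) _.
  apply: deq_trans (deq_tens (sprep_cls _) dr) _.
  by rewrite !cat0c; apply: deq_tens1f tr.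
- move=> a b f; apply: sp_Arr; [exact: catc0|exact: catc0|].
  apply: deq_trans (sprep_cls _) _.
  apply: deq_trans (deq_tens dr (sprep_cls _)) _.
  by rewrite !catc0; apply: deq_tensf1 tr.
Qed.

Definition SpPerm : lmcat K := LMCat sp_axioms.

Lemma typed_merge (k l : nat) :
  typed (strip [:: k; l]) (strip [:: (k + l)%N]) (Merge k l : diag K).
Proof. exact/typedP. Qed.

Lemma typed_split (k l : nat) :
  typed (strip [:: (k + l)%N]) (strip [:: k; l]) (Split k l : diag K).
Proof. exact/typedP. Qed.

Definition spmerge (k l : nat) :
    @mhom K SpPerm (strip [:: k; l]) (strip [:: (k + l)%N]) :=
  spcls (typed_merge k l).

Definition spsplit (k l : nat) :
    @mhom K SpPerm (strip [:: (k + l)%N]) (strip [:: k; l]) :=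
  spcls (typed_split k l).

End SpCat.

(* The blocks of s are the intervals [0, s_0), [s_0, s_0 + s_1), ...;
   [reshape_index s i] is the number of the block containing i. *)
Definition young (d : nat) (s : seq nat) : {set 'S_d} :=
  [set g : 'S_d | [forall i, reshape_index s (g i) == reshape_index s i]].

Lemma youngP (d : nat) (s : seq nat) (g : 'S_d) :
  reflect (forall i, reshape_index s (g i) = reshape_index s i)
    (g \in young d s).
Proof. by rewrite inE; apply/eqfunP. Qed.

Lemma young_group_set (d : nat) (s : seq nat) : group_set (young d s).
Proof.
apply/group_setP; split=> [|g h /youngP gP /youngP hP].
  by apply/youngP => i; rewrite perm1.
by apply/youngP => i; rewrite permM hP gP.
Qed.

Canonical young_group (d : nat) (s : seq nat) : {group 'S_d} :=
  Group (young_group_set d s).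

Definition ycoset (d : nat) (s : seq nat) : Type :=
  {X : {set 'S_d} | X \in rcosets (young d s) [set: 'S_d]}.

HB.instance Definition _ (d : nat) (s : seq nat) := Finite.on (ycoset d s).

Section Cosets.
Local Open Scope group_scope.
Variables (d : nat) (s : seq nat).

Lemma ycos_subproof (g : 'S_d) :
  young d s :* g \in rcosets (young d s) [set: 'S_d].
Proof. by apply/rcosetsP; exists g. Qed.

Definition ycos (g : 'S_d) : ycoset d s :=
  exist (fun X : {set 'S_d} => X \in rcosets (young d s) [set: 'S_d])
    (young d s :* g) (ycos_subproof g).

Definition yrepr (X : ycoset d s) : 'S_d := fingroup.repr (sval X).

Lemma yreprK (X : ycoset d s) : ycos (yrepr X) = X.
Proof.
case: X => X XP; apply: val_inj; rewrite /= /yrepr /=.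
by case/rcosetsP: (XP) => g _ ->; rewrite rcoset_repr.
Qed.

Lemma ycosE (g h : 'S_d) : g * h^-1 \in young d s -> ycos g = ycos h.
Proof. by move=> gh; apply: val_inj; apply/rcoset_eqP; rewrite mem_rcoset. Qed.

Lemma yrepr_cos (g : 'S_d) : yrepr (ycos g) * g^-1 \in young d s.
Proof. by rewrite -mem_rcoset; exact: mem_repr_rcoset. Qed.

Definition ymul (X : ycoset d s) (g : 'S_d) : ycoset d s := ycos (yrepr X * g).

Lemma ymul_cos (g h : 'S_d) : ymul (ycos g) h = ycos (g * h).
Proof.
by apply: ycosE; rewrite invMg mulgA mulgK yrepr_cos.
Qed.

Lemma sval_ymul (X : ycoset d s) (g : 'S_d) : sval (ymul X g) = sval X :* g.
Proof. by rewrite -{2}(yreprK X) /= rcosetM. Qed.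

Lemma ymulA (X : ycoset d s) (g h : 'S_d) :
  ymul (ymul X g) h = ymul X (g * h).
Proof. by rewrite -(yreprK X) !ymul_cos mulgA. Qed.

Lemma ymul1 (X : ycoset d s) : ymul X 1 = X.
Proof. by rewrite -(yreprK X) ymul_cos mulg1. Qed.

End Cosets.

(* The right permutation module M^s_d; v : pmod d s stands for the formal sum
   of the v X *: X over the right cosets X. *)
Definition pmod (K : fieldType) (d : nat) (s : seq nat) : vectType K :=
  {ffun ycoset d s -> K^o}.

Section Modules.
Variables (K : fieldType) (d : nat) (s : seq nat).
Implicit Types (u v : pmod K d s) (g h : 'S_d) (X Y : ycoset d s).

Definition ebas X : pmod K d s := [ffun Y => (Y == X)%:R].

Definition pact v g : pmod K d s := [ffun X => v (ymul X g^-1)].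

Lemma pact_lin g (k : K) u v : pact (k *: u + v) g = k *: pact u g + pact v g.
Proof. by apply/ffunP => X; rewrite !ffunE. Qed.

Lemma pact0 g : pact 0 g = 0.
Proof. by apply/ffunP => X; rewrite !ffunE. Qed.

Lemma pact1 v : pact v 1%g = v.
Proof. by apply/ffunP => X; rewrite !ffunE invg1 ymul1. Qed.

Lemma pactM v g h : pact (pact v g) h = pact v (g * h)%g.
Proof. by apply/ffunP => X; rewrite !ffunE ymulA invMg. Qed.

Lemma pact_ebas X g : pact (ebas X) g = ebas (ymul X g).
Proof.
apply/ffunP => Y; rewrite !ffunE; congr (_%:R : K); congr nat_of_bool.
by apply/eqP/eqP => [<-|->]; rewrite ymulA ?mulVg ?mulgV ymul1.
Qed.

Lemma ebas_cos g : ebas (ycos s g) = pact (ebas (ycos s 1%g)) g.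
Proof. by rewrite pact_ebas ymul_cos mul1g. Qed.

Lemma pact_ycos (g h : 'S_d) :
  pact (ebas (ycos s g)) h = ebas (ycos s (g * h)%g).
Proof. by rewrite pact_ebas ymul_cos. Qed.

Lemma pmodE v : v = \sum_X v X *: ebas X.
Proof.
apply/ffunP => Y; rewrite sum_ffunE (bigD1 Y) //= big1 => [|X /negPf nX].
  by rewrite !ffunE eqxx addr0 [RHS]mulr1.
by rewrite !ffunE eq_sym nX [LHS]mulr0.
Qed.

Lemma pmod_ind (P : pmod K d s -> Prop) :
  (forall (k : K) u v, P u -> P v -> P (k *: u + v)) ->
  (forall g, P (ebas (ycos s g))) -> forall v, P v.
Proof.
move=> Plin Pb v; rewrite (pmodE v).
have P0 : P 0 by have := Plin (-1) _ _ (Pb 1%g) (Pb 1%g); rewrite scaleN1r addNr.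
elim/big_rec: _ => // X u _ Pu; apply: Plin => //.
by rewrite -(yreprK X).
Qed.

End Modules.

(* Transport of permutations along m = n; the value 1 for m != n is junk. *)
Definition permto (m n : nat) (g : 'S_m) : 'S_n :=
  if m =P n is ReflectT e then cast_perm e g else 1%g.

Lemma permto_id (n : nat) (g : 'S_n) : permto n g = g.
Proof. by rewrite /permto; case: eqP => // e; rewrite cast_perm_id. Qed.

Lemma permtoE (m n : nat) (e : m = n) (g : 'S_m) (i : 'I_n) :
  permto n g i = g (cast_ord (esym e) i) :> nat.
Proof.
by case: n / e i => i; rewrite permto_id; congr (val (g _)); apply: val_inj.
Qed.

Lemma permto_trans (m n p : nat) (g : 'S_m) :
  m = n -> permto p (permto n g) = permto p g.
Proof. by move=> e; case: n / e; rewrite permto_id. Qed.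

(* M^pshape_pdeg, with pshape a composition of pdeg.  The module depends only on the
   zero-free part of the composition. *)
Record pob := POb {
  pdeg : nat;
  pshape : composition;
  pob_sum : sumn pshape == pdeg }.

Lemma pob_eq (a b : pob) : pdeg a = pdeg b -> pshape a = pshape b -> a = b.
Proof.
case: a b => [d s p] [d' s' p'] /= ed es; subst d' s'.
by rewrite (bool_irrelevance p p').
Qed.

Lemma Mob_subproof (s : seq nat) : sumn (strip s) == sumn s.
Proof. by rewrite sumn_strip. Qed.

Definition Mob (s : seq nat) : pob := POb (Mob_subproof s).

Lemma pprod_subproof (a b : pob) : sumn (catc (pshape a) (pshape b)) == (pdeg a + pdeg b)%N.
Proof. by rewrite /= sumn_cat (eqP (pob_sum a)) (eqP (pob_sum b)). Qed.

Definition pprod (a b : pob) : pob := POb (pprod_subproof a b).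

Definition pmodo (K : fieldType) (a : pob) : vectType K :=
  pmod K (pdeg a) (pshape a).

Section PHom.
Variables (K : fieldType) (a b : pob).

(* Hom_{S_d}(M^lambda, M^mu) if the degrees agree, and 0 otherwise. *)
Definition ishom : {pred 'Hom(pmodo K a, pmodo K b)} := fun f =>
  if pdeg a == pdeg b then
    `[< forall (v : pmodo K a) (g : 'S_(pdeg a)),
          f (pact v g) = pact (f v) (permto (pdeg b) g) >]
  else f == 0.

Lemma ishom_submod : submod_closed ishom.
Proof.
rewrite /ishom; split=> [|k f h]; rewrite !unfold_in; case: eqP => // _.
- by apply/asboolP => v g; rewrite !lfunE /= pact0.
- move=> /asboolP fP /asboolP hP; apply/asboolP => v g.
  by rewrite !lfunE /= !lfunE /= fP hP pact_lin.
- by move=> /eqP-> /eqP->; rewrite scaler0 addr0.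
Qed.

HB.instance Definition _ :=
  GRing.isSubmodClosed.Build K 'Hom(pmodo K a, pmodo K b) ishom ishom_submod.

Record phom := PHom {
  phval :> 'Hom(pmodo K a, pmodo K b);
  phvalP : phval \in ishom }.

HB.instance Definition _ := [isSub of phom for phval].
HB.instance Definition _ := [Choice of phom by <:].
HB.instance Definition _ := [SubChoice_isSubLmodule of phom by <:].

Lemma phomP (f : phom) (v : pmodo K a) (g : 'S_(pdeg a)) :
  f (pact v g) = pact (f v) (permto (pdeg b) g).
Proof.
have := phvalP f; rewrite unfold_in /ishom; case: eqP => _; first by move/asboolP.
by move/eqP->; rewrite !lfunE /= pact0.
Qed.

Lemma phom_deg (f : phom) : pdeg a = pdeg b \/ forall v, f v = 0.
Proof.
have := phvalP f; rewrite unfold_in /ishom; case: eqP => e; first by left.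
by move/eqP => f0; right=> v; rewrite f0 zero_lfunE.
Qed.

Lemma phom_eq (f g : phom) : (forall h, f (ebas K (ycos _ h)) = g (ebas K (ycos _ h))) -> f = g.
Proof.
move=> fg; apply: val_inj; apply/lfunP; apply: pmod_ind => // k u v eu ev.
by rewrite !linearP; congr (_ *: _ + _).
Qed.

End PHom.

Section PId.
Variable K : fieldType.

Lemma pid_subproof (a : pob) : (\1%VF : 'End(pmodo K a)) \in @ishom K a a.
Proof.
rewrite unfold_in /ishom eqxx; apply/asboolP => v g.
by rewrite !lfunE /= permto_id.
Qed.

Definition pid (a : pob) : phom K a a := PHom (pid_subproof a).

Lemma pcomp_subproof (a b c : pob) (g : phom K b c) (f : phom K a b) :
  (g \o f)%VF \in @ishom K a c.
Proof.
rewrite unfold_in /ishom; case: eqP => ac.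
  apply/asboolP => v x; rewrite !lfunE /= !phomP.
  case: (phom_deg f) => [ab|f0]; first by rewrite permto_trans.
  by rewrite !f0 linear0 !pact0.
apply/eqP/lfunP => v; rewrite !lfunE /=.
case: (phom_deg f) => [ab|->]; last by rewrite linear0.
by case: (phom_deg g) => [bc|->] //; case: ac; rewrite ab bc.
Qed.

Definition pcomp (a b c : pob) (g : phom K b c) (f : phom K a b) : phom K a c :=
  PHom (pcomp_subproof g f).

End PId.

Section PermProd.
Local Open Scope group_scope.

Definition permprod_fun (m n : nat) (g : 'S_m) (h : 'S_n) (i : 'I_(m + n)) :
    'I_(m + n) :=
  match split i with
  | inl j => lshift n (g j)
  | inr j => rshift m (h j)
  end.

Lemma permprod_inj (m n : nat) (g : 'S_m) (h : 'S_n) :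
  injective (permprod_fun g h).
Proof.
move=> i j; rewrite /permprod_fun.
case: (splitP i) => i' ei; case: (splitP j) => j' ej /eqP.
- by rewrite eq_lshift => /eqP/perm_inj eij; apply: val_inj; rewrite /= ei ej eij.
- by rewrite eq_lrshift.
- by rewrite eq_rlshift.
- by rewrite eq_rshift => /eqP/perm_inj eij; apply: val_inj; rewrite /= ei ej eij.
Qed.

(* The image of (g, h) under the embedding S_m x S_n <= S_(m + n). *)
Definition permprod (m n : nat) (g : 'S_m) (h : 'S_n) : 'S_(m + n) :=
  perm (@permprod_inj m n g h).

Lemma permprodl (m n : nat) (g : 'S_m) (h : 'S_n) (i : 'I_m) :
  permprod g h (lshift n i) = lshift n (g i).
Proof. by rewrite permE /permprod_fun (unsplitK (inl i)). Qed.

Lemma permprodr (m n : nat) (g : 'S_m) (h : 'S_n) (i : 'I_n) :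
  permprod g h (rshift m i) = rshift m (h i).
Proof. by rewrite permE /permprod_fun (unsplitK (inr i)). Qed.

Lemma split_ind (m n : nat) (P : 'I_(m + n) -> Prop) :
  (forall i, P (lshift n i)) -> (forall i, P (rshift m i)) -> forall i, P i.
Proof. by move=> Pl Pr i; rewrite -(splitK i); case: (split i). Qed.

Lemma permprodM (m n : nat) (g g' : 'S_m) (h h' : 'S_n) :
  permprod g h * permprod g' h' = permprod (g * g') (h * h').
Proof.
apply/permP; apply: split_ind => i; rewrite permM.
  by rewrite !permprodl permM.
by rewrite !permprodr permM.
Qed.

Lemma permprod1 (m n : nat) : permprod (1 : 'S_m) (1 : 'S_n) = 1.
Proof.
apply/permP; apply: split_ind => i; rewrite perm1.
  by rewrite !permprodl perm1.
by rewrite !permprodr perm1.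
Qed.

Lemma permprodV (m n : nat) (g : 'S_m) (h : 'S_n) :
  (permprod g h)^-1 = permprod g^-1 h^-1.
Proof.
by apply/eqP; rewrite eq_invg_mul permprodM !mulgV permprod1.
Qed.

Lemma permtoM (m n : nat) (g h : 'S_m) :
  m = n -> permto n (g * h) = permto n g * permto n h.
Proof. by move=> e; case: n / e; rewrite !permto_id. Qed.

Lemma permto_prod (m n m' n' : nat) (g : 'S_m) (h : 'S_n) :
  m = m' -> n = n' ->
  permto (m' + n') (permprod g h) = permprod (permto m' g) (permto n' h).
Proof.
by move=> e e'; case: m' / e; case: n' / e'; rewrite !permto_id.
Qed.

Lemma reshape_index_catl (s t : seq nat) (i : nat) :
  (i < sumn s)%N -> reshape_index (s ++ t) i = reshape_index s i.
Proof.
move=> lis; have := reshape_indexP lis; rewrite /reshape_index scanl_cat find_cat.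
by move: (find_size) => _; rewrite -[X in (_ < X)%N](size_scanl subn i.+1) has_find => ->.
Qed.

Lemma reshape_index_catr (s t : seq nat) (i : nat) :
  reshape_index (s ++ t) (sumn s + i) = (size s + reshape_index t i)%N.
Proof.
rewrite /reshape_index scanl_cat find_cat size_scanl.
have fE : forall (u : seq nat) n, foldl subn n u = (n - sumn u)%N.
  by elim=> [|x u IH] n /=; rewrite ?subn0 // IH subnDA.
have /negPf-> : ~~ has (pred1 0%N) (scanl subn (sumn s + i).+1 s).
  elim: s i => //= x s IH i; rewrite negb_or; apply/andP; split.
    by apply/eqP; lia.
  by rewrite -[X in scanl _ X]/((x + sumn s + i).+1 - x)%N -addnA subSn ?leq_addr // addKn.
by rewrite fE -addnS addKn.
Qed.

Variables (m n : nat) (s t : seq nat).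
Hypothesis sm : sumn s = m.

Lemma young_prod (g : 'S_m) (h : 'S_n) :
  g \in young m s -> h \in young n t -> permprod g h \in young (m + n) (s ++ t).
Proof.
move=> /youngP gP /youngP hP; apply/youngP; apply: split_ind => i.
  by rewrite permprodl /= !reshape_index_catl ?gP // sm.
by rewrite permprodr /= -sm !reshape_index_catr hP.
Qed.

Lemma young_prod_inv (w : 'S_(m + n)) :
  w \in young (m + n) (s ++ t) ->
  exists g h, [/\ g \in young m s, h \in young n t & w = permprod g h].
Proof.
move=> /youngP wP.
have lE (i : 'I_(m + n)) : (i < m)%N = (reshape_index (s ++ t) i < size s)%N.
  case: (ltnP i m) => im.
    by rewrite reshape_index_catl ?sm // reshape_indexP ?sm.
  by rewrite -(subnKC im) -[X in (X + _)%N]sm reshape_index_catr ltnNge leq_addr.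
have rE j : reshape_index (s ++ t) (m + j) = (size s + reshape_index t j)%N.
  by rewrite -sm reshape_index_catr.
have wl (i : 'I_m) : (w (lshift n i) < m)%N by rewrite lE wP -lE /=.
have wr (i : 'I_n) : (w (rshift m i) - m < n)%N.
  have := ltn_ord (w (rshift m i)); have := lE (w (rshift m i)).
  by rewrite wP -lE /=; lia.
have wr' (i : 'I_n) : (m <= w (rshift m i))%N.
  by have := lE (w (rshift m i)); rewrite wP -lE /=; lia.
have gi : injective (fun i => Ordinal (wl i)).
  by move=> i j [] /val_inj /perm_inj /eqP; rewrite eq_lshift => /eqP.
have hi : injective (fun i => Ordinal (wr i)).
  move=> i j [] /(congr1 (addn m)); rewrite !subnKC // => /val_inj /perm_inj /eqP.
  by rewrite eq_rshift => /eqP.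
have wE : w = permprod (perm gi) (perm hi).
  apply/permP; apply: split_ind => i; rewrite ?permprodl ?permprodr permE;
    apply: val_inj => //=.
  by rewrite subnKC.
exists (perm gi), (perm hi); split=> //; apply/youngP => i.
- have := wP (lshift n i); rewrite {1}wE permprodl /=.
  by rewrite !reshape_index_catl ?sm.
- have := wP (rshift m i); rewrite {1}wE permprodr /=.
  by rewrite !rE => /addnI.
Qed.

End PermProd.

Section Iota.
Variables (K : fieldType) (m n : nat) (s t : seq nat).
Implicit Types (u : pmod K m s) (v : pmod K n t).

(* The S_m x S_n-equivariant bilinear map M^s_m x M^t_n -> M^(s,t)_(m + n),
   (S_s g, S_t h) |-> S_(s,t) (g x h), through which M^(s,t)_(m + n) is the
   induced module of M^s_m [x] M^t_n. *)
Definition pouter u v : pmod K (m + n) (s ++ t) :=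
  \sum_X \sum_Y (u X * v Y) *:
    ebas K (ycos (s ++ t) (permprod (yrepr X) (yrepr Y))).

Lemma pouter_linl (k : K) u u' v :
  pouter (k *: u + u') v = k *: pouter u v + pouter u' v.
Proof.
rewrite /pouter scaler_sumr -big_split; apply: eq_bigr => X _ /=.
rewrite scaler_sumr -big_split; apply: eq_bigr => Y _ /=.
by rewrite !ffunE scalerA -scalerDl; congr (_ *: _); rewrite mulrDl mulrA.
Qed.

Lemma pouter_linr (k : K) u v v' :
  pouter u (k *: v + v') = k *: pouter u v + pouter u v'.
Proof.
rewrite /pouter scaler_sumr -big_split; apply: eq_bigr => X _ /=.
rewrite scaler_sumr -big_split; apply: eq_bigr => Y _ /=.
rewrite !ffunE scalerA -scalerDl; congr (_ *: _).
by rewrite mulrDr mulrCA.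
Qed.

Lemma pouter0l v : pouter 0 v = 0.
Proof.
rewrite /pouter big1 // => X _; rewrite big1 // => Y _.
by rewrite ffunE mul0r scale0r.
Qed.

Lemma pouter0r u : pouter u 0 = 0.
Proof.
rewrite /pouter big1 // => X _; rewrite big1 // => Y _.
by rewrite ffunE mulr0 scale0r.
Qed.

Hypothesis sm : sumn s = m.

Lemma pouter_ebas (g : 'S_m) (h : 'S_n) :
  pouter (ebas K (ycos s g)) (ebas K (ycos t h)) =
  ebas K (ycos (s ++ t) (permprod g h)).
Proof.
rewrite /pouter (bigD1 (ycos s g)) //= [X in _ + X]big1 => [|X /negPf nX]; last first.
  by rewrite big1 // => Y _; rewrite ffunE nX mul0r scale0r.
rewrite addr0 (bigD1 (ycos t h)) //= [X in _ + X]big1 => [|Y /negPf nY]; last first.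
  by rewrite [X in (_ * X) *: _]ffunE nY mulr0 scale0r.
rewrite addr0 !ffunE !eqxx mulr1 scale1r; congr ebas; apply: ycosE.
by rewrite permprodV permprodM young_prod ?yrepr_cos.
Qed.

Lemma pouter_pact u v (g : 'S_m) (h : 'S_n) :
  pouter (pact u g) (pact v h) = pact (pouter u v) (permprod g h).
Proof.
elim/pmod_ind: u => [k u u' eu eu'|x].
  by rewrite pact_lin !pouter_linl eu eu' pact_lin.
elim/pmod_ind: v => [k v v' ev ev'|y].
  by rewrite pact_lin !pouter_linr ev ev' pact_lin.
rewrite (pact_ycos _ _ x g) (pact_ycos _ _ y h).
apply: etrans (pouter_ebas (x * g)%g (y * h)%g) _; rewrite -permprodM.
apply: etrans (esym (pact_ycos _ _ _ _)) _.
by congr pact; apply: esym (pouter_ebas x y).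
Qed.

End Iota.

Section PTens.
Variable K : fieldType.
Variables (a b c d : pob) (f : phom K a b) (g : phom K c d).

Definition pone (x : pob) : pmodo K x := ebas K (ycos (pshape x) 1%g).

(* Ind(f [x] g): the unique equivariant map with
   (pouter u v).w |-> (pouter (f u) (g v)).w, see [ptensE].  It is given here by
   its values on the cosets S_(a,c) w = (pouter (pone a) (pone c)).w. *)
Definition ptens_fun (v : pmodo K (pprod a c)) : pmodo K (pprod b d) :=
  \sum_Z v Z *: pact (pouter (f (pone a)) (g (pone c)))
                     (permto (pdeg (pprod b d)) (yrepr Z)).

Lemma ptens_linear : linear ptens_fun.
Proof.
move=> k u v; rewrite /ptens_fun scaler_sumr -big_split; apply: eq_bigr => Z _ /=.
by rewrite !ffunE scalerA -scalerDl.
Qed.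

HB.instance Definition _ := GRing.isLinear.Build K _ _ _ ptens_fun ptens_linear.

Lemma pone_young (x : pob) (w : 'S_(pdeg x)) :
  w \in young (pdeg x) (pshape x) -> pact (pone x) w = pone x.
Proof.
move=> wY; rewrite /pone pact_ebas ymul_cos mul1g; congr ebas.
by apply: ycosE; rewrite invg1 mulg1.
Qed.

Lemma ptens_key (w : 'S_(pdeg (pprod a c))) :
  ptens_fun (ebas K (ycos (pshape (pprod a c)) w)) =
  pact (pouter (f (pone a)) (g (pone c))) (permto (pdeg (pprod b d)) w).
Proof.
rewrite /ptens_fun (bigD1 (ycos (pshape (pprod a c)) w)) //= big1 => [|Z /negPf nZ].
  rewrite addr0 ffunE eqxx scale1r.
  have [ab|f0] := phom_deg f; last by rewrite !f0 pouter0l !pact0.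
  have [cd|g0] := phom_deg g; last by rewrite !g0 pouter0r !pact0.
  have /(young_prod_inv (eqP (pob_sum a)))[x [y [xa yc e]]] :=
    yrepr_cos (pshape a ++ pshape c) w.
  have -> : yrepr (ycos (pshape (pprod a c)) w) = (permprod x y * w)%g.
    by rewrite -e mulgKV.
  rewrite permtoM /= ?ab ?cd // permto_prod //.
  rewrite -pactM -pouter_pact ?(eqP (pob_sum b)) //.
  by rewrite -!phomP !pone_young.
by rewrite ffunE nZ scale0r.
Qed.

Lemma ptens_subproof :
  (linfun ptens_fun : 'Hom(pmodo K (pprod a c), pmodo K (pprod b d)))
    \in @ishom K (pprod a c) (pprod b d).
Proof.
rewrite unfold_in /ishom; case: eqP => /= e.
  apply/asboolP => v x; rewrite !lfunE /=; elim/pmod_ind: v => [k u v eu ev|w].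
    by rewrite pact_lin !ptens_linear eu ev pact_lin.
  rewrite pact_ebas ymul_cos.
  apply: etrans (ptens_key (w * x)%g) _.
  apply: etrans (esym (congr1 (fun z => pact z _) (ptens_key w))).
  by rewrite pactM (permtoM _ _ e).
apply/eqP/lfunP => v; rewrite !lfunE /= /ptens_fun big1 // => Z _.
have [ab|f0] := phom_deg f; last by rewrite !f0 pouter0l !pact0 scaler0.
have [cd|g0] := phom_deg g; last by rewrite !g0 pouter0r !pact0 scaler0.
by case: e; rewrite ab cd.
Qed.

Definition ptens : phom K (pprod a c) (pprod b d) := PHom ptens_subproof.

Lemma ptensE (u : pmodo K a) (v : pmodo K c) (w : 'S_(pdeg (pprod a c))) :
  ptens (pact (pouter u v) w) =
  pact (pouter (f u) (g v)) (permto (pdeg (pprod b d)) w).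
Proof.
rewrite phomP; congr pact.
elim/pmod_ind: u => [k u u' eu eu'|x].
  by rewrite pouter_linl linearP /= eu eu' linearP pouter_linl.
elim/pmod_ind: v => [k v v' ev ev'|y].
  by rewrite pouter_linr linearP /= ev ev' linearP pouter_linr.
rewrite pouter_ebas ?(eqP (pob_sum a)) // /ptens /= lfunE /= ptens_key.
have [ab|f0] := phom_deg f; last first.
  have fz u z : pouter (f u) z = 0 :> pmodo K (pprod b d) by rewrite f0 pouter0l.
  exact: etrans (congr1 (fun z => pact z _) (fz _ _)) (etrans (pact0 _ _ _) (esym (fz _ _))).
have [cd|g0] := phom_deg g; last first.
  have gz u z : pouter z (g u) = 0 :> pmodo K (pprod b d) by rewrite g0 pouter0r.
  exact: etrans (congr1 (fun z => pact z _) (gz _ _)) (etrans (pact0 _ _ _) (esym (gz _ _))).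
rewrite /= permto_prod //.
apply: etrans (esym (pouter_pact (eqP (pob_sum b)) _ _ _ _)) _.
by congr pouter; rewrite -phomP; congr (_ _); apply: esym (ebas_cos _ _ _).
Qed.

End PTens.

Section PermCat.
Variable K : fieldType.

Definition perm_data : lmcat_data K :=
  @LMCatData K pob (fun a b => phom K a b : lmodType K)
    (@pid K) (@pcomp K) (Mob [::]) pprod (@ptens K).

Lemma pouter_pone (a c : pob) :
  pouter (pone K a) (pone K c) = pone K (pprod a c).
Proof.
apply: etrans (pouter_ebas K (pshape c) (eqP (pob_sum a)) 1%g 1%g) _.
by rewrite permprod1.
Qed.

Lemma ebas_pprod (a c : pob) (w : 'S_(pdeg (pprod a c))) :
  ebas K (ycos (pshape (pprod a c)) w) = pact (pouter (pone K a) (pone K c)) w.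
Proof. by rewrite pouter_pone; apply: ebas_cos. Qed.

Lemma permto_transr (m n p : nat) (g : 'S_m) :
  n = p -> permto p (permto n g) = permto p g.
Proof. by move=> e; case: p / e; rewrite permto_id. Qed.

Lemma permto1 (m n : nat) : permto n (1%g : 'S_m) = 1%g.
Proof. by rewrite /permto; case: eqP => // e; case: n / e. Qed.

Lemma ptensE1 (a b c d : pob) (f : phom K a b) (g : phom K c d) u v :
  ptens f g (pouter u v) = pouter (f u) (g v).
Proof.
by have := ptensE f g u v 1; rewrite permto1 !pact1.
Qed.

Lemma phom_ext2 (a c b : pob) (f f' : phom K (pprod a c) b) :
  (forall u v w, f (pact (pouter u v) w) = f' (pact (pouter u v) w)) -> f = f'.
Proof.
move=> ff; apply: phom_eq => w.
apply: etrans (congr1 f (ebas_pprod w)) (etrans (ff _ _ _) _).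
exact: esym (congr1 f' (ebas_pprod w)).
Qed.

(* Transport of vectors along an equality of objects. *)
Definition mcast (a a' : pob) (v : pmodo K a) : pmodo K a' :=
  [ffun Y => v (ycos (pshape a) (permto (pdeg a) (yrepr Y)))].

Lemma mcast_id (a : pob) (v : pmodo K a) : mcast a v = v.
Proof. by apply/ffunP => Y; rewrite ffunE permto_id yreprK. Qed.

Lemma mcast_lin (a a' : pob) (k : K) (u v : pmodo K a) :
  mcast a' (k *: u + v) = k *: mcast a' u + mcast a' v.
Proof. by apply/ffunP => Y; rewrite !ffunE. Qed.

Lemma mcast_pact (a a' : pob) (v : pmodo K a) (w : 'S_(pdeg a)) :
  a = a' -> mcast a' (pact v w) = pact (mcast a' v) (permto (pdeg a') w).
Proof. by move=> e; case: a' / e; rewrite !mcast_id permto_id. Qed.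

Lemma mcast_ebas (a a' : pob) (w : 'S_(pdeg a)) :
  a = a' -> mcast a' (ebas K (ycos (pshape a) w)) =
    ebas K (ycos (pshape a') (permto (pdeg a') w)).
Proof. by move=> e; case: a' / e; rewrite !mcast_id permto_id. Qed.

Lemma phom_Arr (a b a' b' : pob) (f : phom K a b) (f' : phom K a' b') :
  a = a' -> b = b' ->
  (forall w, mcast b' (f (ebas K (ycos (pshape a) w)))
             = f' (mcast a' (ebas K (ycos (pshape a) w)))) ->
  @Arr K perm_data a b f = @Arr K perm_data a' b' f'.
Proof.
move=> ea eb; case: a' / ea f'; case: b' / eb => f' ff.
suff -> : f = f' by [].
by apply: phom_eq => w; rewrite -[LHS]mcast_id ff mcast_id.
Qed.

Lemma pprodA (a b c : pob) : pprod a (pprod b c) = pprod (pprod a b) c.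
Proof. by apply: pob_eq; [exact: addnA | exact: catcA]. Qed.

Lemma pprod1o (a : pob) : pprod (Mob [::]) a = a.
Proof. by apply: pob_eq => //; exact: cat0c. Qed.

Lemma pprodo1 (a : pob) : pprod a (Mob [::]) = a.
Proof. by apply: pob_eq; [exact: addn0 | exact: catc0]. Qed.

Lemma mcast_pouterA (a b c : pob) (u : pmodo K a) (v : pmodo K b)
    (w : pmodo K c) :
  mcast (pprod (pprod a b) c) (pouter u (pouter v w) : pmodo K (pprod a (pprod b c)))
  = pouter (pouter u v) w.
Proof.
elim/pmod_ind: u => [k u u' eu eu'|x].
  by rewrite !pouter_linl mcast_lin eu eu'.
elim/pmod_ind: v => [k v v' ev ev'|y].
  by rewrite !(pouter_linl, pouter_linr) mcast_lin ev ev'.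
elim/pmod_ind: w => [k w w' ew ew'|z].
  by rewrite !pouter_linr mcast_lin ew ew'.
have sa := eqP (pob_sum a); have sb := eqP (pob_sum b).
have sab := eqP (pob_sum (pprod a b)).
pose T := pmodo K (pprod a (pprod b c)).
transitivity (mcast (pprod (pprod a b) c)
    (ebas K (ycos (pshape a ++ pshape b ++ pshape c) (permprod x (permprod y z))) : T)).
  congr mcast; transitivity (pouter (ebas K (ycos (pshape a) x))
      (ebas K (ycos (pshape b ++ pshape c) (permprod y z))));
    last exact: pouter_ebas.
  by congr pouter; apply: pouter_ebas.
apply: etrans (@mcast_ebas (pprod a (pprod b c)) _ _ (pprodA a b c)) _.
transitivity (ebas K (ycos ((pshape a ++ pshape b) ++ pshape c)
    (permprod (permprod x y) z))); last first.
  transitivity (pouter (ebas K (ycos (pshape a ++ pshape b) (permprod x y)))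
      (ebas K (ycos (pshape c) z))); first exact: esym (pouter_ebas _ _ sab _ _).
  by congr pouter; apply: esym (pouter_ebas _ _ sa _ _).
congr (ebas K (ycos _ _)); apply/permP => i; apply: val_inj.
rewrite /= (permtoE (addnA (pdeg a) (pdeg b) (pdeg c))).
elim/split_ind: i => [i|i].
  rewrite permprodl /=; elim/split_ind: i => [i|i].
    rewrite permprodl /= [cast_ord _ _](_ : _ = lshift _ i) ?permprodl //.
    exact: val_inj.
  rewrite permprodr /= [cast_ord _ _](_ : _ = rshift _ (lshift _ i)) ?permprodr ?permprodl //.
  exact: val_inj.
rewrite permprodr /= [cast_ord _ _](_ : _ = rshift _ (rshift _ i)) ?permprodr /= ?addnA //.
by apply: val_inj; rewrite /= addnA.
Qed.

Lemma mcast_pouter1 (a : pob) (v : pmodo K a) :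
  mcast a (pouter (pone K (Mob [::])) v : pmodo K (pprod (Mob [::]) a)) = v.
Proof.
elim/pmod_ind: v => [k v v' ev ev'|y].
  by rewrite pouter_linr mcast_lin ev ev'.
apply: etrans (congr1 (mcast _) (pouter_ebas K _ (eqP (pob_sum (Mob [::]))) _ y)) _.
apply: etrans (@mcast_ebas (pprod (Mob [::]) a) _ _ (pprod1o a)) _.
congr (ebas K (ycos _ _)); apply/permP => i; apply: val_inj.
apply: etrans (permtoE (erefl : pdeg (pprod (Mob [::]) a) = pdeg a) _ _) _.
rewrite [cast_ord _ _](_ : _ = rshift _ i) ?permprodr //.
exact: val_inj.
Qed.

Lemma mcast_pouterr1 (a : pob) (v : pmodo K a) :
  mcast a (pouter v (pone K (Mob [::])) : pmodo K (pprod a (Mob [::]))) = v.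
Proof.
elim/pmod_ind: v => [k v v' ev ev'|y].
  by rewrite pouter_linl mcast_lin ev ev'.
apply: etrans (congr1 (@mcast (pprod a (Mob [::])) a) (pouter_ebas K
  (pshape (Mob [::])) (eqP (pob_sum a)) y (1%g : 'S_(pdeg (Mob [::]))))) _.
apply: etrans (@mcast_ebas (pprod a (Mob [::])) _ _ (pprodo1 a)) _.
congr (ebas K (ycos _ _)); apply/permP => i; apply: val_inj.
apply: etrans (permtoE (addn0 (pdeg a)) _ _) _.
rewrite [cast_ord _ _](_ : _ = lshift _ i) ?permprodl //.
exact: val_inj.
Qed.

Lemma perm_axioms : lmcat_axioms perm_data.
Proof.
split=> /=.
- by move=> a b c d h g f; apply: val_inj; apply/lfunP => v; rewrite !comp_lfunE.
- by move=> a b f; apply: val_inj; apply/lfunP => v; rewrite comp_lfunE id_lfunE.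
- by move=> a b f; apply: val_inj; apply/lfunP => v; rewrite comp_lfunE id_lfunE.
- move=> a b c f k g g'; apply: val_inj; apply/lfunP => v.
  by rewrite /= !(comp_lfunE, add_lfunE, scale_lfunE).
- move=> a b c g k f f'; apply: val_inj; apply/lfunP => v.
  by rewrite /= !(comp_lfunE, add_lfunE, scale_lfunE) linearP.
- exact: pprodA.
- exact: pprod1o.
- exact: pprodo1.
- move=> a b c d g k f f'; apply: phom_ext2 => u v w.
  rewrite ptensE /= add_lfunE scale_lfunE pouter_linl pact_lin.
  by rewrite add_lfunE scale_lfunE -!ptensE.
- move=> a b c d f k g g'; apply: phom_ext2 => u v w.
  rewrite ptensE /= add_lfunE scale_lfunE pouter_linr pact_lin.
  by rewrite add_lfunE scale_lfunE -!ptensE.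
- move=> a b; apply: phom_ext2 => u v w.
  by rewrite ptensE /= !id_lfunE permto_id.
- move=> a b c a' b' c' g f g' f'; apply: phom_ext2 => u v w.
  rewrite ptensE /= !comp_lfunE.
  apply: esym; apply: etrans (congr1 _ (ptensE f f' u v w)) _.
  apply: etrans (ptensE g g' _ _ _) _.
  have [ab|f0] := phom_deg f; last first.
    by rewrite (f0 u) linear0 !pouter0l !pact0.
  have [cd|g0] := phom_deg f'; last first.
    by rewrite (g0 v) linear0 !pouter0r !pact0.
  by rewrite permto_trans //= ab cd.
- move=> a b c a' b' c' f g h.
  apply: phom_Arr; [exact: pprodA | exact: pprodA |] => w.
  pose e := pouter (pone K a) (pouter (pone K b) (pone K c)).
  have -> : ebas K (ycos (pshape (pprod a (pprod b c))) w) =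
      pact (e : pmodo K (pprod a (pprod b c))) w.
    apply: etrans (ebas_pprod w) _; congr pact.
    by congr pouter; apply: esym (pouter_pone b c).
  apply: etrans (congr1 (mcast _) (ptensE f (ptens g h) _ _ w)) _.
  apply: etrans (mcast_pact _ _ (pprodA a' b' c')) _.
  apply: esym; apply: etrans (congr1 _ (mcast_pact _ _ (pprodA a b c))) _.
  rewrite mcast_pouterA; apply: etrans (ptensE (ptens f g) h _ _ _) _.
  rewrite !ptensE1 -mcast_pouterA; congr pact.
  rewrite (permto_transr _ (addnA (pdeg a') (pdeg b') (pdeg c'))).
  exact: permto_trans (addnA (pdeg a) (pdeg b) (pdeg c)).
- move=> a b f; apply: phom_Arr; [exact: pprod1o | exact: pprod1o |] => w.
  have wE : ebas K (ycos (pshape (pprod (Mob [::]) a)) w) =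
      pact (pouter (pone K (Mob [::])) (pone K a)) w := ebas_pprod w.
  rewrite wE; apply: etrans (congr1 (mcast _) (ptensE _ f _ _ w)) _.
  apply: etrans (mcast_pact _ _ (pprod1o b)) _.
  apply: esym; apply: etrans (congr1 _ (mcast_pact _ _ (pprod1o a))) _.
  rewrite phomP mcast_pouter1 id_lfunE mcast_pouter1; congr pact.
  rewrite (permto_transr _ (erefl : pdeg (pprod (Mob [::]) b) = pdeg b)).
  exact: permto_trans (erefl : pdeg (pprod (Mob [::]) a) = pdeg a).
- move=> a b f; apply: phom_Arr; [exact: pprodo1 | exact: pprodo1 |] => w.
  rewrite ebas_pprod; apply: etrans (congr1 (mcast _) (ptensE f _ _ _ w)) _.
  apply: etrans (mcast_pact _ _ (pprodo1 b)) _.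
  apply: esym; apply: etrans (congr1 _ (mcast_pact _ _ (pprodo1 a))) _.
  rewrite phomP mcast_pouterr1 id_lfunE mcast_pouterr1; congr pact.
  rewrite (permto_transr _ (addn0 (pdeg b))).
  exact: permto_trans (addn0 (pdeg a)).
Qed.

Definition Perm : lmcat K := LMCat perm_axioms.

Section Generators.
Variables k l : nat.

(* M^{k+l} = K: the coset space of S_{k+l} in itself is a point. *)
Definition nabla_fun (v : pmodo K (Mob [:: k; l])) : pmodo K (Mob [:: (k + l)%N]) :=
  (\sum_X v X) *: pone K (Mob [:: (k + l)%N]).

Definition delta_fun (v : pmodo K (Mob [:: (k + l)%N])) : pmodo K (Mob [:: k; l]) :=
  v (ycos _ 1%g) *: ((k`! * l`!)%N%:R^-1 *:
    \sum_(g : 'S_(pdeg (Mob [:: k; l]))) ebas K (ycos _ g)).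

Lemma nabla_linear : linear nabla_fun.
Proof.
move=> c u v; rewrite /nabla_fun scalerA -scalerDl; congr (_ *: _).
by rewrite mulr_sumr -big_split; apply: eq_bigr => X _; rewrite !ffunE.
Qed.

Lemma delta_linear : linear delta_fun.
Proof.
by move=> c u v; rewrite /delta_fun [in RHS]scalerA -scalerDl !ffunE.
Qed.

HB.instance Definition _ := GRing.isLinear.Build K _ _ _ nabla_fun nabla_linear.
HB.instance Definition _ := GRing.isLinear.Build K _ _ _ delta_fun delta_linear.

Lemma young1 (n : nat) (g : 'S_(pdeg (Mob [:: n]))) :
  g \in young (pdeg (Mob [:: n])) (pshape (Mob [:: n])).
Proof.
apply/youngP => i; have s1 : (size (strip [:: n]) <= 1)%N.
  by rewrite /=; case: eqP.
have ri (j : 'I_(pdeg (Mob [:: n]))) : reshape_index (strip [:: n]) j = 0%N.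
  have := @reshape_indexP (strip [:: n]) j; rewrite sumn_strip ltn_ord.
  by move=> /(_ isT) /leq_trans /(_ s1); rewrite ltnS leqn0 => /eqP.
by rewrite !ri.
Qed.

Lemma ycos1 (n : nat) (g h : 'S_(pdeg (Mob [:: n]))) :
  ycos (pshape (Mob [:: n])) g = ycos (pshape (Mob [:: n])) h.
Proof. by apply: ycosE; apply: young1. Qed.

Lemma nabla_subproof :
  linfun nabla_fun \in @ishom K (Mob [:: k; l]) (Mob [:: (k + l)%N]).
Proof.
rewrite unfold_in /ishom; case: eqP => [_|[]]; last by rewrite /= addnA.
apply/asboolP => v g.
rewrite !lfunE /= /nabla_fun.
have pl (c : K) (u : pmodo K (Mob [:: (k + l)%N])) h : pact (c *: u) h = c *: pact u h.
  by have := pact_lin h c u 0; rewrite pact0 !addr0.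
rewrite pl /pone pact_ycos (ycos1 _ 1%g); congr (_ *: _).
rewrite (reindex_inj (h := fun X => ymul X g)) /=; last first.
  by move=> X Y /(congr1 (fun Z => ymul Z g^-1%g)); rewrite !ymulA mulgV !ymul1.
by apply: eq_bigr => X _; rewrite ffunE ymulA mulgV ymul1.
Qed.

Lemma delta_subproof :
  linfun delta_fun \in @ishom K (Mob [:: (k + l)%N]) (Mob [:: k; l]).
Proof.
rewrite unfold_in /ishom; case: eqP => [_|[]]; last by rewrite /= addnA.
apply/asboolP => v g.
rewrite !lfunE /= /delta_fun.
have pl (c : K) (u : pmodo K (Mob [:: k; l])) h : pact (c *: u) h = c *: pact u h.
  by have := pact_lin h c u 0; rewrite pact0 !addr0.
rewrite !pl ffunE ymul_cos (ycos1 _ 1%g); congr (_ *: (_ *: _)).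
have ps (h : 'S_(pdeg (Mob [:: k; l]))) (I : finType) (F : I -> pmodo K (Mob [:: k; l])) :
    pact (\sum_i F i) h = \sum_i pact (F i) h.
  by apply/ffunP => X; rewrite ffunE !sum_ffunE; apply: eq_bigr => i _; rewrite ffunE.
rewrite ps (reindex_inj (mulIg (permto (pdeg (Mob [:: k; l])) g))) /=.
by apply: eq_bigr => h _; rewrite pact_ycos.
Qed.

Definition nabla : @mhom K Perm (Mob [:: k; l]) (Mob [:: (k + l)%N]) :=
  PHom nabla_subproof.

Definition delta : @mhom K Perm (Mob [:: (k + l)%N]) (Mob [:: k; l]) :=
  PHom delta_subproof.

End Generators.

Inductive nabla_delta : arrow Perm -> Prop :=
  | nd_nabla k l : nabla_delta (Arr (nabla k l))
  | nd_delta k l : nabla_delta (Arr (delta k l)).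

Definition Gamma_spec (G : lmfunctor (SpPerm K) Perm) : Prop :=
  [/\ forall a : composition, fob G a = Mob a,
      forall k l : nat, Arr (fmor G _ _ (spmerge K k l)) = Arr (nabla k l)
    & forall k l : nat, Arr (fmor G _ _ (spsplit K k l)) = Arr (delta k l)].

End PermCat.

(* Main.v *)
From HB Require Import structures.
From mathcomp Require Import all_boot all_order all_fingroup all_algebra.
From mathcomp Require Import boolp zify ring ssrAC.
Require Import Defs.

(** Both categories are compared with the group algebras of the symmetric groups.

    An equivariant map M^a -> M^b is determined by the image of the trivial coset
    of S_a, an S_a-invariant vector of M^b, hence by a function on S_d that is
    invariant under S_b on the left and under S_a on the right (hsym, hsym_inj,
    hsym_surj).  For this symbol, composition is convolution divided by the order
    of the Young subgroup of the middle object, the monoidal product is the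
    embedding of the group algebra of S_m x S_n in that of S_(m + n), and both
    nabla and delta have the constant symbol 1.  The same formulas define a symbol
    for every diagram (ev).  All the relations of Sp(Perm) hold for symbols
    (deq_ev); the only one that needs an argument is the square-switch relation
    (ev_EF), which for two-part compositions becomes a count of subsets and reduces
    to the Vandermonde identity with an upper index of arbitrary sign.

    It remains to see that symbols identify the morphisms a -> b of Sp(Perm) with
    all bi-invariant functions.  As k! is invertible, a strand labelled k is a
    direct summand of k strands labelled 1: the iterated split followed by the
    iterated merge is k! (mrg_spl).  On strands labelled 1, the split after the
    merge of two neighbours, minus 1, is a crossing.  Crossings satisfy the Coxeter
    relations: the quadratic one from the merge-split relation, the braid relation
    from the square-switch relation at the weights (2, 1) and (1, 2) (braid_X).  The
    square-switch relation at (k, 1) expresses the split after the merge of k + 1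
    strands by the one of k strands and a crossing (alg_flatten); therefore
    every endomorphism of d strands labelled 1 is a combination of words in
    crossings (red_alg, alg_span).  The Coxeter relations present S_d
    (cox_complete), so there is one word for each permutation, and its symbol is
    the indicator of that permutation.  Symbols are thus faithful and full on
    strands labelled 1, and by flattening everywhere (evs_inj, ev_onto).

    The functor Gamma and its inverse match the morphisms that have the same
    symbol.  A functor with the prescribed values on merges and splits preserves
    symbols, which gives uniqueness (gamma_unique), and every arrow of Perm has the
    symbol of some diagram, which gives generation (generated_all). *)

Set Implicit Arguments.
Unset Strict Implicit.
Unset Printing Implicit Defensive.

Import GRing.Theory.
Local Open Scope ring_scope.

(** * Young subgroups *)

Section YoungSubgroups.
Local Open Scope group_scope.

Lemma permprod_inj2 m n (x x' : 'S_m) (y y' : 'S_n) :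
  permprod x y = permprod x' y' -> x = x' /\ y = y'.
Proof.
move=> /permP e; split; apply/permP => i.
  by have /eqP := e (lshift n i); rewrite !permprodl eq_lshift => /eqP.
by have /eqP := e (rshift m i); rewrite !permprodr eq_rshift => /eqP.
Qed.

Lemma eq_permprod m n (x x' : 'S_m) (y y' : 'S_n) :
  (permprod x y == permprod x' y') = (x == x') && (y == y').
Proof.
by apply/eqP/andP => [/permprod_inj2[-> ->]|[/eqP-> /eqP->]].
Qed.

Lemma permprodA m n p (x : 'S_m) (y : 'S_n) (z : 'S_p) :
  permto (m + (n + p)) (permprod (permprod x y) z) =
    permprod x (permprod y z).
Proof.
apply/permP => i; apply: val_inj; rewrite /= (permtoE (esym (addnA m n p))).
elim/split_ind: i => [i|i].
  rewrite permprodl /= [cast_ord _ _](_ : _ = lshift p (lshift n i)).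
    by rewrite !permprodl.
  exact: val_inj.
elim/split_ind: i => [i|i].
  rewrite permprodr permprodl /=.
  rewrite [cast_ord _ _](_ : _ = lshift p (rshift m i)).
    by rewrite permprodl permprodr.
  exact: val_inj.
rewrite !permprodr /= [cast_ord _ _](_ : _ = rshift (m + n) i).
  by rewrite permprodr /= addnA.
by apply: val_inj; rewrite /= addnA.
Qed.

Lemma permprod0l n (x : 'S_0) (y : 'S_n) : permprod x y = y.
Proof.
apply/permP; apply: split_ind => [[//]|i]; rewrite permprodr.
rewrite [in RHS](_ : rshift 0 i = i); exact: val_inj.
Qed.

Lemma permprod0r m (x : 'S_m) (y : 'S_0) : permto m (permprod x y) = x.
Proof.
apply/permP => i; apply: val_inj; rewrite /= (permtoE (addn0 m)).
rewrite [cast_ord _ _](_ : _ = lshift 0 i) ?permprodl //.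
exact: val_inj.
Qed.

Lemma young_size1 d (s : seq nat) (w : 'S_d) :
  sumn s = d -> (size s <= 1)%N -> w \in young d s.
Proof.
move=> sd s1; apply/youngP => i.
have ri (j : 'I_d) : reshape_index s j = 0%N.
  have := @reshape_indexP s j; rewrite sd ltn_ord.
  by move=> /(_ isT) /leq_trans /(_ s1); rewrite ltnS leqn0 => /eqP.
by rewrite !ri.
Qed.

Lemma young_strip1 k (w : 'S_k) : w \in young k (strip [:: k]).
Proof.
by apply: young_size1; rewrite ?sumn_strip /= ?addn0 //; case: ifP.
Qed.

Lemma permprod_young m n (s t : seq nat) (x : 'S_m) (y : 'S_n) : sumn s = m ->
  (permprod x y \in young (m + n) (s ++ t)) =
    (x \in young m s) && (y \in young n t).
Proof.
move=> sm; apply/idP/andP => [|[]]; last exact: young_prod.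
move=> /(young_prod_inv sm)[x' [y' [xs yt /permprod_inj2[-> ->]]]].
by [].
Qed.

Lemma card_young_cat m n (s t : seq nat) : sumn s = m ->
  #|young (m + n) (s ++ t)| = (#|young m s| * #|young n t|)%N.
Proof.
move=> sm; rewrite -cardsX.
have inj : injective (fun u : 'S_m * 'S_n => permprod u.1 u.2).
  by move=> [x y] [x' y'] /= /permprod_inj2[-> ->].
rewrite -(card_imset _ inj); apply: eq_card => w.
apply/idP/imsetP => [/(young_prod_inv sm)[x [y [xs yt ->]]]|].
  by exists (x, y); rewrite // inE xs.
by move=> [[x y]]; rewrite inE /= => /andP[xs yt] ->; rewrite permprod_young ?xs.
Qed.

Definition ycard (a : composition) : nat := #|young (sumn a) a|.

Lemma ycard_gt0 a : (0 < ycard a)%N.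
Proof. exact: cardG_gt0. Qed.

Lemma ycard_cat a b : ycard (catc a b) = (ycard a * ycard b)%N.
Proof. by rewrite /ycard /= sumn_cat card_young_cat. Qed.

Lemma ycard1 k : ycard (strip [:: k]) = k`!.
Proof.
rewrite /ycard sumn_strip /= addn0 -[RHS]card_Sn.
by apply: eq_card => w; rewrite young_strip1.
Qed.

Lemma ycard2 k l : ycard (strip [:: k; l]) = (k`! * l`!)%N.
Proof. by rewrite -cat1s strip_cat ycard_cat !ycard1. Qed.

End YoungSubgroups.

(** * Graded group algebras *)

Section GradedFunctions.
Variable K : fieldType.

(** Elements of the product over all d of the group algebras of S_d.  Keeping
    every degree in one type lets objects that are equal but not convertible
    have symbols in the same type, so that no transport is ever needed to
    compare them. *)
Definition gfun : Type := forall d : nat, 'S_d -> K.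

Implicit Types f g h : gfun.

Lemma gfunP f g : (forall d w, f d w = g d w) -> f = g.
Proof.
by move=> fg; apply: functional_extensionality_dep => d; apply/funext => w.
Qed.

Definition gconv f g : gfun := fun d w => \sum_z f d (w * z^-1)%g * g d z.

(** The induction product: f [x] g viewed in the group algebra of S_(m + n)
    through the embedding of S_m x S_n. *)
Definition gtens (m n : nat) f g : gfun := fun d w =>
  if d == (m + n)%N then
    \sum_x \sum_y (permto d (permprod x y) == w)%:R * (f m x * g n y)
  else 0.

Lemma gtensE m n f g d (w : 'S_d) : d = (m + n)%N -> gtens m n f g w =
  \sum_x \sum_y (permto d (permprod x y) == w)%:R * (f m x * g n y).
Proof. by move=> /eqP e; rewrite /gtens e. Qed.

Lemma gtens_sum m n f g (F : 'S_(m + n) -> K) :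
  \sum_w F w * gtens m n f g w =
  \sum_x \sum_y F (permprod x y) * (f m x * g n y).
Proof.
rewrite /gtens eqxx; under eq_bigr => w _ do rewrite mulr_sumr.
rewrite exchange_big /=; apply: eq_bigr => x _.
under eq_bigr => w _ do rewrite mulr_sumr.
rewrite exchange_big /=; apply: eq_bigr => y _.
rewrite permto_id (bigD1 (permprod x y)) //= eqxx mul1r big1 ?addr0 // => w.
by rewrite eq_sym => /negPf->; rewrite mul0r mulr0.
Qed.

Lemma gtens_permprod m n f g (x : 'S_m) (y : 'S_n) :
  gtens m n f g (permprod x y) = f m x * g n y.
Proof.
rewrite /gtens eqxx (bigD1 x) //= [X in _ + X]big1 ?addr0 => [|x' /negPf nx].
  rewrite (bigD1 y) //= [X in _ + X]big1 ?addr0 => [|y' /negPf ny].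
    by rewrite permto_id eqxx mul1r.
  by rewrite permto_id eq_permprod ny andbF mul0r.
by rewrite big1 // => y' _; rewrite permto_id eq_permprod nx mul0r.
Qed.

Lemma gtens_out m n f g (w : 'S_(m + n)) :
  (forall x y, w != permprod x y) -> gtens m n f g w = 0.
Proof.
move=> nw; rewrite /gtens eqxx big1 // => x _; rewrite big1 // => y _.
by rewrite permto_id eq_sym (negPf (nw x y)) mul0r.
Qed.

Lemma gtens_deg m n f g d (w : 'S_d) : d != (m + n)%N -> gtens m n f g w = 0.
Proof. by rewrite /gtens => /negPf->. Qed.

(** The embedding of S_m x S_n is injective, so a function is an induction
    product as soon as it is supported on S_m x S_n and has the right values
    there. *)
Lemma gtens_eq m n f g h :
  (forall d (w : 'S_d), d != (m + n)%N -> h d w = 0) ->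
  (forall w : 'S_(m + n), (forall x y, w != permprod x y) -> h _ w = 0) ->
  (forall x y, h _ (permprod x y) = f m x * g n y) ->
  gtens m n f g = h.
Proof.
move=> hd ho hp; apply: gfunP => d w.
have [e|nd] := eqVneq d (m + n)%N; last by rewrite gtens_deg ?hd.
subst d; have [/existsP[x /existsP[y /eqP->]]|nw] :=
    boolP [exists x, [exists y, w == permprod x y]].
  by rewrite gtens_permprod hp.
have {}nw x y : w != permprod x y.
  by move: nw; rewrite negb_exists => /forallP/(_ x); rewrite negb_exists => /forallP.
by rewrite gtens_out ?ho.
Qed.

Lemma gtens_conv m n f f' g g' :
  gtens m n (gconv f f') (gconv g g') = gconv (gtens m n f g) (gtens m n f' g').
Proof.
apply: gtens_eq => [d w nd|w nw|x y].
- by rewrite /gconv big1 // => z _; rewrite gtens_deg ?mul0r.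
- rewrite /gconv gtens_sum big1 // => x _; rewrite big1 // => y _.
  rewrite gtens_out ?mul0r // => x' y'; apply: contra_neq (nw (x' * x)%g (y' * y)%g) => e.
  by rewrite -permprodM -e mulgKV.
rewrite /gconv gtens_sum mulr_suml; apply: eq_bigr => z _.
rewrite mulr_sumr; apply: eq_bigr => z' _.
by rewrite permprodV permprodM gtens_permprod mulrACA.
Qed.

Lemma gtensA m n p f g h :
  gtens m (n + p) f (gtens n p g h) = gtens (m + n) p (gtens m n f g) h.
Proof.
apply: gtens_eq => [d w|w nw|x u].
- by rewrite addnA => /gtens_deg->.
- rewrite (gtensE _ _ _ (addnA m n p)) big1 // => u _; rewrite big1 // => z _.
  have [/existsP[x /existsP[y /eqP->]]|nu] :=
    boolP [exists x, [exists y, u == permprod x y]].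
    by rewrite permprodA eq_sym (negPf (nw _ _)) mul0r.
  rewrite gtens_out ?mul0r ?mulr0 // => x y; apply: contraNneq nu => e.
  by apply/existsP; exists x; apply/existsP; exists y; rewrite e.
apply: esym; transitivity (\sum_z \sum_(v : 'S_(m + n))
    (permto (m + (n + p)) (permprod v z) == permprod x u)%:R *
    h p z * gtens m n f g v); last first.
  rewrite (gtensE _ _ _ (addnA m n p)) exchange_big /=.
  by apply: eq_bigr => v _; apply: eq_bigr => z _; rewrite mulrCA mulrC mulrA.
transitivity (\sum_z \sum_y (permprod y z == u)%:R * (f m x * g n y) * h p z).
  rewrite gtensE // exchange_big /= mulr_sumr; apply: eq_bigr => z _.
  rewrite mulr_sumr; apply: eq_bigr => y _; rewrite permto_id.
  by rewrite mulrCA !mulrA.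
apply: eq_bigr => z _; rewrite (gtens_sum f g (fun v => _ * _)) (bigD1 x) //=.
rewrite [X in _ + X]big1 ?addr0 => [|x' /negPf nx].
  by apply: eq_bigr => y _; rewrite permprodA eq_permprod eqxx /= mulrAC.
by rewrite big1 // => y _; rewrite permprodA eq_permprod nx !mul0r.
Qed.

Lemma gtens_linl m n (k : K) f f' g d (w : 'S_d) :
  gtens m n (fun e x => k * f e x + f' e x) g w =
    k * gtens m n f g w + gtens m n f' g w.
Proof.
rewrite /gtens; case: eqP => _; last by rewrite mulr0 addr0.
rewrite mulr_sumr -big_split; apply: eq_bigr => x _ /=.
by rewrite mulr_sumr -big_split; apply: eq_bigr => y _ /=; ring.
Qed.

Lemma gtens_linr m n (k : K) f g g' d (w : 'S_d) :
  gtens m n f (fun e x => k * g e x + g' e x) w =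
    k * gtens m n f g w + gtens m n f g' w.
Proof.
rewrite /gtens; case: eqP => _; last by rewrite mulr0 addr0.
rewrite mulr_sumr -big_split; apply: eq_bigr => x _ /=.
by rewrite mulr_sumr -big_split; apply: eq_bigr => y _ /=; ring.
Qed.

Lemma gconvA f g h : gconv f (gconv g h) = gconv (gconv f g) h.
Proof.
apply: gfunP => d w; rewrite /gconv.
under [RHS]eq_bigr => z _ do rewrite mulr_suml.
under [LHS]eq_bigr => z _ do rewrite mulr_sumr.
rewrite [LHS]exchange_big /=; apply: eq_bigr => z _.
rewrite (reindex_inj (mulIg z)) /=; apply: eq_bigr => u _.
by rewrite mulgK invMg !mulgA mulrA.
Qed.

End GradedFunctions.

(** * Symbols of diagrams *)

Section Evaluation.
Variable K : fieldType.
Implicit Types (f g h : diag K) (a b c : composition) (u v : gfun K).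

Definition gyoung a : gfun K :=
  fun d w => ((d == sumn a) && (w \in young d a))%:R.

(** The symbol of a diagram from a to b.  Its value at w is meant to be the
    coefficient of the coset S_b w in the image of the trivial coset S_a; an
    equivariant map is determined by these numbers.  Composition of maps sums
    over the cosets of the middle Young subgroup; summing over all of S_d
    instead counts each coset ycard times, whence the factor.  Merges and
    splits both have constant symbol 1. *)
Fixpoint ev f : gfun K :=
  match f with
  | Id a => gyoung a
  | Merge k l => gyoung (strip [:: (k + l)%N])
  | Split k l => gyoung (strip [:: (k + l)%N])
  | Comp g f => fun d w => (ycard (tgt f))%:R^-1 * gconv (ev g) (ev f) w
  | Tens f g => gtens (sumn (src f)) (sumn (src g)) (ev f) (ev g)
  | Zero _ _ => fun _ _ => 0
  | Add f g => fun d w => ev f w + ev g w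
  | Scale k f => fun d w => k * ev f w
  end.

(** The left S_b-invariance says that u is a function of cosets S_b w, and
    the right S_a-invariance that the vector it describes in M^b is fixed by
    S_a, as the image of the trivial coset of S_a must be. *)
Definition binv a b u : Prop :=
  [/\ forall d (w : 'S_d), d != sumn a -> u d w = 0,
      forall d (w : 'S_d), d != sumn b -> u d w = 0,
      forall d (y w : 'S_d), y \in young d b -> u d (y * w)%g = u d w
    & forall d (y w : 'S_d), y \in young d a -> u d (w * y)%g = u d w].

Lemma gyoung_deg a d (w : 'S_d) : d != sumn a -> gyoung a w = 0.
Proof. by rewrite /gyoung => /negPf->. Qed.

Lemma gyoung_size1 a d (w : 'S_d) :
  (size a <= 1)%N -> gyoung a w = (d == sumn a)%:R.
Proof.
by rewrite /gyoung; case: eqP => // e s1; rewrite young_size1 ?e.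
Qed.

Lemma gyoung1 k d (w : 'S_d) : gyoung (strip [:: k]) w = (d == k)%:R.
Proof. by rewrite gyoung_size1 ?sumn_strip /= ?addn0 //; case: ifP. Qed.

Lemma gyoung_tens a b :
  gtens (sumn a) (sumn b) (gyoung a) (gyoung b) = gyoung (catc a b).
Proof.
apply: gtens_eq => [d w|w nw|x y].
- by rewrite -sumn_cat => nd; rewrite gyoung_deg.
- rewrite /gyoung /= sumn_cat eqxx /=; case: (boolP (_ \in _)) => //.
  by move=> /(young_prod_inv erefl)[x [y [_ _ /eqP]]]; rewrite (negPf (nw x y)).
- by rewrite /gyoung /= sumn_cat !eqxx /= permprod_young // -natrM mulnb.
Qed.

Lemma gyoung_binv a : binv a a (gyoung a).
Proof.
split=> [d w|d w|d y w yY|d y w yY]; rewrite /gyoung.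
- by move=> /negPf->.
- by move=> /negPf->.
- by rewrite groupMl.
- by rewrite groupMr.
Qed.

Lemma binv_diff a b u d (w : 'S_d) : binv a b u -> sumn a != sumn b -> u d w = 0.
Proof.
move=> [ua ub _ _] ab; have [e|/ua->//] := eqVneq d (sumn a).
by rewrite ub // e.
Qed.

Lemma gtens_binv a b a' b' u u' : binv a b u -> binv a' b' u' ->
  binv (catc a a') (catc b b') (gtens (sumn a) (sumn a') u u').
Proof.
move=> bu bu'; have [ab|ab] := eqVneq (sumn a) (sumn b); last first.
  have z d (w : 'S_d) : gtens (sumn a) (sumn a') u u' w = 0.
    rewrite /gtens; case: ifP => // _; rewrite big1 // => x _.
    by rewrite big1 // => y _; rewrite (binv_diff _ bu) // mul0r mulr0.
  by split=> *; rewrite !z.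
have [ab'|ab'] := eqVneq (sumn a') (sumn b'); last first.
  have z d (w : 'S_d) : gtens (sumn a) (sumn a') u u' w = 0.
    rewrite /gtens; case: ifP => // _; rewrite big1 // => x _.
    by rewrite big1 // => y _; rewrite (binv_diff _ bu') // mulr0 mulr0.
  by split=> *; rewrite !z.
have deg d : d != (sumn a + sumn a')%N -> forall w : 'S_d,
   gtens (sumn a) (sumn a') u u' w = 0 by move=> nd w; rewrite gtens_deg.
have [_ _ ul ur] := bu; have [_ _ ul' ur'] := bu'.
split=> [d w|d w|d y w|d y w]; rewrite /= ?sumn_cat; first by move=> /deg->.
- by rewrite -ab -ab' => /deg->.
- have [e|/deg nd] := eqVneq d (sumn a + sumn a')%N; last by rewrite !nd.
  subst d => /(young_prod_inv (esym ab))[y1 [y2 [Y1 Y2 ->]]].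
  have [/existsP[w1 /existsP[w2 /eqP->]]|nw] :=
    boolP [exists x1, [exists x2, w == permprod x1 x2]].
    by rewrite permprodM !gtens_permprod ul // ul'.
  rewrite !gtens_out // => x1 x2; apply: contraNneq nw => e.
    by apply/existsP; exists x1; apply/existsP; exists x2; rewrite e.
  apply/existsP; exists (y1^-1 * x1)%g; apply/existsP; exists (y2^-1 * x2)%g.
  by rewrite -permprodM -e -permprodV mulKg.
- have [e|/deg nd] := eqVneq d (sumn a + sumn a')%N; last by rewrite !nd.
  subst d => /(young_prod_inv erefl)[y1 [y2 [Y1 Y2 ->]]].
  have [/existsP[w1 /existsP[w2 /eqP->]]|nw] :=
    boolP [exists x1, [exists x2, w == permprod x1 x2]].
    by rewrite permprodM !gtens_permprod ur // ur'.
  rewrite !gtens_out // => x1 x2; apply: contraNneq nw => e.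
    by apply/existsP; exists x1; apply/existsP; exists x2; rewrite e.
  apply/existsP; exists (x1 * y1^-1)%g; apply/existsP; exists (x2 * y2^-1)%g.
  by rewrite -permprodM -e -permprodV mulgK.
Qed.

Lemma gconv_binv a b c b' u v : binv a b u -> binv b' c v -> binv a c (gconv v u).
Proof.
move=> [ua _ _ ur] [_ vc vl _]; split=> [d w nd|d w nd|d y w yY|d y w yY].
- by rewrite /gconv big1 // => z _; rewrite ua ?mulr0.
- by rewrite /gconv big1 // => z _; rewrite vc ?mul0r.
- by rewrite /gconv; apply: eq_bigr => z _; rewrite -mulgA (vl _ y).
- rewrite {1}/gconv (reindex_inj (mulIg y)) /=; apply: eq_bigr => z _.
  by rewrite invMg mulgA mulgK ur.
Qed.

Lemma binv_lin a b k u v : binv a b u -> binv a b v ->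
  binv a b (fun d w => k * u d w + v d w).
Proof.
move=> [ua ub ul ur] [va vb vl vr]; split=> [d w nd|d w nd|d y w Y|d y w Y].
- by rewrite ua ?va // mulr0 addr0.
- by rewrite ub ?vb // mulr0 addr0.
- by rewrite ul ?vl.
- by rewrite ur ?vr.
Qed.

Lemma binv0 a b : binv a b (fun d w => 0).
Proof. by []. Qed.

Lemma binv_scale a b k u : binv a b u -> binv a b (fun d w => k * u d w).
Proof.
move=> bu; have := binv_lin k bu (binv0 a b).
by rewrite [X in binv _ _ X](_ : _ = (fun d w => k * u d w)) //; apply: gfunP => d w;
  rewrite addr0.
Qed.

Lemma ev_binv f : wf f -> binv (src f) (tgt f) (ev f).
Proof.
elim: f => /= [a|k l|k l|g IHg f IHf|f IHf g IHg|a b|f IHf g IHg|k f IHf].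
- by move=> _; apply: gyoung_binv.
- move=> _; split=> [d w|d w|d y w _|d y w _]; rewrite !gyoung1 // -?strip_cat;
   by rewrite sumn_strip /= addn0 => /negPf->.
- move=> _; split=> [d w|d w|d y w _|d y w _]; rewrite !gyoung1 // -?strip_cat;
   by rewrite sumn_strip /= addn0 => /negPf->.
- move=> /and3P[/IHg bg /IHf bf /eqP e]; apply: binv_scale.
  exact: gconv_binv bf bg.
- by move=> /andP[/IHf bf /IHg bg]; apply: gtens_binv.
- by [].
- move=> /and4P[/IHf bf /IHg bg /eqP es /eqP et]; rewrite -es -et in bg.
  have := binv_lin 1 bf bg.
  by rewrite [X in binv _ _ X](_ : _ = (fun d w => ev f w + ev g w)) //;
    apply: gfunP => d w; rewrite mul1r.
- by move=> /IHf; apply: binv_scale.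
Qed.

Lemma ev_binv_typed a b f : typed a b f -> binv a b (ev f).
Proof. by move=> /typedP[/ev_binv ? <- <-]. Qed.

(** The augmentation, by which composition with a merge or a split acts. *)
Definition gaug u d : K := \sum_(w : 'S_d) u d w.

Lemma gaug_young a : gaug (gyoung a) (sumn a) = (ycard a)%:R.
Proof.
rewrite /gaug /gyoung eqxx /= -natr_sum; congr _%:R.
by rewrite /ycard -sum1_card [RHS]big_mkcond /=; apply: eq_bigr => w _; case: (_ \in _).
Qed.

Lemma gconv_youngl n u d (w : 'S_d) :
  gconv (gyoung (strip [:: n])) u w = (d == n)%:R * gaug u d.
Proof. by rewrite /gaug mulr_sumr; apply: eq_bigr => z _; rewrite gyoung1. Qed.

Lemma gconv_youngr n u d (w : 'S_d) :
  gconv u (gyoung (strip [:: n])) w = (d == n)%:R * gaug u d.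
Proof.
rewrite /gaug mulr_sumr /gconv (reindex_inj (inj_comp (mulIg w) invg_inj)) /=.
by apply: eq_bigr => z _; rewrite gyoung1 invMg invgK mulKVg mulrC.
Qed.

Lemma gconv_young1l a b u d (w : 'S_d) : binv a b u ->
  gconv (gyoung b) u w = (ycard b)%:R * u d w.
Proof.
move=> [ua ub ul ur]; have [e|nd] := eqVneq d (sumn b); last first.
  by rewrite ub // mulr0 /gconv big1 // => z _; rewrite ub // mulr0.
subst d; rewrite -gaug_young /gaug mulr_suml /gconv.
rewrite (reindex_inj (inj_comp (mulIg w) invg_inj)) /=.
apply: eq_bigr => z _; rewrite invMg invgK mulKVg /gyoung eqxx /=.
case: (boolP (z \in _)) => Y; last by rewrite !mul0r.
by rewrite ul ?groupV.
Qed.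

Lemma gconv_young1r a b u d (w : 'S_d) : binv a b u ->
  gconv u (gyoung a) w = (ycard a)%:R * u d w.
Proof.
move=> [ua ub ul ur]; have [e|nd] := eqVneq d (sumn a); last first.
  by rewrite ua // mulr0 /gconv big1 // => z _; rewrite ua // mul0r.
subst d; rewrite -gaug_young /gaug mulr_suml; apply: eq_bigr => z _.
rewrite /gyoung eqxx /= mulrC; case: (boolP (z \in _)) => Y; last by rewrite !mul0r.
by rewrite ur ?groupV.
Qed.

End Evaluation.

(** * A Vandermonde identity and flags of subsets *)

Section Vandermonde.
Variable K : fieldType.
Hypothesis char0 : forall n, n.+1%:R != 0 :> K.

Lemma gbinom0 n : gbinom K n 0 = 1.
Proof. by rewrite /gbinom big_ord0 fact0 divr1. Qed.

Lemma gbinomS n t : gbinom K (n + 1) t.+1 = gbinom K n t.+1 + gbinom K n t.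
Proof.
have tf m : m`!%:R != 0 :> K by case: m`! (fact_gt0 m).
rewrite /gbinom big_ord_recl big_ord_recr /= factS natrM.
rewrite (eq_bigr (fun i : 'I_t => (n - i%:Z)%:~R : K)) => [|i _]; last first.
  by rewrite /bump /= add1n -addn1 PoszD; congr _%:~R; ring.
rewrite subr0 rmorphD rmorphB /=; have t1 := char0 t; have t2 := tf t.
set P := \prod_(i < t) _; rewrite -[t%:~R]/(t%:R).
have e : t.+1%:R = t%:R + 1 :> K by rewrite -addn1 natrD.
by rewrite e in t1 *; field; apply/andP.
Qed.

Lemma gbinom_nat (i t : nat) : gbinom K i t = 'C(i, t)%:R.
Proof.
elim: i t => [|i IH] [|t]; rewrite ?gbinom0 ?bin0 //.
  by rewrite /gbinom big_ord_recl /= subrr mul0r mul0r.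
by rewrite -addn1 PoszD gbinomS !IH addn1 binS natrD.
Qed.

(** The upper index i - N may be negative, so the classical identity
    does not apply.  Pascal's rule, applied to both factors, shows that the sum
    is unchanged when N + 1 is replaced by N; at N = 0 only the last term is
    left. *)
Lemma gbinom_Vandermonde (i N m : nat) :
  \sum_(t < m.+1) gbinom K (i%:Z - N%:Z) t * 'C(N, m - t)%:R = 'C(i, m)%:R.
Proof.
elim: N m => [|N IH] m.
  rewrite subr0 big_ord_recr /= subnn bin0 mulr1 big1 ?add0r ?gbinom_nat // => t _.
  by rewrite bin0n (_ : (m - t == 0)%N = false) ?mulr0 //; have := ltn_ord t; lia.
rewrite -(IH m); set n := _ - N.+1%:Z.
have -> : i%:Z - N%:Z = n + 1 by rewrite /n; lia.
case: m => [|m]; first by rewrite !big_ord1 !gbinom0 !subn0 !bin0.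
rewrite [RHS]big_ord_recl gbinom0 mul1r subn0.
under [X in _ = _ + X]eq_bigr => t _ do rewrite lift0 gbinomS mulrDl subSS.
rewrite big_split /= addrA big_ord_recr /= subnn bin0 mulr1.
transitivity (\sum_(t < m.+1) gbinom K n t * 'C(N, m.+1 - t)%:R +
    gbinom K n m.+1 + \sum_(t < m.+1) gbinom K n t * 'C(N, m - t)%:R).
  rewrite addrAC -big_split; congr (_ + _); apply: eq_bigr => t _ /=.
  by rewrite -mulrDr -natrD subSn ?binS // -ltnS.
congr (_ + _); rewrite big_ord_recl gbinom0 mul1r subn0 -addrA; congr (_ + _).
rewrite [RHS]big_ord_recr /= subnn bin0 mulr1; congr (_ + _).
Qed.

End Vandermonde.

Section NestedSets.
Local Open Scope nat_scope.
Variable d : nat.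
Implicit Types (A C W : {set 'I_d}) (w z : 'S_d).

Definition below p : {set 'I_d} := [set i : 'I_d | i < p].

Lemma card_below p : p <= d -> #|below p| = p.
Proof.
move=> pd; rewrite -sum1dep_card -(big_ord_widen d (fun=> 1) pd).
by rewrite sum1_card card_ord.
Qed.

Lemma imset_permM w z A : (w * z)%g @: A = z @: (w @: A).
Proof. by rewrite -imset_comp; apply: eq_imset => i; rewrite /= permM. Qed.

Lemma imset_perm1 A : (1 : 'S_d)%g @: A = A.
Proof. by rewrite -[RHS]imset_id; apply: eq_imset => i; rewrite perm1. Qed.

Lemma imset_perm_inj w : injective (fun A : {set 'I_d} => w @: A).
Proof. exact: imset_inj perm_inj. Qed.

(** Such a permutation lists A, then W minus A, then the complement of W. *)
Lemma nested_perm A W : A \subset W ->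
  exists z, z @: below #|A| = A /\ z @: below #|W| = W.
Proof.
move=> sAW; pose s := enum A ++ enum (W :\: A) ++ enum (~: W).
have us : uniq s.
  rewrite /s !cat_uniq !enum_uniq /= andbT; apply/andP; split.
    apply/hasPn => i; rewrite mem_cat !mem_enum !inE => /orP[/andP[]//|].
    by apply: contra; apply: (subsetP sAW).
  by apply/hasPn => i; rewrite !mem_enum !inE => /negPf->; rewrite andbF.
have sW : size (enum A ++ enum (W :\: A)) = #|W|.
  by rewrite size_cat -!cardE cardsD (setIidPr sAW) subnKC // subset_leq_card.
have sd : size s = d.
  by rewrite /s catA size_cat sW -cardE cardsC card_ord.
have inj : injective (fun i : 'I_d => nth i s i).
  move=> i j e; apply: val_inj => /=; apply/eqP; rewrite -(nth_uniq i _ _ us) ?sd ?ltn_ord //.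
  by rewrite e; apply/eqP; apply: set_nth_default; rewrite sd.
exists (perm inj); split; apply/eqP.
- rewrite eqEcard (card_imset _ perm_inj) card_below ?leqnn ?andbT; last first.
    by rewrite -[X in _ <= X]card_ord max_card.
  apply/subsetP => x /imsetP[i]; rewrite inE => iA ->.
  by rewrite permE /s nth_cat -cardE iA -mem_enum mem_nth // -cardE.
- rewrite eqEcard (card_imset _ perm_inj) card_below ?leqnn ?andbT; last first.
    by rewrite -[X in _ <= X]card_ord max_card.
  apply/subsetP => x /imsetP[i]; rewrite inE => iW ->.
  rewrite permE /s catA nth_cat sW iW.
  have : nth i (enum A ++ enum (W :\: A)) i \in enum A ++ enum (W :\: A).
    by rewrite mem_nth ?sW.
  rewrite mem_cat !mem_enum !inE => /orP[|/andP[]//]; exact: (subsetP sAW).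
Qed.

End NestedSets.

(** * Young subgroups as stabilizers of flags *)

Section YoungSets.
Local Open Scope nat_scope.

Lemma reshape_index_strip1 k i : i < k -> reshape_index (strip [:: k]) i = 0.
Proof.
case: k => // k; rewrite /reshape_index /= => ik.
by rewrite subSS (_ : i - k == 0)%N // subn_eq0.
Qed.

Lemma reshape_index_strip_cons k (s : seq nat) i :
  reshape_index (strip (k :: s)) i =
    if i < k then 0 else (0 < k) + reshape_index (strip s) (i - k).
Proof.
have -> : strip (k :: s) = strip [:: k] ++ strip s :> seq nat.
  by rewrite -cat1s strip_cat.
have sk : sumn (strip [:: k]) = k by rewrite sumn_strip /= addn0.
case: ltnP => ik; first by rewrite reshape_index_catl ?sk // reshape_index_strip1.
have e : i = sumn (strip [:: k]) + (i - k) by rewrite sk subnKC.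
rewrite {1}e reshape_index_catr; congr (_ + _).
by case: (k) => //=.
Qed.

Variables (d : nat).
Implicit Types (w z : 'S_d) (A C W : {set 'I_d}).

Lemma imset_belowP w p : reflect (forall i, (w i < p) = (i < p)) (w @: below d p == below d p).
Proof.
apply: (iffP eqP) => [e i|e].
  have := mem_imset (below d p) i (@perm_inj _ w).
  by rewrite e !inE.
by apply/setP => i; rewrite -(permKV w i) mem_imset ?inE ?e //; apply: perm_inj.
Qed.

Lemma young_strip2 p q w : d = p + q ->
  (w \in young d (strip [:: p; q])) = (w @: below d p == below d p).
Proof.
move=> e; have rE (i : 'I_d) : reshape_index (strip [:: p; q]) i =
    if i < p then 0 else (0 < p) + 0.
  rewrite reshape_index_strip_cons; case: ltnP => // pi; congr (_ + _).
  by rewrite reshape_index_strip1 //; have := ltn_ord i; lia.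
apply/youngP/imset_belowP => H i; last by rewrite !rE H.
by have := H i; rewrite !rE; case: (ltnP (w i) p); case: (ltnP i p) => //=; lia.
Qed.

Lemma young_strip3 p q r w : d = p + q + r ->
  (w \in young d (strip [:: p; q; r])) =
    (w @: below d p == below d p) && (w @: below d (p + q) == below d (p + q)).
Proof.
move=> e; have rE (i : 'I_d) : reshape_index (strip [:: p; q; r]) i =
    if i < p then 0 else (0 < p) + (if i < p + q then 0 else (0 < q)).
  rewrite !reshape_index_strip_cons; case: ltnP => // pi; congr (_ + _).
  rewrite -(ltn_add2l p) subnKC //; case: ltnP => // pqi.
  by rewrite (_ : i - p - q < r) ?addn0 //; have := ltn_ord i; lia.
apply/youngP/andP => [H|[/imset_belowP Hp /imset_belowP Hq] i]; last by rewrite !rE Hp Hq.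
split; apply/imset_belowP => i; have := H i; rewrite !rE.
  by case: (ltnP (w i) p); case: (ltnP i p); case: (ltnP (w i) (p + q));
    case: (ltnP i (p + q)) => //=; lia.
case: (ltnP (w i) p); case: (ltnP i p); case: (ltnP (w i) (p + q)); case: (ltnP i (p + q));
 case: (posnP p); case: (posnP q); move=> * //=; lia.
Qed.

Lemma ycard3 p q r : ycard (strip [:: p; q; r]) = p`! * q`! * r`!.
Proof. by rewrite -cat1s strip_cat ycard_cat ycard1 ycard2 mulnA. Qed.

(** The permutations carrying the standard flag to A and W form a coset of
    the stabilizer of the standard flag, which is a Young subgroup. *)
Lemma card_nested A W : A \subset W ->
  #|[set z : 'S_d | (z @: below d #|A| == A) && (z @: below d #|W| == W)]|
    = #|A|`! * (#|W| - #|A|)`! * (d - #|W|)`!.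
Proof.
move=> sAW; have [z0 [zA zW]] := nested_perm sAW.
have AW := subset_leq_card sAW.
have Wd : #|W| <= d by rewrite -[X in _ <= X]card_ord max_card.
rewrite -ycard3 /ycard sumn_strip /= addn0 addnA.
rewrite (subnKC AW) (subnKC Wd) -[RHS](card_rcoset _ z0); apply: eq_card => z.
rewrite mem_rcoset young_strip3 ?(subnKC AW) ?subnKC // inE !imset_permM.
have E (B C : {set 'I_d}) : z0 @: B = C -> ((z0^-1)%g @: (z @: B) == B) = (z @: B == C).
  move=> <-; rewrite -[in LHS](inj_eq (@imset_perm_inj _ z0)) -[in LHS]imset_permM.
  by rewrite mulVg imset_perm1.
by rewrite (E _ _ zA) (E _ _ zW).
Qed.

Lemma card_flag C : #|[set z : 'S_d | z @: below d #|C| == C]| = #|C|`! * (d - #|C|)`!.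
Proof.
have := card_nested (subxx C); rewrite subnn fact0 muln1 => <-.
by apply: eq_card => z; rewrite !inE andbb.
Qed.

Lemma card_supersets A p : p <= d ->
  #|[set C : {set 'I_d} | (A \subset C) && (#|C| == p)]| = 'C(d - #|A|, d - p).
Proof.
move=> pd; have cA (B : {set 'I_d}) : #|~: B| = d - #|B| :> nat.
  by have := cardsC B; rewrite card_ord; lia.
rewrite -cA -cards_draws -[LHS](card_imset _ (@setC_inj _)); apply: eq_card => C.
rewrite -[C]setCK mem_imset; last exact: setC_inj.
rewrite !inE setCK subsetC; congr (_ && _); rewrite cA.
have : #|C| <= d by rewrite -[X in _ <= X]card_ord max_card.
by lia.
Qed.

End YoungSets.

Section YoungConvolution.
Variable K : fieldType.
Hypothesis char0 : forall n, n.+1%:R != 0 :> K.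

Lemma natr_neq0 n : (0 < n)%N -> n%:R != 0 :> K.
Proof. by case: n. Qed.

Lemma ycard_neq0 a : (ycard a)%:R != 0 :> K.
Proof. exact/natr_neq0/ycard_gt0. Qed.

Variable d : nat.
Implicit Types (w z : 'S_d).

(** Double coset counting: a Young subgroup with two blocks is the
    stabilizer of an initial segment, so the convolution of two indicators
    counts the permutations that move a flag to a given flag. *)
Lemma gconv_young2 p q p' q' w : d = (p + q)%N -> d = (p' + q')%N ->
  gconv (gyoung K (strip [:: p; q])) (gyoung K (strip [:: p'; q'])) w =
  #|[set z : 'S_d | (z @: below d p' == below d p') &&
                    (z @: below d p == w @: below d p)]|%:R.
Proof.
move=> e e'; rewrite /gconv -sum1dep_card natr_sum [RHS]big_mkcond /=.
apply: eq_bigr => z _; rewrite /gyoung !sumn_strip /= !addn0 -e -e' eqxx /=.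
rewrite !young_strip2 // -natrM mulnb andbC imset_permM.
have -> : ((z^-1)%g @: (w @: below d p) == below d p) = (z @: below d p == w @: below d p).
  rewrite -[in LHS](inj_eq (@imset_perm_inj _ z)) -[in LHS]imset_permM.
  by rewrite mulVg imset_perm1 eq_sym.
by case: (_ && _).
Qed.

Lemma sum_flag (F : {set 'I_d} -> K) p : (p <= d)%N ->
  \sum_(z : 'S_d) F (z @: below d p) =
    (p`! * (d - p)`!)%:R * \sum_(C : {set 'I_d} | #|C| == p) F C.
Proof.
move=> pd; rewrite (partition_big (fun z : 'S_d => z @: below d p)
  (fun C : {set 'I_d} => #|C| == p)) /=; last first.
  by move=> z _; rewrite (card_imset _ perm_inj) card_below.
rewrite mulr_sumr; apply: eq_bigr => C /eqP Cp.
transitivity (\sum_(z : 'S_d | z @: below d p == C) F C).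
  by apply: eq_bigr => z /eqP->.
by rewrite sumr_const mulr_natl -Cp -card_flag cardsE.
Qed.

End YoungConvolution.

(** * The symbols of E F and F E *)

Section EF.
Variable K : fieldType.
Hypothesis char0 : forall n, n.+1%:R != 0 :> K.

Lemma card_nested_if d p q r (A W : {set 'I_d}) :
    d = (p + q + r)%N -> #|A| = p -> #|W| = (p + q)%N ->
  #|[set z : 'S_d | (z @: below d p == A) && (z @: below d (p + q) == W)]| =
    (ycard (strip [:: p; q; r]) * (A \subset W))%N.
Proof.
move=> e Ap Wq; have [sAW|nAW] := boolP (A \subset W); last first.
  rewrite muln0 (_ : [set _ | _] = set0) ?cards0 //; apply/setP => z.
  rewrite !inE; apply/andP => -[/eqP zA /eqP zW]; case/negP: nAW.
  rewrite -zA -zW; apply: imsetS; apply/subsetP => i; rewrite !inE.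
  by move/leq_trans; apply; apply: leq_addr.
rewrite ycard3 muln1 -Wq; subst p.
have -> : q = (#|W| - #|A|)%N by lia.
have -> : r = (d - #|W|)%N by lia.
exact: card_nested.
Qed.

Lemma gyoung_tens2 (s t : seq nat) n m : n = sumn s -> m = sumn t ->
  gtens n m (gyoung K (strip s)) (gyoung K (strip t)) = gyoung K (strip (s ++ t)).
Proof. by move=> -> ->; rewrite strip_cat -gyoung_tens !sumn_strip. Qed.

Lemma ev_Tens_Merge_Id k r l :
  ev (Tens (Merge k r) (Id (strip [:: l]))) = gyoung K (strip [:: (k + r)%N; l]).
Proof.
change (gtens (sumn (strip [:: k; r])) (sumn (strip [:: l]))
  (gyoung K (strip [:: (k + r)%N])) (gyoung K (strip [:: l])) =
   gyoung K (strip [:: (k + r)%N; l])).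
by rewrite gyoung_tens2 // sumn_strip /= !addn0.
Qed.

Lemma ev_Tens_Id_Merge k r l :
  ev (Tens (Id (strip [:: l])) (Merge k r)) = gyoung K (strip [:: l; (k + r)%N]).
Proof.
change (gtens (sumn (strip [:: l])) (sumn (strip [:: k; r]))
  (gyoung K (strip [:: l])) (gyoung K (strip [:: (k + r)%N])) =
   gyoung K (strip [:: l; (k + r)%N])).
by rewrite gyoung_tens2 // sumn_strip /= !addn0.
Qed.

Lemma ev_Tens_Split_Id k r l :
  ev (Tens (Split k r) (Id (strip [:: l]))) = gyoung K (strip [:: (k + r)%N; l]).
Proof.
change (gtens (sumn (strip [:: (k + r)%N])) (sumn (strip [:: l]))
  (gyoung K (strip [:: (k + r)%N])) (gyoung K (strip [:: l])) =
   gyoung K (strip [:: (k + r)%N; l])).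
by rewrite gyoung_tens2 // sumn_strip.
Qed.

Lemma ev_Tens_Id_Split k r l :
  ev (Tens (Id (strip [:: l])) (Split k r)) = gyoung K (strip [:: l; (k + r)%N]).
Proof.
change (gtens (sumn (strip [:: l])) (sumn (strip [:: (k + r)%N]))
  (gyoung K (strip [:: l])) (gyoung K (strip [:: (k + r)%N])) =
   gyoung K (strip [:: l; (k + r)%N])).
by rewrite gyoung_tens2 // sumn_strip.
Qed.

Lemma ev_Comp (g f : diag K) d (w : 'S_d) :
  ev (Comp g f) w = (ycard (tgt f))%:R^-1 * gconv (ev g) (ev f) w.
Proof. by []. Qed.

Lemma EdiagE (r k l : nat) : Ediag K r k (r + l)%N =
  Comp (Tens (Merge k r) (Id (strip [:: l]))) (Tens (Id (strip [:: k])) (Split r l)).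
Proof.
rewrite /Ediag ifT; last by apply/and5P; split; lia.
by congr (Comp (Tens _ (Id (strip [:: _]))) (Tens _ (Split _ _))); lia.
Qed.

Lemma FdiagE (s k l : nat) : Fdiag K s (k + s)%N l =
  Comp (Tens (Id (strip [:: k])) (Merge s l)) (Tens (Split k s) (Id (strip [:: l]))).
Proof.
rewrite /Fdiag ifT; last by apply/and5P; split; lia.
by congr (Comp (Tens (Id (strip [:: _])) _) (Tens (Split _ _) _)); lia.
Qed.

(** The coset of w is the subset C = w(below (k + r)); thus E sends a set A to
    the sum of the sets containing A that have r more elements. *)
Lemma ev_Ediag (r k l d : nat) (w : 'S_d) : d = (k + r + l)%N ->
  ev (Ediag K r k (r + l)%N) w = (below d k \subset w @: below d (k + r))%:R.
Proof.
move=> e; rewrite EdiagE ev_Comp ev_Tens_Merge_Id ev_Tens_Id_Split gconv_young2 ?addnA //.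
rewrite [tgt _](_ : _ = strip [:: k; r; l]); last exact: esym (strip_cat _ _).
rewrite (@card_nested_if d k r l) ?card_below ?(card_imset _ perm_inj) ?card_below //; try lia.
by rewrite natrM mulKf // ycard_neq0.
Qed.

(** Dually, F sends a set to the sum of its subsets with s fewer elements. *)
Lemma ev_Fdiag (s p l d : nat) (w : 'S_d) : d = (p + s + l)%N ->
  ev (Fdiag K s (p + s)%N l) w = (w @: below d p \subset below d (p + s))%:R.
Proof.
move=> e; rewrite FdiagE ev_Comp ev_Tens_Id_Merge ev_Tens_Split_Id gconv_young2 ?addnA //.
rewrite [tgt _](_ : _ = strip [:: p; s; l]); last exact: esym (strip_cat _ _).
rewrite (eq_card (B := [set z : 'S_d | (z @: below d p == w @: below d p) &&
    (z @: below d (p + s) == below d (p + s))])); last by move=> z; rewrite !inE andbC.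
rewrite (@card_nested_if d p s l) ?card_below ?(card_imset _ perm_inj) ?card_below //; try lia.
by rewrite natrM mulKf // ycard_neq0.
Qed.

Lemma imset_permV_sub d (z : 'S_d) (A B : {set 'I_d}) :
  (A \subset (z^-1)%g @: B) = (z @: A \subset B).
Proof.
have E (C : {set 'I_d}) (y : 'S_d) : y @: ((y^-1)%g @: C) = C.
  by rewrite -imset_permM mulVg imset_perm1.
apply/idP/idP => [/(imsetS z)|/(imsetS (z^-1)%g)]; first by rewrite E.
by have := E A (z^-1)%g; rewrite invgK => ->.
Qed.

Lemma imset_permV_sup d (z : 'S_d) (A B : {set 'I_d}) :
  ((z^-1)%g @: A \subset B) = (A \subset z @: B).
Proof. by rewrite -{2}(invgK z) imset_permV_sub. Qed.

Lemma deg_typed a b (f : diag K) d (w : 'S_d) : typed a b f -> d != sumn a -> ev f w = 0.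
Proof. by move=> /ev_binv_typed[H _ _ _] /H. Qed.

Lemma sumn_iob (k l : int) : sumn (iob k l) = (`|k| + `|l|)%N.
Proof. by rewrite sumn_strip /= addn0. Qed.

(** The coefficient counts the intermediate sets, which are the subsets of
    the intersection of the two end sets that have k - s elements. *)
Lemma ev_EFdiag (k l r s d : nat) (w : 'S_d) : d = (k + l)%N -> (r <= l + s)%N ->
  (s <= k + r)%N ->
  ev (Comp (Ediag K r (k%:Z - s%:Z) (l%:Z + s%:Z)) (Fdiag K s k l)) w =
   if (s <= k)%N then 'C(#|w @: below d (k + r - s) :&: below d k|, k - s)%:R else 0.
Proof.
move=> e rls skr; case: leqP => sk; last first.
  rewrite ev_Comp [X in gconv _ X](_ : _ = fun _ _ => 0) ?/gconv; last first.
    apply: gfunP => c z; rewrite /Fdiag ifF //; apply/negP => /and5P[]; lia.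
  by rewrite big1 ?mulr0 // => z _; rewrite mulr0.
have [p kE] : exists p, k = (p + s)%N by exists (k - s)%N; rewrite subnK.
have [q lE] : exists q, (l + s = r + q)%N by exists (l + s - r)%N; lia.
have tF := Fdiag_typed K s k l.
have -> : k%:Z - s%:Z = p by lia.
have -> : l%:Z + s%:Z = (r + q)%N by lia.
have -> : (k + r - s = p + r)%N by lia.
have -> : (k - s = p)%N by lia.
rewrite ev_Comp (_ : tgt (Fdiag K s k l) = strip [:: p; (r + q)%N]); last first.
  by case/typedP: tF => _ _ ->; congr (strip [:: _; _]); lia.
rewrite /gconv kE.
under eq_bigr => z _.
  rewrite ev_Fdiag ?ev_Ediag; try lia.
  rewrite imset_permM imset_permV_sub; over.
rewrite (sum_flag (fun C : {set 'I_d} => (C \subset w @: below d (p + r))%:R *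
  (C \subset below d (p + s))%:R)); last by lia.
rewrite ycard2 (_ : (d - p = r + q)%N); last by lia.
rewrite mulKf; last by rewrite natr_neq0 // muln_gt0 !fact_gt0.
rewrite -cards_draws -sum1dep_card natr_sum big_mkcond [RHS]big_mkcond.
apply: eq_bigr => C _; rewrite subsetI -natrM mulnb.
by case: (#|C| == p); rewrite ?andbF // andbT; case: (_ && _).
Qed.

(** Here the intermediate sets are the supersets of the union of the two end
    sets that have k + r elements, and are counted by their complements. *)
Lemma ev_FEdiag (k l r s d : nat) (w : 'S_d) : d = (k + l)%N -> (r <= l)%N ->
  (s <= k + r)%N ->
  ev (Comp (Fdiag K s (k%:Z + r%:Z) (l%:Z - r%:Z)) (Ediag K r k l)) w =
   'C(d - #|w @: below d (k + r - s) :|: below d k|, l - r)%:R.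
Proof.
move=> e rl skr.
have [q lE] : exists q, l = (r + q)%N by exists (l - r)%N; rewrite subnKC.
have [p pE] : exists p, (k + r = p + s)%N by exists (k + r - s)%N; rewrite subnK.
have tE := Ediag_typed K r k l.
have -> : k%:Z + r%:Z = (p + s)%N by lia.
have -> : l%:Z - r%:Z = q by lia.
have -> : (k + r - s = p)%N by lia.
have -> : (l - r = q)%N by lia.
rewrite ev_Comp (_ : tgt (Ediag K r k l) = strip [:: (p + s)%N; q]); last first.
  by case/typedP: tE => _ _ ->; congr (strip [:: _; _]); lia.
rewrite /gconv lE.
under eq_bigr => z _.
  rewrite ev_Fdiag ?ev_Ediag; try lia.
  rewrite imset_permM imset_permV_sup pE; over.
rewrite (sum_flag (fun C : {set 'I_d} => (w @: below d p \subset C)%:R *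
  (below d k \subset C)%:R)); last by lia.
rewrite ycard2 (_ : (d - (p + s) = q)%N); last by lia.
rewrite mulKf; last by rewrite natr_neq0 // muln_gt0 !fact_gt0.
rewrite [X in 'C(_, X)](_ : _ = (d - (p + s))%N); last by lia.
rewrite -card_supersets; last by lia.
rewrite -sum1dep_card natr_sum big_mkcond [RHS]big_mkcond.
apply: eq_bigr => C _; rewrite subUset -natrM mulnb andbC.
by case: (#|C| == _); rewrite ?andbF // andbT; case: (_ && _).
Qed.

Lemma ev_EF_rhs k l r s d (w : 'S_d) :
  ev (EF_rhs K k l r s) w = \sum_(t < `|s|.+1) gbinom K (k - l + r - s) t *
    ev (Comp (Fdiag K (s - t%:Z) (k + r - t%:Z) (l - r + t%:Z))
             (Ediag K (r - t%:Z) k l)) w.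
Proof. by rewrite /EF_rhs; elim/big_ind2: _ => //= f x g y -> ->. Qed.

Lemma ev_Ediag_neg r k l d (w : 'S_d) :
  ~~ [&& 0 <= r, 0 <= k, 0 <= l, 0 <= k + r & 0 <= l - r] -> ev (Ediag K r k l) w = 0.
Proof. by rewrite /Ediag => /negPf->. Qed.

Lemma ev_Fdiag_neg s k l d (w : 'S_d) :
  ~~ [&& 0 <= s, 0 <= k, 0 <= l, 0 <= k - s & 0 <= l + s] -> ev (Fdiag K s k l) w = 0.
Proof. by rewrite /Fdiag => /negPf->. Qed.

Lemma ev_Comp0l (g f : diag K) d (w : 'S_d) : (forall z : 'S_d, ev g z = 0) ->
  ev (Comp g f) w = 0.
Proof. by move=> g0; rewrite /= /gconv big1 ?mulr0 // => z _; rewrite g0 mul0r. Qed.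

Lemma ev_Comp0r (g f : diag K) d (w : 'S_d) : (forall z : 'S_d, ev f z = 0) ->
  ev (Comp g f) w = 0.
Proof. by move=> f0; rewrite /= /gconv big1 ?mulr0 // => z _; rewrite f0 mulr0. Qed.

(** Let i be the size of the intersection of the two end sets and N that of
    the complement of their union; the upper index k - l + r - s is then i - N
    whatever the sets are.  By the two previous counts the relation reads
    binom(i, k - s) = sum over t of binom(i - N, t) binom(N, l - r + t), which is
    the Vandermonde identity. *)
Lemma ev_EF k l r s :
  ev (Comp (Ediag K r (k - s) (l + s)) (Fdiag K s k l)) = ev (EF_rhs K k l r s).
Proof.
apply: gfunP => d w; rewrite ev_EF_rhs.
have [/and5P[k0 l0 r0 s0 /andP[ks ls]]|neg] := boolP
    [&& 0 <= k, 0 <= l, 0 <= r, 0 <= s & (0 <= k - s + r) && (0 <= l + s - r)]; last first.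
  rewrite big1 => [|t _].
    have [sk|sk] := boolP [&& 0 <= s, 0 <= k, 0 <= l, 0 <= k - s & 0 <= l + s].
      by apply: ev_Comp0l => z; apply: ev_Ediag_neg; lia.
    by apply: ev_Comp0r => z; apply: ev_Fdiag_neg.
  have [rt|rt] := boolP [&& 0 <= r - t%:Z, 0 <= k, 0 <= l,
      0 <= k + (r - t%:Z) & 0 <= l - (r - t%:Z)].
    by rewrite ev_Comp0l ?mulr0 // => z; apply: ev_Fdiag_neg; lia.
  by rewrite ev_Comp0r ?mulr0 // => z; apply: ev_Ediag_neg.
case: k k0 ks => // k _; case: l l0 ls => // l _; case: r r0 => // r _; case: s s0 => // s _.
move=> ls ks.
have [e|nd] := eqVneq d (k + l)%N; last first.
  rewrite (deg_typed _ (typed_comp (Ediag_typed _ _ _ _) (Fdiag_typed _ _ _ _))); last first.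
    by rewrite sumn_iob.
  rewrite big1 // => t _; rewrite ev_Comp0r ?mulr0 // => z.
  by rewrite (deg_typed _ (Ediag_typed _ _ _ _)) // sumn_iob.
rewrite ev_EFdiag //; try lia.
set W := w @: below d (k + r - s); set i := #|W :&: below d k|.
have Wc : #|W| = (k + r - s)%N by rewrite /W (card_imset _ perm_inj) card_below //; lia.
have kc : #|below d k| = k by rewrite card_below //; lia.
have iW : (i <= k + r - s)%N by rewrite -Wc subset_leq_card // subsetIl.
have ik : (i <= k)%N by rewrite -[X in (_ <= X)%N]kc subset_leq_card // subsetIr.
have Uc : (#|W :|: below d k| + i = k + r - s + k)%N.
  by rewrite cardsUI Wc kc.
have Ud : (#|W :|: below d k| <= d)%N by rewrite -[X in (_ <= X)%N]card_ord max_card.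
pose N := (d - #|W :|: below d k|)%N.
have termE (t : 'I_s.+1) : gbinom K (k%:Z - l%:Z + r%:Z - s%:Z) t *
    ev (Comp (Fdiag K (s%:Z - t%:Z) (k%:Z + r%:Z - t%:Z) (l%:Z - r%:Z + t%:Z))
             (Ediag K (r%:Z - t%:Z) k l)) w =
    if (t <= r)%N && (r <= l + t)%N then gbinom K (i%:Z - N%:Z) t * 'C(N, l + t - r)%:R else 0.
  have ts : (t <= s)%N by rewrite -ltnS.
  case: ifP => [/andP[tr rl]|H]; last first.
    by rewrite ev_Comp0r ?mulr0 // => z; apply: ev_Ediag_neg; lia.
  congr (gbinom K _ _ * _); first by lia.
  have -> : s%:Z - t%:Z = (s - t)%N by lia.
  have -> : k%:Z + r%:Z - t%:Z = k%:Z + (r - t)%N%:Z by lia.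
  have -> : l%:Z - r%:Z + t%:Z = l%:Z - (r - t)%N%:Z by lia.
  have -> : r%:Z - t%:Z = (r - t)%N by lia.
  rewrite ev_FEdiag; try lia.
  have -> : (k + (r - t) - (s - t) = k + r - s)%N by lia.
  by congr ('C(_, _)%:R); lia.
rewrite (eq_bigr _ (fun t _ => termE t)).
have [mk|km] := leqP (k - s) i; last first.
  rewrite big1 => [|t _].
    by case: ifP => // sk; rewrite bin_small.
  by case: ifP => // /andP[tr rl]; rewrite bin_small ?mulr0 //; lia.
(* If s > k then m = i + s - k exceeds i, and both sides vanish. *)
have [m mE] : exists m, (i + s = k + m)%N by exists (i + s - k)%N; lia.
transitivity ('C(i, m)%:R : K).
  case: leqP => sk; last by rewrite bin_small //; lia.
  by rewrite -bin_sub; [congr ('C(_, _)%:R) |]; lia.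
(* The terms with t > m vanish on the right, as do those that the bounds on t
   exclude. *)
rewrite -(gbinom_Vandermonde char0 i N m).
rewrite (big_ord_widen s.+1 (fun t => gbinom K (i%:Z - N%:Z) t * 'C(N, m - t)%:R)); last by lia.
rewrite big_mkcond; apply: eq_bigr => t _; rewrite ltnS.
have ts := ltn_ord t; case: leqP => tm; last first.
  by case: ifP => // /andP[tr rl]; rewrite bin_small ?mulr0 //; lia.
case: ifP => H; last by rewrite bin_small ?mulr0 //; lia.
by rewrite -bin_sub; [congr (_ * 'C(_, _)%:R) |]; lia.
Qed.

End EF.

(** * Soundness of the symbol *)

Section Soundness.
Variable K : fieldType.
Hypothesis char0 : forall n, n.+1%:R != 0 :> K.
Implicit Types (f g h : diag K) (a b c : composition).

Lemma gconv_scalel k (u v : gfun K) d (w : 'S_d) :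
  gconv (fun e x => k * u e x) v w = k * gconv u v w.
Proof. by rewrite /gconv mulr_sumr; apply: eq_bigr => z _; rewrite mulrA. Qed.

Lemma gconv_scaler k (u v : gfun K) d (w : 'S_d) :
  gconv u (fun e x => k * v e x) w = k * gconv u v w.
Proof. by rewrite /gconv mulr_sumr; apply: eq_bigr => z _; rewrite mulrCA. Qed.

Lemma gtens_scalel m n k (u v : gfun K) d (w : 'S_d) :
  gtens m n (fun e x => k * u e x) v w = k * gtens m n u v w.
Proof.
rewrite /gtens; case: eqP => _; last by rewrite mulr0.
rewrite mulr_sumr; apply: eq_bigr => x _; rewrite mulr_sumr.
by apply: eq_bigr => y _; ring.
Qed.

Lemma gtens_scaler m n k (u v : gfun K) d (w : 'S_d) :
  gtens m n u (fun e x => k * v e x) w = k * gtens m n u v w.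
Proof.
rewrite /gtens; case: eqP => _; last by rewrite mulr0.
rewrite mulr_sumr; apply: eq_bigr => x _; rewrite mulr_sumr.
by apply: eq_bigr => y _; ring.
Qed.

Lemma ev_Tens f g :
  ev (Tens f g) = gtens (sumn (src f)) (sumn (src g)) (ev f) (ev g).
Proof. by []. Qed.

Lemma ev_MergeE k l d (w : 'S_d) : ev (Merge k l : diag K) w = (d == k + l)%N%:R.
Proof. exact: gyoung1. Qed.

Lemma ev_Id1 k d (w : 'S_d) : ev (Id (strip [:: k]) : diag K) w = (d == k)%:R.
Proof. exact: gyoung1. Qed.

Lemma ev_SplitE k l d (w : 'S_d) : ev (Split k l : diag K) w = (d == k + l)%N%:R.
Proof. exact: gyoung1. Qed.

Lemma ev_Comp_Merge k l f d (w : 'S_d) :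
  ev (Comp (Merge k l) f) w =
    (d == k + l)%N%:R * (gaug (ev f) d / (ycard (tgt f))%:R).
Proof. by rewrite ev_Comp gconv_youngl mulrC mulrA. Qed.

Lemma ev_Comp_Split k l f d (w : 'S_d) :
  ev (Comp f (Split k l)) w =
    (d == k + l)%N%:R * (gaug (ev f) d / (ycard (strip [:: k; l]))%:R).
Proof. by rewrite ev_Comp gconv_youngr mulrC mulrA. Qed.

(** The interchange law holds on symbols because both the convolution and the
    normalizing factor are multiplicative; the degrees of the middle objects
    match because a symbol whose two degrees differ vanishes. *)
Lemma ev_Tens_Comp b c b' c' a a' f g f' g' :
  typed b c g -> typed a b f -> typed b' c' g' -> typed a' b' f' ->
  ev (Tens (Comp g f) (Comp g' f')) = ev (Comp (Tens g g') (Tens f f')).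
Proof.
move=> tg tf tg' tf'; have [_ sf ef] := typedP _ _ _ tf.
have [_ sf' ef'] := typedP _ _ _ tf'; have [_ sg _] := typedP _ _ _ tg.
have [_ sg' _] := typedP _ _ _ tg'.
apply: gfunP => d w; rewrite ev_Comp [tgt _]/= ycard_cat natrM invfM.
rewrite !ev_Tens /= gtens_scalel gtens_scaler mulrA; congr (_ * _).
rewrite gtens_conv sf sf' sg sg' /=.
have bf := ev_binv_typed tf; have bf' := ev_binv_typed tf'.
rewrite /gconv; apply: eq_bigr => z _.
have [e|ne] := eqVneq (sumn a) (sumn b); last first.
  suff -> : gtens (sumn a) (sumn a') (ev f) (ev f') z = 0 by rewrite !mulr0.
  rewrite /gtens; case: ifP => // _; rewrite big1 // => x _; rewrite big1 // => y _.
  by rewrite (binv_diff x bf ne) mul0r mulr0.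
have [e'|ne'] := eqVneq (sumn a') (sumn b'); last first.
  suff -> : gtens (sumn a) (sumn a') (ev f) (ev f') z = 0 by rewrite !mulr0.
  rewrite /gtens; case: ifP => // _; rewrite big1 // => x _; rewrite big1 // => y _.
  by rewrite (binv_diff y bf' ne') mulr0 mulr0.
by rewrite e e'.
Qed.

Lemma gtens0l (u v : gfun K) n : (forall d (w : 'S_d), u d w = (d == 0)%N%:R) ->
  gtens 0 n u v = fun d w => (d == n)%:R * v d w.
Proof.
move=> u1; apply: gtens_eq => [d w|w nw|x y].
- by rewrite add0n => /negPf->; rewrite mul0r.
- by case/eqP: (nw (1%g : 'S_0) w); rewrite permprod0l.
- by rewrite permprod0l (_ : (0 + n == n)%N = true) ?add0n ?eqxx // u1 !mul1r.
Qed.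

Lemma gtens0r (u v : gfun K) n : (forall d (w : 'S_d), v d w = (d == 0)%N%:R) ->
  gtens n 0 u v = fun d w => (d == n)%:R * u d w.
Proof.
move=> v1; apply: gfunP => d w; have [e|nd] := eqVneq d (n + 0)%N; last first.
  by rewrite gtens_deg // -[n in X in _ = X * _]addn0 (negPf nd) mul0r.
have e' : d = n by rewrite e addn0.
subst n; rewrite eqxx mul1r gtensE // (bigD1 w) //= [X in _ + X]big1 => [|x nx].
  rewrite addr0 (bigD1 1%g) //= [X in _ + X]big1 => [|y /eqP[]].
    by rewrite permprod0r eqxx v1 eqxx mul1r mulr1 addr0.
  by apply/permP => -[].
rewrite big1 // => y _; rewrite permprod0r (negPf nx) mul0r //.
Qed.

(** The defining relations of Sp(Perm) hold between symbols.  Associativity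
    of merges and splits holds because both sides have constant symbol 1, and
    the square-switch relation is the only one with combinatorial content. *)
Theorem deq_ev a b f g : deq a b f g -> ev f = ev g.
Proof.
elim=> {a b f g}.
- by [].
- by [].
- by move=> a b f g h _ -> _ ->.
- move=> a b c g g' f f' _ eg df ef; apply: gfunP => d w.
  have [/typedP[_ _ t] /typedP[_ _ t']] := deq_typed df.
  by rewrite !ev_Comp eg ef t t'.
- move=> a b c d f f' g g' df ef dg eg.
  have [/typedP[_ sf _] /typedP[_ sf' _]] := deq_typed df.
  have [/typedP[_ sg _] /typedP[_ sg' _]] := deq_typed dg.
  by rewrite !ev_Tens ef eg sf sf' sg sg'.
- by move=> a b f f' g g' _ /= -> _ ->.
- by move=> a b k f f' _ /= ->.
- by move=> a b f g h _ _ _; apply: gfunP => d w /=; rewrite addrA.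
- by move=> a b f g _ _; apply: gfunP => d w /=; rewrite addrC.
- by move=> a b f _; apply: gfunP => d w /=; rewrite add0r.
- by move=> a b f _; apply: gfunP => d w /=; rewrite mul0r.
- by move=> a b f _; apply: gfunP => d w /=; rewrite mul1r.
- by move=> a b k l f _; apply: gfunP => d w /=; rewrite mulrA.
- by move=> a b k l f _; apply: gfunP => d w /=; rewrite mulrDl.
- by move=> a b k f g _ _; apply: gfunP => d w /=; rewrite mulrDr.
- move=> a b c d h g f _ _ _; apply: gfunP => n w /=.
  by rewrite gconv_scaler gconv_scalel gconvA mulrCA.
- move=> a b f tf; apply: gfunP => d w; rewrite ev_Comp.
  case/typedP: (tf) => _ _ ->.
  by rewrite (gconv_young1l _ (ev_binv_typed tf)) mulKf ?ycard_neq0.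
- move=> a b f tf; apply: gfunP => d w; rewrite ev_Comp.
  by rewrite (gconv_young1r _ (ev_binv_typed tf)) mulKf ?ycard_neq0.
- move=> a b c g g' f _ _ _; apply: gfunP => d w /=.
  rewrite -mulrDr /gconv -big_split; congr (_ * _); apply: eq_bigr => z _ /=.
  by rewrite mulrDl.
- move=> a b c g f f' _ /typedP[_ _ t] /typedP[_ _ t']; apply: gfunP => d w /=.
  rewrite t t' -mulrDr /gconv -big_split; congr (_ * _); apply: eq_bigr => z _ /=.
  by rewrite mulrDr.
- by move=> a b c k g f _ _; apply: gfunP => d w /=; rewrite gconv_scalel mulrCA.
- by move=> a b c k g f _ _; apply: gfunP => d w /=; rewrite gconv_scaler mulrCA.
- by move=> a b; apply: gyoung_tens.
- by move=> a b c a' b' c' g f g' f' tg tf tg' tf'; apply: ev_Tens_Comp tg tf tg' tf'.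
- by move=> a a' b b' c c' f g h _ _ _; rewrite !ev_Tens /= !sumn_cat gtensA.
- move=> a b f tf; rewrite ev_Tens gtens0l => [|d w]; last by rewrite [LHS]gyoung_size1.
  apply: gfunP => d w; have [_|nd] := eqVneq; first by rewrite mul1r.
  have [ua _ _ _] := ev_binv_typed tf; rewrite mul0r ua //.
  by case/typedP: tf nd => _ ->.
- move=> a b f tf; rewrite ev_Tens gtens0r => [|d w]; last by rewrite [LHS]gyoung_size1.
  apply: gfunP => d w; have [_|nd] := eqVneq; first by rewrite mul1r.
  have [ua _ _ _] := ev_binv_typed tf; rewrite mul0r ua //.
  by case/typedP: tf nd => _ ->.
- move=> a b c d f f' g /typedP[_ s _] /typedP[_ s' _] _; apply: gfunP => n w.
  have E : ev (Add f f') = (fun e x => 1 * ev f x + ev f' x).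
    by apply: gfunP => e x; rewrite /= mul1r.
  by rewrite ev_Tens E gtens_linl /= s s' mul1r.
- move=> a b c d f g g' _ /typedP[_ s _] /typedP[_ s' _]; apply: gfunP => n w.
  have E : ev (Add g g') = (fun e x => 1 * ev g x + ev g' x).
    by apply: gfunP => e x; rewrite /= mul1r.
  by rewrite ev_Tens E gtens_linr /= s s' mul1r.
- by move=> a b c d k f g _ _; apply: gfunP => n w /=; rewrite gtens_scalel.
- by move=> a b c d k f g _ _; apply: gfunP => n w /=; rewrite gtens_scaler.
- by move=> k; apply: gfunP => d w; rewrite ev_MergeE ev_Id1 addn0.
- by move=> k; apply: gfunP => d w; rewrite ev_MergeE ev_Id1.
- by move=> k; apply: gfunP => d w; rewrite ev_SplitE ev_Id1 addn0.
- by move=> k; apply: gfunP => d w; rewrite ev_SplitE ev_Id1.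
- move=> k l m; apply: gfunP => d w.
  rewrite !ev_Comp_Merge addnA; case: eqP => [e|_]; last by rewrite !mul0r.
  congr (_ * _); rewrite ev_Tens_Merge_Id ev_Tens_Id_Merge.
  have E p q : (p + q = d)%N -> gaug (gyoung K (strip [:: p; q])) d = (ycard (strip [:: p; q]))%:R.
    by move=> <-; rewrite -gaug_young sumn_strip /= addn0.
  rewrite !E ?addnA // [tgt _](_ : _ = strip [:: (k + l)%N; m]); last exact: esym (strip_cat _ _).
  rewrite [tgt _](_ : _ = strip [:: k; (l + m)%N]); last exact: esym (strip_cat _ _).
  by rewrite !mulfV ?ycard_neq0.
- move=> k l m; apply: gfunP => d w.
  rewrite !ev_Comp_Split addnA; case: eqP => [e|_]; last by rewrite !mul0r.
  congr (_ * _); rewrite ev_Tens_Split_Id ev_Tens_Id_Split.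
  have E p q : (p + q = d)%N -> gaug (gyoung K (strip [:: p; q])) d = (ycard (strip [:: p; q]))%:R.
    by move=> <-; rewrite -gaug_young sumn_strip /= addn0.
  by rewrite !E ?addnA // !mulfV ?ycard_neq0.
- move=> k l; apply: gfunP => d w; rewrite ev_Comp_Merge.
  have -> : ev (Scale 'C(k + l, l)%:R (Id (strip [:: (k + l)%N]))) w =
    'C(k + l, l)%:R * (d == k + l)%N%:R :> K by rewrite -(ev_Id1 _ w).
  rewrite mulrC; case: eqP => [->|_]; last by rewrite !mulr0.
  rewrite !mulr1 [gaug _ _](_ : _ = (ycard (strip [:: (k + l)%N]))%:R); last first.
    by rewrite -gaug_young sumn_strip /= addn0.
  rewrite ycard1 ycard2 -(bin_fact (leq_addl k l)) addnK [(k`! * _)%N]mulnC natrM.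
  by rewrite mulfK // natr_neq0 // muln_gt0 !fact_gt0.
- by move=> k l r s; apply: ev_EF.
Qed.

End Soundness.

(** * Symbols of equivariant maps *)

Section Cosets.
Local Open Scope group_scope.
Variables (d : nat) (s : seq nat).

Lemma eq_ycos (g h : 'S_d) : (ycos s g == ycos s h) = (g * h^-1 \in young d s).
Proof.
apply/eqP/idP => [/(congr1 (fun X => sval X)) /= e|/ycosE//].
by rewrite -mem_rcoset -e rcoset_refl.
Qed.

Lemma card_ycos (h : 'S_d) : #|[set g : 'S_d | ycos s g == ycos s h]| = #|young d s|.
Proof.
rewrite -[RHS](card_rcoset _ h); apply: eq_card => g.
by rewrite !inE eq_ycos mem_rcoset.
Qed.

(** Passing from cosets to permutations multiplies a sum by the order of the
    subgroup. *)
Lemma sum_cosets (K : fieldType) (F : 'S_d -> K) :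
    (forall y g, y \in young d s -> F (y * g) = F g) ->
  (\sum_g F g = #|young d s|%:R * \sum_(X : ycoset d s) F (yrepr X))%R.
Proof.
move=> Fy; rewrite (partition_big (ycos s) xpredT) //= GRing.mulr_sumr.
apply: eq_bigr => X _; rewrite -(card_ycos (yrepr X)) mulr_natl -sumr_const.
apply: eq_big => [g|g /eqP gX]; first by rewrite inE yreprK.
rewrite -[in LHS](mulgKV (yrepr X) g) Fy // -eq_ycos gX yreprK //.
Qed.

End Cosets.

Section Symbols.
Variable K : fieldType.

(** The symbol of an equivariant map: the coefficients of the image of the
    trivial coset, set to 0 outside the common degree. *)
Definition hsym (a b : pob) (p : phom K a b) : gfun K := fun d w =>
  if (d == pdeg a) && (d == pdeg b)
  then p (pone K a) (ycos (pshape b) (permto (pdeg b) w)) else 0.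

Lemma hsymE n (s t : composition) (sn : sumn s == n) (tn : sumn t == n)
    (p : phom K (POb sn) (POb tn)) (w : 'S_n) :
  hsym p w = p (pone K (POb sn)) (ycos t w).
Proof. by rewrite /hsym /= eqxx permto_id. Qed.

Lemma hsym_deg a b (p : phom K a b) d (w : 'S_d) :
  (d == pdeg a) && (d == pdeg b) = false -> hsym p w = 0.
Proof. by rewrite /hsym => ->. Qed.

Lemma hsym0 a b (p : phom K a b) d (w : 'S_d) : (forall v, p v = 0) -> hsym p w = 0.
Proof. by rewrite /hsym => ->; rewrite ffunE if_same. Qed.

Lemma hsym_lin a b k (p q : phom K a b) d (w : 'S_d) :
  hsym (k *: p + q) w = k * hsym p w + hsym q w.
Proof.
rewrite /hsym; case: ifP => _; last by rewrite mulr0 addr0.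
by rewrite /= add_lfunE scale_lfunE !ffunE.
Qed.

(** The trivial coset generates M^a. *)
Lemma hsym_inj a b (p q : phom K a b) : hsym p = hsym q -> p = q.
Proof.
case: a b p q => [n s sn] [m t tm] p q e.
have [nm|nm] := eqVneq n m; last first.
  have z (r : phom K (POb sn) (POb tm)) v : r v = 0.
    by case: (phom_deg r) => //= nm'; rewrite nm' eqxx in nm.
  by apply: phom_eq => h; rewrite !z.
subst m; apply: phom_eq => h; rewrite ebas_cos !phomP; congr pact.
apply/ffunP => X; rewrite -(yreprK X) -!hsymE.
by rewrite e.
Qed.

Lemma hsym_binv a b (p : phom K a b) : binv (pshape a) (pshape b) (hsym p).
Proof.
case: a b p => [n s sn] [m t tm] p /=.
split=> [d w|d w|d y w yY|d y w yY]; rewrite ?(eqP sn) ?(eqP tm).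
- by move=> nd; rewrite hsym_deg //= (negPf nd).
- by move=> nd; rewrite hsym_deg //= (negPf nd) andbF.
- have [/andP[/eqP e /eqP e']|ne] := boolP ((d == n) && (d == m)); last first.
    by rewrite !hsym_deg //=; apply: negbTE.
  subst m; subst n; rewrite !hsymE; congr (p _ _).
  by apply: ycosE; rewrite mulgK.
have [/andP[/eqP e /eqP e']|ne] := boolP ((d == n) && (d == m)); last first.
  by rewrite !hsym_deg //=; apply: negbTE.
subst m; subst n; rewrite !hsymE.
have := phomP p (pone K (POb sn)) y^-1%g.
rewrite pone_young ?groupV // permto_id => {2}->.
by rewrite ffunE invgK ymul_cos.
Qed.

Lemma Arr_phi a b a' b' (p : phom K a b) (p' : phom K a' b') :
  a = a' -> b = b' -> hsym p = hsym p' ->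
  @Arr K (perm_data K) a b p = @Arr K (perm_data K) a' b' p'.
Proof. by move=> ea eb; subst => /hsym_inj->. Qed.

(** Stated on packed arrows, so that an equality of arrows between objects
    that are only propositionally equal still gives an equality of symbols. *)
Definition hsym_arrow (x : arrow (perm_data K)) : gfun K := hsym (projT2 x).

Lemma hsym_Arr a b a' b' (p : phom K a b) (p' : phom K a' b') :
  @Arr K (perm_data K) a b p = @Arr K (perm_data K) a' b' p' -> hsym p = hsym p'.
Proof. exact: (congr1 hsym_arrow). Qed.

End Symbols.

Section Reconstruction.
Variables (K : fieldType) (n : nat) (s t : composition) (u : gfun K).

Definition symbol_vec : pmod K n t := [ffun Y => u (yrepr Y)].

(** The map sending the coset S_s g to the translate by g of the vector
    described by u. *)
Definition symbol_map (v : pmod K n s) : pmod K n t :=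
  \sum_X v X *: pact symbol_vec (yrepr X).

Lemma symbol_map_linear : linear symbol_map.
Proof.
move=> k v v'; rewrite /symbol_map scaler_sumr -big_split; apply: eq_bigr => X _ /=.
by rewrite !ffunE scalerA -scalerDl.
Qed.

HB.instance Definition _ :=
  GRing.isLinear.Build K _ _ _ symbol_map symbol_map_linear.

Hypothesis ul : forall y w : 'S_n, y \in young n t -> u (y * w)%g = u w.
Hypothesis ur : forall y w : 'S_n, y \in young n s -> u (w * y)%g = u w.

Lemma symbol_vecE (w : 'S_n) : symbol_vec (ycos t w) = u w.
Proof. by rewrite ffunE -(mulgKV w (yrepr _)) ul // yrepr_cos. Qed.

Lemma symbol_map_ebas (g : 'S_n) :
  symbol_map (ebas K (ycos s g)) = pact symbol_vec g.
Proof.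
rewrite /symbol_map (bigD1 (ycos s g)) //= big1 => [|X /negPf nX]; last first.
  by rewrite ffunE nX scale0r.
rewrite addr0 ffunE eqxx scale1r; apply/ffunP => Y; rewrite -(yreprK Y).
rewrite [LHS]ffunE [RHS]ffunE !ymul_cos !symbol_vecE.
rewrite -[in RHS](mulgKV (yrepr (ycos s g)) (yrepr Y)) -[in RHS]mulgA.
by rewrite [RHS]ur // yrepr_cos.
Qed.

Lemma symbol_map_pact (v : pmod K n s) (g : 'S_n) :
  symbol_map (pact v g) = pact (symbol_map v) g.
Proof.
elim/pmod_ind: v => [k v v' ev ev'|h]; last first.
  by rewrite pact_ycos !symbol_map_ebas pactM.
by rewrite pact_lin !symbol_map_linear ev ev' pact_lin.
Qed.

End Reconstruction.

Section SymbolsMore.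
Variable K : fieldType.
Hypothesis char0 : forall n, n.+1%:R != 0 :> K.

Lemma hsym_surj (a b : pob) (u : gfun K) : binv (pshape a) (pshape b) u ->
  exists p : phom K a b, hsym p = u.
Proof.
case: a b => [n s sn] [m t tm] /= bu.
have [e|ne] := eqVneq n m; last first.
  exists 0; apply: gfunP => d w; rewrite (binv_diff w bu) ?(eqP sn) ?(eqP tm) //.
  by rewrite hsym0 // => v; rewrite lfunE.
subst m; have [ua ub ul ur] := bu.
have hom : linfun (@symbol_map K n s t u) \in @ishom K (POb sn) (POb tm).
  rewrite unfold_in /ishom eqxx; apply/asboolP => v g; rewrite !lfunE permto_id.
  by apply: symbol_map_pact => y w; [apply: ul | apply: ur].
exists (PHom hom); apply: gfunP => d w.
have [e|nd] := eqVneq d n; last by rewrite hsym_deg ?ua ?(eqP sn) //= (negPf nd).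
subst d; rewrite hsymE.
have Ep : PHom hom (pone K (POb sn)) = @symbol_vec K n t u.
  rewrite /= lfunE; apply: etrans (pact1 _).
  by apply: symbol_map_ebas => y x; [apply: ul | apply: ur].
by rewrite Ep symbol_vecE // => y x; apply: ul.
Qed.

Lemma ycard_pshape (a : pob) : ycard (pshape a) = #|young (pdeg a) (pshape a)|.
Proof. by case: a => [n s /= sn]; rewrite /ycard (eqP sn). Qed.

Lemma hsym_comp (a b c : pob) (g : phom K b c) (f : phom K a b) d (w : 'S_d) :
  hsym (pcomp g f) w = (ycard (pshape b))%:R^-1 * gconv (hsym g) (hsym f) w.
Proof.
have z0 : (forall v, pcomp g f v = 0) ->
    (forall z : 'S_d, hsym g z = 0) \/ (forall z : 'S_d, hsym f z = 0) ->
    hsym (pcomp g f) w = (ycard (pshape b))%:R^-1 * gconv (hsym g) (hsym f) w.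
  move=> gf0 H; rewrite hsym0 // /gconv big1 ?mulr0 // => z _.
  by case: H => ->; rewrite ?mul0r ?mulr0.
case: (phom_deg f) => [ab|f0]; last first.
  apply: z0 => [v|]; first by rewrite /= comp_lfunE f0 linear0.
  by right=> z; rewrite hsym0.
case: (phom_deg g) => [bc|g0]; last first.
  apply: z0 => [v|]; first by rewrite /= comp_lfunE g0.
  by left=> z; rewrite hsym0.
have [e|nd] := eqVneq d (pdeg a); last first.
  rewrite hsym_deg ?(negPf nd) // /gconv big1 ?mulr0 // => z _.
  by rewrite [hsym f z]hsym_deg ?mulr0 // (negPf nd).
rewrite {z0} ycard_pshape.
case: a b c ab bc f g e => [n s sn] [m t tm] [l r rl] /= ab bc; subst m; subst l.
move=> f g e; subst d; rewrite hsymE /= comp_lfunE.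
rewrite /gconv (@sum_cosets _ t) => [|y z yY]; last first.
  have [_ _ fl _] := hsym_binv f; have [_ _ _ gr] := hsym_binv g.
  have yV : (y^-1)%g \in young n t by rewrite groupV.
  by rewrite (fl _ _ _ yY) invMg mulgA (gr _ _ _ yV).
rewrite mulKf; last by rewrite natr_neq0 // cardG_gt0.
rewrite {1}(pmodE (f _)) linear_sum sum_ffunE; apply: eq_bigr => Z _.
rewrite linearZ ffunE [RHS]mulrC; congr (_ * _); first by rewrite hsymE yreprK.
have E (h x : 'S_n) : g (ebas K (ycos t h)) (ycos r x) = hsym g (x * h^-1)%g.
  by rewrite ebas_cos phomP permto_id ffunE ymul_cos hsymE.
by apply: etrans (E (yrepr Z) w); rewrite yreprK.
Qed.

Lemma hsym_id (a : pob) : hsym (pid K a) = gyoung K (pshape a).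
Proof.
apply: gfunP => d w; case: a => [n s sn].
have [e|nd] := eqVneq d n; last first.
  by rewrite hsym_deg ?gyoung_deg ?(eqP sn) //= (negPf nd).
subst d; rewrite hsymE /= id_lfunE ffunE eq_ycos invg1 mulg1 /gyoung (eqP sn) eqxx.
by [].
Qed.

Lemma pouter_out m n (s t : seq nat) (u : pmod K m s) (v : pmod K n t)
    (w : 'S_(m + n)) : sumn s = m -> (forall x y, w != permprod x y) ->
  pouter u v (ycos (s ++ t) w) = 0.
Proof.
move=> sm nw; rewrite /pouter sum_ffunE big1 // => X _.
rewrite sum_ffunE big1 // => Y _; rewrite !ffunE.
case: eqP => [/eqP|_]; last by rewrite [LHS]mulr0.
rewrite eq_ycos => /(young_prod_inv sm)[x [y [_ _ e]]].
have /eqP := nw (x * yrepr X)%g (y * yrepr Y)%g; case.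
by rewrite -permprodM -e mulgKV.
Qed.

Lemma pouterE m n (s t : seq nat) (u : pmod K m s) (v : pmod K n t)
    (x : 'S_m) (y : 'S_n) : sumn s = m ->
  pouter u v (ycos (s ++ t) (permprod x y)) = u (ycos s x) * v (ycos t y).
Proof.
move=> sm; elim/pmod_ind: u => [k u u' eu eu'|x'].
  by rewrite pouter_linl !ffunE eu eu' [RHS]mulrDl; congr (_ + _); apply: mulrA.
elim/pmod_ind: v => [k v v' ev ev'|y'].
  by rewrite pouter_linr !ffunE ev ev' [RHS]mulrDr; congr (_ + _); rewrite ffunE //; apply: mulrCA.
rewrite pouter_ebas // !ffunE !eq_ycos permprodV permprodM permprod_young //.
by rewrite -natrM mulnb.
Qed.

Lemma hsym_tens (a b c d : pob) (f : phom K a b) (g : phom K c d) :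
  hsym (ptens f g) = gtens (pdeg a) (pdeg c) (hsym f) (hsym g).
Proof.
apply: esym; case: (phom_deg f) => [ab|f0]; last first.
  apply: gfunP => n w; rewrite [RHS]/hsym; case: ifP => [/andP[/eqP e /eqP e']|_].
    have -> : pone K (pprod a c) = pouter (pone K a) (pone K c) by rewrite pouter_pone.
    rewrite ptensE1 f0 pouter0l ffunE.
    rewrite gtensE // big1 // => x _; rewrite big1 // => y _.
    by rewrite hsym0 // mul0r mulr0.
  rewrite /gtens; case: ifP => // _; rewrite big1 // => x _; rewrite big1 // => y _.
  by rewrite hsym0 // mul0r mulr0.
case: (phom_deg g) => [cd|g0]; last first.
  apply: gfunP => n w; rewrite [RHS]/hsym; case: ifP => [/andP[/eqP e /eqP e']|_].
    have -> : pone K (pprod a c) = pouter (pone K a) (pone K c) by rewrite pouter_pone.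
    rewrite ptensE1 g0 pouter0r ffunE.
    rewrite gtensE // big1 // => x _; rewrite big1 // => y _.
    by rewrite [X in _ * (_ * X)]hsym0 // !mulr0.
  rewrite /gtens; case: ifP => // _; rewrite big1 // => x _; rewrite big1 // => y _.
  by rewrite [X in _ * (_ * X)]hsym0 // !mulr0.
move: a b c d ab cd f g => [n a an] [n' b bn] [m c cm] [m' d dm] /= ab cd; subst n' m'.
move=> f g; have sb := eqP bn.
have oneE : pone K (pprod (POb an) (POb cm)) = pouter (pone K (POb an)) (pone K (POb cm)).
  by rewrite pouter_pone.
have hsymP (w : 'S_(n + m)) : hsym (ptens f g) w =
    pouter (f (pone K (POb an))) (g (pone K (POb cm))) (ycos (b ++ d) w).
  by rewrite /hsym !eqxx oneE ptensE1 permto_id.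
apply: gtens_eq => [l w nd|w nw|x y].
- by rewrite hsym_deg //= (negPf nd).
- by rewrite hsymP pouter_out.
- by rewrite hsymP pouterE // !hsymE.
Qed.

Lemma pone_size1 (a : pob) (w : 'S_(pdeg a)) : (size (pshape a) <= 1)%N ->
  pone K a (ycos (pshape a) w) = 1.
Proof.
by move=> s1; rewrite ffunE eq_ycos young_size1 // (eqP (pob_sum a)).
Qed.

Lemma hsym_nabla k l : hsym (nabla K k l) = gyoung K (strip [:: (k + l)%N]).
Proof.
apply: gfunP => d w; rewrite gyoung1 /hsym.
rewrite (_ : _ && _ = (d == k + l)%N); last by rewrite /= !addn0 andbb.
case: ifP => // _; rewrite lfunE /= /nabla_fun ffunE.
rewrite (bigD1 (ycos _ 1%g)) //= big1 => [|X /negPf nX]; last by rewrite ffunE nX.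
rewrite ffunE eqxx addr0 [LHS]mul1r; apply: pone_size1.
by rewrite /=; case: ifP.
Qed.

Lemma hsym_delta k l : hsym (delta K k l) = gyoung K (strip [:: (k + l)%N]).
Proof.
apply: gfunP => d w; rewrite gyoung1 /hsym.
rewrite (_ : _ && _ = (d == k + l)%N); last by rewrite /= !addn0 andbb.
case: ifP => // _.
have one : pone K (Mob [:: (k + l)%N]) (ycos (pshape (Mob [:: (k + l)%N])) 1%g) = 1.
  by apply: pone_size1; rewrite /=; case: ifP.
have -> : delta K k l (pone K (Mob [:: (k + l)%N])) = ((k`! * l`!)%N%:R^-1 *:
    \sum_(g : 'S_(pdeg (Mob [:: k; l]))) ebas K (ycos (pshape (Mob [:: k; l])) g)).
  by rewrite lfunE -[LHS]/(@delta_fun K k l _) /delta_fun one scale1r.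
rewrite ffunE sum_ffunE.
set v := ycos _ _.
have -> : \sum_(g : 'S_(pdeg (Mob [:: k; l]))) ebas K (ycos _ g) v =
    #|young (pdeg (Mob [:: k; l])) (pshape (Mob [:: k; l]))|%:R.
  rewrite -(card_ycos _ (permto (pdeg (Mob [:: k; l])) w)) -sum1dep_card natr_sum.
  rewrite [RHS]big_mkcond; apply: eq_bigr => g _; rewrite ffunE eq_sym.
  by case: (_ == _).
rewrite -ycard_pshape ycard2; apply: mulVf.
by rewrite natr_neq0 // muln_gt0 !fact_gt0.
Qed.

End SymbolsMore.

From Stdlib Require Import Setoid Morphisms.

(** * Equality of diagrams as an unconditional congruence *)

(** Equality of diagrams without reference to a boundary.  Since ill-formed
    diagrams are only related to diagrams that are ill-formed with the same
    boundary, all diagram constructors respect it unconditionally, and it can be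
    used for rewriting under them. *)
Definition eqd (K : fieldType) (f g : diag K) : Prop :=
  [/\ wf f = wf g, src f = src g, tgt f = tgt g
    & wf f -> deq (src f) (tgt f) f g].

Local Notation "f === g" := (eqd f g) (at level 70, no associativity).

Section Eqd.
Variable K : fieldType.
Implicit Types (f g h : diag K) (a b c : composition).

Lemma wf_typed f : wf f -> typed (src f) (tgt f) f.
Proof. by move=> w; apply/typedP. Qed.

Lemma deq_eqd a b f g : deq a b f g -> f === g.
Proof.
move=> fg; have [/typedP[w1 s1 t1] /typedP[w2 s2 t2]] := deq_typed fg; subst a b.
by split; rewrite ?w1 ?w2 ?s2 ?t2.
Qed.

Lemma eqd_deq a b f g : typed a b f -> f === g -> deq a b f g.
Proof. by move=> /typedP[w <- <-] [_ _ _ /(_ w)]. Qed.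

Lemma eqd_refl f : f === f.
Proof. by split=> // w; apply: deq_refl; apply: wf_typed. Qed.

Lemma eqd_sym f g : f === g -> g === f.
Proof.
move=> [w s t d]; split=> // wg; rewrite -w in wg.
by rewrite -s -t; apply: deq_sym; apply: d.
Qed.

Lemma eqd_trans f g h : f === g -> g === h -> f === h.
Proof.
move=> [w s t d] [w' s' t' d']; split; try by congruence.
move=> wf; apply: deq_trans (d wf) _; rewrite s t; apply: d'.
by rewrite -w.
Qed.

Lemma eqd_typed a b f g : f === g -> typed a b f -> typed a b g.
Proof. by move=> [w s t _]; rewrite /typed w s t. Qed.

Lemma eqd_wf f g : wf f = wf g -> src f = src g -> tgt f = tgt g ->
  (wf f -> wf g -> deq (src f) (tgt f) f g) -> f === g.
Proof. by move=> w s t d; split=> // wf; apply: d; rewrite -?w. Qed.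

Lemma eqd_Comp g g' f f' : g === g' -> f === f' -> Comp g f === Comp g' f'.
Proof.
move=> [w s t d] [w' s' t' d']; split; rewrite /= ?w ?s ?t ?w' ?s' ?t' //.
move=> /and3P[wg wf /eqP e]; rewrite -s' -t.
apply: deq_comp (d' (etrans w' wf)); rewrite t' e -s; exact: d (etrans w wg).
Qed.

Lemma eqd_Tens g g' f f' : g === g' -> f === f' -> Tens g f === Tens g' f'.
Proof.
move=> [w s t d] [w' s' t' d']; split; rewrite /= ?w ?s ?t ?w' ?s' ?t' //.
move=> /andP[wg wf]; rewrite -s -s' -t -t'.
exact: deq_tens (d (etrans w wg)) (d' (etrans w' wf)).
Qed.

Lemma eqd_Add g g' f f' : g === g' -> f === f' -> Add g f === Add g' f'.
Proof.
move=> [w s t d] [w' s' t' d']; split; rewrite /= ?w ?s ?t ?w' ?s' ?t' //.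
move=> /and4P[wg wf /eqP es /eqP et]; rewrite -s -t.
apply: deq_add (d (etrans w wg)) _; rewrite s t es et -s' -t'.
exact: d' (etrans w' wf).
Qed.

Lemma eqd_Scale k f f' : f === f' -> Scale k f === Scale k f'.
Proof.
by move=> [w s t d]; split=> //= wf; apply: deq_scale; apply: d.
Qed.

End Eqd.

#[global] Instance eqd_equiv (K : fieldType) : Equivalence (@eqd K).
Proof.
by split; [apply: eqd_refl | apply: eqd_sym | apply: eqd_trans].
Qed.

#[global] Instance eqd_Comp_m (K : fieldType) :
  Proper (@eqd K ==> @eqd K ==> @eqd K) (@Comp K).
Proof. by move=> g g' eg f f' ef; apply: eqd_Comp. Qed.

#[global] Instance eqd_Tens_m (K : fieldType) :
  Proper (@eqd K ==> @eqd K ==> @eqd K) (@Tens K).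
Proof. by move=> g g' eg f f' ef; apply: eqd_Tens. Qed.

#[global] Instance eqd_Add_m (K : fieldType) :
  Proper (@eqd K ==> @eqd K ==> @eqd K) (@Add K).
Proof. by move=> g g' eg f f' ef; apply: eqd_Add. Qed.

#[global] Instance eqd_Scale_m (K : fieldType) (k : K) :
  Proper (@eqd K ==> @eqd K) (@Scale K k).
Proof. by move=> f f' ef; apply: eqd_Scale. Qed.

Section EqdLaws.
Variable K : fieldType.
Implicit Types (f g h : diag K) (a b c : composition) (k l : K).

Lemma CompA h g f : Comp h (Comp g f) === Comp (Comp h g) f.
Proof.
apply: eqd_wf => //= [|/and3P[wh /and3P[wg wf /eqP e] /eqP e'] _].
  by case: (wf h); case: (wf g); case: (wf f); rewrite /= ?andbF // andbC.
by apply: deq_compA (wf_typed wh) _ _; apply/typedP.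
Qed.

Lemma Comp1f a f : tgt f = a -> Comp (Id a) f === f.
Proof.
by move=> <-; apply: eqd_wf => //=; rewrite ?eqxx ?andbT // => _ w; apply: deq_comp1f (wf_typed w).
Qed.

Lemma Compf1 a f : src f = a -> Comp f (Id a) === f.
Proof.
by move=> <-; apply: eqd_wf => //=; rewrite ?eqxx ?andbT // => _ w; apply: deq_compf1 (wf_typed w).
Qed.

Lemma Tens1 a b : (Tens (Id a) (Id b) : diag K) === Id (catc a b).
Proof. exact: deq_eqd (deq_tens1 _ _ _). Qed.

Lemma Tens_Comp g f g' f' : src g = tgt f -> src g' = tgt f' ->
  Tens (Comp g f) (Comp g' f') === Comp (Tens g g') (Tens f f').
Proof.
move=> e e'; apply: eqd_wf => //=.
  rewrite e e' !eqxx !andbT; by case: (wf g); case: (wf g'); case: (wf f).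
move=> /andP[/and3P[wg wf _] /and3P[wg' wf' _]] _.
by apply: deq_tens_comp; apply/typedP; split.
Qed.

Lemma TensA f g h : Tens f (Tens g h) === Tens (Tens f g) h.
Proof.
apply: eqd_wf; rewrite /= ?catcA ?andbA // => /andP[/andP[wf wg] wh] _.
by rewrite -!catcA; apply: deq_tensA; apply: wf_typed.
Qed.

Lemma Tens1f f : Tens (Id (strip [::])) f === f.
Proof.
by apply: eqd_wf; rewrite /= ?cat0c // => w _; apply: deq_tens1f (wf_typed w).
Qed.

Lemma Tensf1 f : Tens f (Id (strip [::])) === f.
Proof.
by apply: eqd_wf; rewrite /= ?catc0 ?andbT // => w _; apply: deq_tensf1 (wf_typed w).
Qed.

Lemma Comp_Scalel k g f : Comp (Scale k g) f === Scale k (Comp g f).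
Proof.
apply: eqd_wf => //= /and3P[wg wf /eqP e] _.
by apply: deq_compZl (wf_typed wg) _; apply/typedP.
Qed.

Lemma Comp_Scaler k g f : Comp g (Scale k f) === Scale k (Comp g f).
Proof.
apply: eqd_wf => //= /and3P[wg wf /eqP e] _.
by apply: deq_compZr (wf_typed wg) _; apply/typedP.
Qed.

Lemma Tens_Scalel k g f : Tens (Scale k g) f === Scale k (Tens g f).
Proof.
by apply: eqd_wf => //= /andP[wg wf] _; apply: deq_tensZl; apply: wf_typed.
Qed.

Lemma Tens_Scaler k g f : Tens g (Scale k f) === Scale k (Tens g f).
Proof.
by apply: eqd_wf => //= /andP[wg wf] _; apply: deq_tensZr; apply: wf_typed.
Qed.

Lemma ScaleA k l f : Scale k (Scale l f) === Scale (k * l) f.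
Proof. by apply: eqd_wf => //= w _; apply: deq_scaleA (wf_typed w). Qed.

Lemma Scale1 f : Scale 1 f === f.
Proof. by apply: eqd_wf => //= w _; apply: deq_scale1 (wf_typed w). Qed.

Lemma Scale0 a b f : typed a b f -> Scale 0 f === Zero a b.
Proof. by move=> tf; apply: deq_eqd (deq_scale0 tf). Qed.

Lemma Comp_Addl g g' f : src g = src g' -> Comp (Add g g') f === Add (Comp g f) (Comp g' f).
Proof.
move=> e; apply: eqd_wf => //=.
  rewrite e !eqxx; case: (wf g); case: (wf g'); case: (wf f);
    by case: (tgt f == src g'); case: (tgt g == tgt g').
move=> /and3P[/and4P[wg wg' _ /eqP et] wf /eqP ef] _.
by apply: deq_compDl (wf_typed wg) _ _; apply/typedP.
Qed.

Lemma Comp_Addr g f f' : tgt f = tgt f' -> Comp g (Add f f') === Add (Comp g f) (Comp g f').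
Proof.
move=> e; apply: eqd_wf => //=.
  rewrite e !eqxx; case: (wf g); case: (wf f); case: (wf f');
    by case: (tgt f' == src g); case: (src f == src f').
move=> /and3P[wg /and4P[wf wf' /eqP es _] /eqP ef] _.
by apply: deq_compDr (wf_typed wg) _ _; apply/typedP; split; rewrite -?e.
Qed.

Lemma Tens_Addl g g' f : src g = src g' -> tgt g = tgt g' ->
  Tens (Add g g') f === Add (Tens g f) (Tens g' f).
Proof.
move=> e e'; apply: eqd_wf => //=.
  by rewrite e e' !eqxx; case: (wf g); case: (wf g'); case: (wf f).
move=> /andP[/and4P[wg wg' _ _] wf] _.
by apply: deq_tensDl (wf_typed wg) _ (wf_typed wf); apply/typedP.
Qed.

Lemma Tens_Addr g f f' : src f = src f' -> tgt f = tgt f' ->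
  Tens g (Add f f') === Add (Tens g f) (Tens g f').
Proof.
move=> e e'; apply: eqd_wf => //=.
  by rewrite e e' !eqxx; case: (wf g); case: (wf f); case: (wf f').
move=> /andP[wg /and4P[wf wf' _ _]] _.
by apply: deq_tensDr (wf_typed wg) (wf_typed wf) _; apply/typedP.
Qed.

Lemma Add0f a b f : typed a b f -> Add (Zero a b) f === f.
Proof. by move=> tf; apply: deq_eqd (deq_add0 tf). Qed.

Lemma AddC f g : src f = src g -> tgt f = tgt g -> Add f g === Add g f.
Proof.
move=> es et; apply: eqd_wf => //=.
  by rewrite es et !eqxx; case: (wf f); case: (wf g).
move=> /and4P[wf wg _ _] _; apply: deq_addC (wf_typed wf) _; apply/typedP; split=> //.
Qed.

Lemma Zero_Comp a b c f : typed a b f -> Comp (Zero b c) f === Zero a c.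
Proof.
move=> tf; rewrite -(Scale0 (typed_zero K b c)) Comp_Scalel.
exact: Scale0 (typed_comp (typed_zero K b c) tf).
Qed.

Lemma Comp_Zero a b c g : typed b c g -> Comp g (Zero a b) === Zero a c.
Proof.
move=> tg; rewrite -(Scale0 (typed_zero K a b)) Comp_Scaler.
exact: Scale0 (typed_comp tg (typed_zero K a b)).
Qed.

Lemma Tens_Zerol a b c d g : typed c d g ->
  Tens (Zero a b) g === Zero (catc a c) (catc b d).
Proof.
move=> tg; rewrite -(Scale0 (typed_zero K a b)) Tens_Scalel.
exact: Scale0 (typed_tens (typed_zero K a b) tg).
Qed.

Lemma Tens_Zeror a b c d f : typed a b f ->
  Tens f (Zero c d) === Zero (catc a c) (catc b d).
Proof.
move=> tf; rewrite -(Scale0 (typed_zero K c d)) Tens_Scaler.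
exact: Scale0 (typed_tens tf (typed_zero K c d)).
Qed.

Lemma Scale_Zero a b k : Scale k (Zero a b) === Zero a b.
Proof.
by rewrite -{1}(Scale0 (typed_zero K a b)) ScaleA mulr0; apply: Scale0; apply: typed_zero.
Qed.

End EqdLaws.

#[global] Hint Resolve eqd_refl : core.

(** * Squares, the braid relation, and thin strands *)

(** The object made of d strands labelled 1, called thin. *)
Definition ones (d : nat) : composition := strip (nseq d 1%N).

Lemma onesD m n : ones (m + n) = catc (ones m) (ones n).
Proof. by rewrite /ones nseqD strip_cat. Qed.

Lemma onesS n : ones n.+1 = catc (ones n) (strip [:: 1%N]).
Proof. by rewrite -addn1 onesD. Qed.

Lemma sumn_ones n : sumn (ones n) = n.
Proof. by rewrite sumn_strip sumn_nseq mul1n. Qed.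

Lemma strip2 k l : strip [:: k; l] = catc (strip [:: k]) (strip [:: l]).
Proof. by rewrite -strip_cat. Qed.

Section SpLaws.
Variable K : fieldType.
Hypothesis char0 : forall n, n.+1%:R != 0 :> K.
Implicit Types (f g h : diag K) (a b c : composition).

Local Notation "1_ s" := (Id (strip s)) (at level 5, s at level 0).
Local Notation "f === g" := (@eqd K f g) (at level 70, no associativity).

Lemma Merge0r k : Merge k 0 === 1_[:: k].
Proof. exact: deq_eqd (deq_merge0r _ _). Qed.
Lemma Merge0l k : Merge 0 k === 1_[:: k].
Proof. exact: deq_eqd (deq_merge0l _ _). Qed.
Lemma Split0r k : Split k 0 === 1_[:: k].
Proof. exact: deq_eqd (deq_split0r _ _). Qed.
Lemma Split0l k : Split 0 k === 1_[:: k].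
Proof. exact: deq_eqd (deq_split0l _ _). Qed.

Lemma MergeA k l m : Comp (Merge (k + l) m) (Tens (Merge k l) 1_[:: m]) ===
  Comp (Merge k (l + m)) (Tens 1_[:: k] (Merge l m)).
Proof. exact: deq_eqd (deq_mergeA _ _ _ _). Qed.

Lemma SplitA k l m : Comp (Tens (Split k l) 1_[:: m]) (Split (k + l) m) ===
  Comp (Tens 1_[:: k] (Split l m)) (Split k (l + m)).
Proof. exact: deq_eqd (deq_splitA _ _ _ _). Qed.

Lemma Merge_Split k l :
  Comp (Merge k l) (Split k l) === Scale 'C(k + l, l)%:R 1_[:: (k + l)%N].
Proof. exact: deq_eqd (deq_merge_split _ _ _). Qed.

(** On two thin strands this acts as 1 plus the crossing. *)
Definition mergesplit : diag K := Comp (Split 1 1) (Merge 1 1).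

Local Notation X := mergesplit.

Lemma gbinom1 n : gbinom K n 1 = n%:~R.
Proof. by rewrite /gbinom big_ord_recl big_ord0 /= subr0 mulr1 (_ : 1`! = 1)%N // divr1. Qed.

Lemma IdTens_Comp a g f : src g = tgt f ->
  Tens (Id a) (Comp g f) === Comp (Tens (Id a) g) (Tens (Id a) f).
Proof. by move=> e; rewrite -Tens_Comp //= Comp1f. Qed.

Lemma TensId_Comp a g f : src g = tgt f ->
  Tens (Comp g f) (Id a) === Comp (Tens g (Id a)) (Tens f (Id a)).
Proof. by move=> e; rewrite -Tens_Comp //= Comp1f. Qed.

Lemma Addf0 a b f : typed a b f -> Add f (Zero a b) === f.
Proof. by move=> tf; rewrite AddC ?Add0f //; case/typedP: tf. Qed.

Lemma AddA f g h : src f = src g -> tgt f = tgt g -> src g = src h ->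
  tgt g = tgt h -> Add f (Add g h) === Add (Add f g) h.
Proof.
move=> s1 t1 s2 t2; apply: eqd_wf => //=.
  by rewrite s1 t1 s2 t2 !eqxx; case: (wf f); case: (wf g); case: (wf h).
move=> /and4P[w1 /and4P[w2 w3 _ _] _ _] _.
by apply: deq_addA (wf_typed w1) _ _; apply/typedP; split; rewrite ?s1 ?t1.
Qed.

Lemma AddNf a b f : typed a b f -> Add (Scale (-1) f) f === Zero a b.
Proof.
move=> tf; rewrite -{2}(Scale1 f) -(Scale0 tf) -(addNr 1).
exact: eqd_sym (deq_eqd (deq_scaleDl _ _ tf)).
Qed.

(** The square-switch relation at weights (j + 1, 1) with r = s = 1.  It
    expresses a split after a merge of a thick strand and a thin one through
    thinner merges and splits. *)
Lemma EF_square j :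
  Comp (Comp (Tens (Merge j 1) 1_[:: 1%N]) (Tens 1_[:: j] X))
       (Tens (Split j 1) 1_[:: 1%N]) ===
  Add (Comp (Split j.+1 1) (Merge j.+1 1)) (Scale j%:R 1_[:: j.+1; 1%N]).
Proof.
have /deq_eqd := deq_EF K j.+1 1%N 1%N 1%N.
have -> : j.+1%:Z - 1%N%:Z = j by lia.
have -> : 1%N%:Z + 1%N%:Z = (1 + 1)%N by [].
rewrite EdiagE -(addn1 j) FdiagE /EF_rhs !big_ord_recl big_ord0.
rewrite gbinom0 lift0 gbinom1.
rewrite [X in Scale X%:~R](_ : _ = j%:Z); last by lia.
rewrite (_ : (j + 1)%N%:Z + 1%N%:Z - 0%N%:Z = (j + 1 + 1)%N%:Z); last by lia.
rewrite (_ : (j + 1)%N%:Z + 1%N%:Z - 1%N%:Z = (j + 1 + 0)%N%:Z); last by lia.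
rewrite (_ : 1%N%:Z - 0%N%:Z = 1%N%:Z) // (_ : 1%N%:Z - 1%N%:Z = 0%N%:Z) //.
have -> : 0%N%:Z + (ord0 : 'I_2)%:Z = 0%N by [].
have -> : 0%N%:Z + (ord0 : 'I_1).+1%:Z = 1%N by [].
rewrite (EdiagE K 1 (j + 1) 0) (FdiagE K 1 (j + 1) 0).
rewrite (EdiagE K 0 (j + 1) 1) (FdiagE K 0 (j + 1) 1).
rewrite !strip0 !Tensf1 !Merge0r !Merge0l !Split0r !Split0l !Tens1.

rewrite -!strip2 !Comp1f // !Compf1 // Scale1.
have -> : iob (j + 1)%N 1%N = strip [:: (j + 1)%N; 1%N] by [].
have -> : iob ((j + 1)%N%:Z - 1%N%:Z + 1%N%:Z) (1%N%:Z + 1%N%:Z - 1%N%:Z) =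
  strip [:: (j + 1)%N; 1%N] by congr (strip [:: _; _]); lia.
rewrite Addf0 => [H|]; last exact: typed_scale (typed_id _ _).
rewrite /X IdTens_Comp // -H !CompA.
reflexivity.
Qed.

(** The square-switch relation at weights (1, 2) with r = s = 1; the binomial
    coefficient there is binom(-1, 1) = -1. *)
Lemma FE_square :
  Comp (Comp (Tens 1_[:: 1%N] (Merge 1 1)) (Tens X 1_[:: 1%N]))
       (Tens 1_[:: 1%N] (Split 1 1)) ===
  Add (Comp (Split 1 2) (Merge 1 2)) 1_[:: 1%N; 2%N].
Proof.
have /deq_eqd := deq_EF K 1%N 2%N 1%N 1%N.
rewrite (_ : 1%N%:Z - 1%N%:Z = 0%N) // (_ : 2%N%:Z + 1%N%:Z = (1 + 2)%N) //.
rewrite EdiagE /EF_rhs !big_ord_recl big_ord0.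
rewrite gbinom0 lift0 gbinom1.
rewrite [X in Scale X%:~R](_ : _ = -1); last by lia.
have -> : 1%N%:Z + 1%N%:Z - (ord0 : 'I_2)%:Z = (1 + 1)%N by [].
have -> : 2%N%:Z - 1%N%:Z + (ord0 : 'I_2)%:Z = 1%N by [].
have -> : 1%N%:Z + 1%N%:Z - (ord0 : 'I_1).+1%:Z = (1 + 0)%N by [].
have -> : 2%N%:Z - 1%N%:Z + (ord0 : 'I_1).+1%:Z = 2%N by [].
rewrite (FdiagE K 1 0 2) (EdiagE K 1 1 1) (FdiagE K 1 1 1).
rewrite (FdiagE K 0 1 2) (EdiagE K 0 1 2).
rewrite !strip0 !Tens1f !Merge0r !Merge0l !Split0r !Split0l !Tens1.
rewrite -!strip2 !Comp1f // !Compf1 // Scale1.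
have -> : iob (1%N%:Z - 1%N%:Z + 1%N%:Z) (2%N%:Z + 1%N%:Z - 1%N%:Z) =
  strip [:: 1%N; 2%N] by congr (strip [:: _; _]); lia.
rewrite Addf0 => [->|]; last exact: typed_scale (typed_id _ _).
rewrite -AddA //; try exact: val_inj.
rewrite mulrN1z (AddNf (typed_id _ _)) Addf0; last first.
  by apply/typedP; split=> //; apply: val_inj.
by rewrite /X TensId_Comp // !CompA.
Qed.

Lemma X_X : Comp X X === Scale 2%:R X.
Proof.
rewrite {1 2}/X CompA -(CompA (Split 1 1)) Merge_Split Comp_Scaler Comp_Scalel.
by rewrite Compf1.
Qed.

(** By the two square relations, the triple products x1 x2 x1 and x2 x1 x2 are
    x1 + T and x2 + T, where T is the full merge of three strands followed by the
    full split; associativity makes T the same for both. *)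
Lemma braid_X (x1 := Tens X 1_[:: 1%N]) (x2 := Tens 1_[:: 1%N] X) :
  Add (Comp x1 (Comp x2 x1)) x2 === Add (Comp x2 (Comp x1 x2)) x1.
Proof.
pose s1 : diag K := Tens (Split 1 1) 1_[:: 1%N].
pose m1 : diag K := Tens (Merge 1 1) 1_[:: 1%N].
pose s2 : diag K := Tens 1_[:: 1%N] (Split 1 1).
pose m2 : diag K := Tens 1_[:: 1%N] (Merge 1 1).
pose P3 : diag K := Comp (Comp s1 (Split 2 1)) (Comp (Merge 2 1) m1).
have x1E : x1 === Comp s1 m1 by rewrite -TensId_Comp.
have x2E : x2 === Comp s2 m2 by rewrite -IdTens_Comp.
have e1 : Comp x1 (Comp x2 x1) === Add P3 x1.
  transitivity (Comp s1 (Comp (Comp (Comp m1 x2) s1) m1)).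
    by apply: eqd_trans (eqd_Comp x1E (eqd_Comp (eqd_refl x2) x1E)) _; rewrite !CompA.
  rewrite EF_square Comp_Addl; last exact: val_inj.
  rewrite Comp_Addr; last exact: val_inj.
  by rewrite Scale1 Comp1f -?x1E /P3 ?CompA //; apply: val_inj.
have e2 : Comp x2 (Comp x1 x2) === Add P3 x2.
  transitivity (Comp s2 (Comp (Comp (Comp m2 x1) s2) m2)).
    by apply: eqd_trans (eqd_Comp x2E (eqd_Comp (eqd_refl x1) x2E)) _; rewrite !CompA.
  rewrite FE_square Comp_Addl; last exact: val_inj.
  rewrite Comp_Addr; last exact: val_inj.
  rewrite Comp1f -?x2E /P3; last exact: val_inj.
  by rewrite (SplitA 1 1 1) (MergeA 1 1 1) ?CompA.
rewrite e1 e2 -AddA; try exact: val_inj.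
rewrite -AddA; try exact: val_inj.
by rewrite (AddC (f := x1)) //; apply: val_inj.
Qed.

Fixpoint mrg k : diag K :=
  if k is k'.+1 then Comp (Merge k' 1) (Tens (mrg k') 1_[:: 1%N]) else 1_[::].

Fixpoint spl k : diag K :=
  if k is k'.+1 then Comp (Tens (spl k') 1_[:: 1%N]) (Split k' 1) else 1_[::].

Lemma mrg_typed k : typed (ones k) (strip [:: k]) (mrg k).
Proof.
elim: k => [|k IH]; first by rewrite strip0; exact: typed_id.
rewrite (_ : [:: k.+1] = [:: (k + 1)%N]); last by rewrite addn1.
apply: typed_comp (typed_merge _ _ _) _.
by rewrite onesS strip2; apply: typed_tens IH (typed_id _ _).
Qed.

Lemma spl_typed k : typed (strip [:: k]) (ones k) (spl k).
Proof.
elim: k => [|k IH]; first by rewrite strip0; exact: typed_id.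
rewrite (_ : [:: k.+1] = [:: (k + 1)%N]); last by rewrite addn1.
apply: typed_comp _ (typed_split _ _ _).
by rewrite onesS strip2; apply: typed_tens IH (typed_id _ _).
Qed.

Lemma src_mrg k : src (mrg k) = ones k. Proof. by case/typedP: (mrg_typed k). Qed.
Lemma tgt_mrg k : tgt (mrg k) = strip [:: k]. Proof. by case/typedP: (mrg_typed k). Qed.
Lemma src_spl k : src (spl k) = strip [:: k]. Proof. by case/typedP: (spl_typed k). Qed.
Lemma tgt_spl k : tgt (spl k) = ones k. Proof. by case/typedP: (spl_typed k). Qed.

Lemma mrg_spl k : Comp (mrg k) (spl k) === Scale k`!%:R 1_[:: k].
Proof.
elim: k => [|k IH] /=; first by rewrite strip0 Comp1f // Scale1.
rewrite CompA -(CompA (Merge k 1)) -Tens_Comp ?src_mrg ?tgt_spl //.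
rewrite IH Comp1f // Tens_Scalel Tens1 Comp_Scaler -strip2 Compf1 //.
by rewrite Comp_Scalel Merge_Split ScaleA -natrM bin1 addn1 mulnC -factS.
Qed.

Lemma Merge_mrg k l : Comp (Merge k l) (Tens (mrg k) (mrg l)) === mrg (k + l).
Proof.
elim: l => [|l IH]; first by rewrite Merge0r /= Tensf1 addn0 Comp1f // tgt_mrg.
rewrite addnS /= -IH.
have -> : Tens (mrg k) (Comp (Merge l 1) (Tens (mrg l) 1_[:: 1%N])) ===
   Comp (Tens 1_[:: k] (Merge l 1)) (Tens (mrg k) (Tens (mrg l) 1_[:: 1%N])).
  by rewrite -Tens_Comp /= ?tgt_mrg ?strip2 // Comp1f // tgt_mrg.
rewrite -(addn1 l) CompA -MergeA TensA -CompA TensId_Comp //=.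
by rewrite !tgt_mrg strip2.
Qed.

Lemma Split_spl k l : Comp (Tens (spl k) (spl l)) (Split k l) === spl (k + l).
Proof.
elim: l => [|l IH]; first by rewrite Split0r /= Tensf1 addn0 Compf1 // src_spl.
rewrite addnS /= -IH.
have -> : Tens (spl k) (Comp (Tens (spl l) 1_[:: 1%N]) (Split l 1)) ===
   Comp (Tens (spl k) (Tens (spl l) 1_[:: 1%N])) (Tens 1_[:: k] (Split l 1)).
  by rewrite -Tens_Comp /= ?src_spl ?strip2 // Compf1 // src_spl.
rewrite -(addn1 l) -CompA -SplitA TensA CompA TensId_Comp //=.
by rewrite !src_spl strip2.
Qed.

End SpLaws.

(** * Flattening a thick strand *)

Section Alg.
Variable K : fieldType.
Hypothesis char0 : forall n, n.+1%:R != 0 :> K.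
Implicit Types (f g h : diag K) (a b c : composition).

Local Notation "1_ s" := (Id (strip s)) (at level 5, s at level 0).
Local Notation "f === g" := (@eqd K f g) (at level 70, no associativity).
Local Notation X := (mergesplit K).
Local Notation mrg := (mrg K).
Local Notation spl := (spl K).

Lemma Add_ScaleN a b k f : typed a b f -> Add (Scale k f) (Scale (- k) f) === Zero a b.
Proof.
move=> tf; rewrite -(Scale0 tf) -(addrN k).
exact: eqd_sym (deq_eqd (deq_scaleDl _ _ tf)).
Qed.

(** The endomorphisms of thin strands obtained from the square mergesplit. *)
Inductive alg : nat -> diag K -> Prop :=
  | alg_id d : alg d (Id (ones d))
  | alg_X : alg 2 X
  | alg_comp d g f : alg d g -> alg d f -> alg d (Comp g f)
  | alg_tens m n f g : alg m f -> alg n g -> alg (m + n) (Tens f g)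
  | alg_zero d : alg d (Zero (ones d) (ones d))
  | alg_add d f g : alg d f -> alg d g -> alg d (Add f g)
  | alg_scale d k f : alg d f -> alg d (Scale k f)
  | alg_eqd d f g : alg d f -> f === g -> alg d g.

Lemma alg_typed d f : alg d f -> typed (ones d) (ones d) f.
Proof.
elim=> {d f} [d||d g f _ tg _ tf|m n f g _ tf _ tg|d|d f g _ tf _ tg|//|d f g _ tf e].
- exact: typed_id.
- exact/typedP.
- exact: typed_comp tg tf.
- by rewrite onesD; apply: typed_tens.
- exact: typed_zero.
- exact: typed_add.
- exact: eqd_typed e tf.
Qed.

(** A merge of thin strands around a split of thin strands is a multiple of
    the identity, so the thick squares produced by the square-switch relation
    can be rewritten with all their strands flattened. *)
Lemma flatten_step j (k := j.+1) :
  Comp (Tens (mrg k) 1_[:: 1%N])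
    (Comp (Tens (Comp (spl j) (mrg j)) X) (Tens (spl k) 1_[:: 1%N])) ===
  Scale (j`!%:R * j`!%:R)
    (Comp (Comp (Tens (Merge j 1) 1_[:: 1%N]) (Tens 1_[:: j] X))
       (Tens (Split j 1) 1_[:: 1%N])).
Proof.
have mE : Tens (mrg k) 1_[:: 1%N] ===
    Comp (Tens (Merge j 1) 1_[:: 1%N]) (Tens (mrg j) 1_[:: 1%N; 1%N]).
  rewrite /= TensId_Comp /= ?tgt_mrg ?strip2 //.
  by rewrite -TensA Tens1 -strip2.
have sE : Tens (spl k) 1_[:: 1%N] ===
    Comp (Tens (spl j) 1_[:: 1%N; 1%N]) (Tens (Split j 1) 1_[:: 1%N]).
  rewrite /= TensId_Comp /= ?src_spl ?strip2 //.
  by rewrite -TensA Tens1 -strip2.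
rewrite mE sE.
(* The part between the outer square and its merge is mrg j, spl j, mrg j, spl j
   beside X, which is (j!)^2 times X on two further strands. *)
transitivity (Comp (Comp (Tens (Merge j 1) 1_[:: 1%N])
   (Comp (Tens (mrg j) 1_[:: 1%N; 1%N]) (Comp (Tens (Comp (spl j) (mrg j)) X)
      (Tens (spl j) 1_[:: 1%N; 1%N])))) (Tens (Split j 1) 1_[:: 1%N])).
  by rewrite !CompA.
have -> : Comp (Tens (mrg j) 1_[:: 1%N; 1%N]) (Comp (Tens (Comp (spl j) (mrg j)) X)
      (Tens (spl j) 1_[:: 1%N; 1%N])) === Scale (j`!%:R * j`!%:R) (Tens 1_[:: j] X).
  rewrite -Tens_Comp /= ?src_mrg ?tgt_spl // Compf1 //.
  rewrite -Tens_Comp /= ?src_mrg ?tgt_spl ?tgt_mrg // Comp1f //.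
  rewrite -CompA mrg_spl Comp_Scaler Comp_Scaler CompA mrg_spl Compf1 //.
  by rewrite Tens_Scalel Tens_Scalel ScaleA.
by rewrite Comp_Scaler Comp_Scalel.
Qed.

(** Write P_k for the split of k thin strands after their merge.  The
    square relation at (j + 1, 1) and the previous lemma give
    (j!)^-2 (P_(j+1) (x) 1)(P_j (x) X)(P_(j+1) (x) 1) =
    P_(j+2) + j P_(j+1) (x) 1,
    which determines P_(j+2) recursively. *)
Lemma alg_flatten k : alg k (Comp (spl k) (mrg k)).
Proof.
elim/ltn_ind: k => -[|[|j]] IH.
- by apply: alg_eqd (alg_id 0) _; rewrite Comp1f.
- apply: alg_eqd (alg_id 1) _; rewrite /= Merge0l Split0l !Tens1f Comp1f //.
  by rewrite Compf1 // Comp1f.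
set k := j.+1; have algk := IH k (ltnSn _); have algj := IH j (ltnW (ltnSn _)).
pose Pk1 : diag K := Tens (Comp (spl k) (mrg k)) 1_[:: 1%N].
pose PjX : diag K := Tens (Comp (spl j) (mrg j)) X.
have a1 : alg k.+1 Pk1 by rewrite -addn1; apply: alg_tens algk (alg_id 1).
have a2 : alg k.+1 PjX by rewrite /k -addn2; apply: alg_tens algj alg_X.
apply: alg_eqd (alg_add (alg_scale (j`!%:R * j`!%:R)^-1
  (alg_comp a1 (alg_comp a2 a1))) (alg_scale (- j%:R) a1)) _.
have Pk1E : Pk1 === Comp (Tens (spl k) 1_[:: 1%N]) (Tens (mrg k) 1_[:: 1%N]).
  by rewrite /Pk1 TensId_Comp // src_spl tgt_mrg.
have -> : Comp Pk1 (Comp PjX Pk1) === Comp (Comp (Tens (spl k) 1_[:: 1%N])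
    (Comp (Tens (mrg k) 1_[:: 1%N]) (Comp PjX (Tens (spl k) 1_[:: 1%N]))))
      (Tens (mrg k) 1_[:: 1%N]).
  by apply: eqd_trans (eqd_Comp Pk1E (eqd_Comp (eqd_refl _) Pk1E)) _; rewrite !CompA.
rewrite flatten_step EF_square !Comp_Scaler Comp_Scalel ScaleA mulVf; last first.
  by rewrite mulf_neq0 // natr_neq0 // fact_gt0.
rewrite Scale1 Comp_Addr; last by [].
rewrite Comp_Addl; last by [].
rewrite Comp_Scaler Comp_Scalel Compf1; last first.
  by rewrite -[src _]/(catc (src (spl k)) (strip [:: 1%N])) src_spl -strip2.
rewrite -Pk1E; set Q := Comp (Comp _ _) _.
have QE : Q === Comp (spl k.+1) (mrg k.+1) by rewrite /Q /= !CompA.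
have tP := alg_typed a1.
have tQ : typed (ones k.+1) (ones k.+1) Q.
  exact: eqd_typed (eqd_sym QE) (typed_comp (spl_typed _ _) (mrg_typed _ _)).
case/typedP: (tQ) => _ sQ tgQ; case/typedP: (tP) => _ sP tgP.
rewrite -AddA ?[src (Scale _ _)]sP ?[tgt (Scale _ _)]tgP //.
rewrite (Add_ScaleN _ tP) Addf0 //.
Qed.

End Alg.

(** * Reduction of a diagram to thin strands *)

Section Reduction.
Variable K : fieldType.
Hypothesis char0 : forall n, n.+1%:R != 0 :> K.
Implicit Types (f g h : diag K) (a b c : composition) (s t : seq nat).

Local Notation "1_ s" := (Id (strip s)) (at level 5, s at level 0).
Local Notation "f === g" := (@eqd K f g) (at level 70, no associativity).
Local Notation mrg := (mrg K).
Local Notation spl := (spl K).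
Local Notation alg := (@alg K).

Fixpoint mrgs s : diag K :=
  if s is k :: s' then Tens (mrg k) (mrgs s') else 1_[::].

Fixpoint spls s : diag K :=
  if s is k :: s' then Tens (spl k) (spls s') else 1_[::].

Lemma strip_cons k s : strip (k :: s) = catc (strip [:: k]) (strip s).
Proof. by rewrite -strip_cat. Qed.

Lemma mrgs_typed s : typed (ones (sumn s)) (strip s) (mrgs s).
Proof.
elim: s => [|k s IH] /=; first exact: typed_id.
by rewrite onesD strip_cons; apply: typed_tens IH; apply: mrg_typed.
Qed.

Lemma spls_typed s : typed (strip s) (ones (sumn s)) (spls s).
Proof.
elim: s => [|k s IH] /=; first exact: typed_id.
by rewrite onesD strip_cons; apply: typed_tens IH; apply: spl_typed.
Qed.

Lemma src_mrgs s : src (mrgs s) = ones (sumn s). Proof. by case/typedP: (mrgs_typed s). Qed.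
Lemma tgt_mrgs s : tgt (mrgs s) = strip s. Proof. by case/typedP: (mrgs_typed s). Qed.
Lemma src_spls s : src (spls s) = strip s. Proof. by case/typedP: (spls_typed s). Qed.
Lemma tgt_spls s : tgt (spls s) = ones (sumn s). Proof. by case/typedP: (spls_typed s). Qed.

Lemma mrgs_cat s t : mrgs (s ++ t) === Tens (mrgs s) (mrgs t).
Proof.
elim: s => [|k s IH] /=; first by rewrite Tens1f.
by rewrite IH TensA.
Qed.

Lemma spls_cat s t : spls (s ++ t) === Tens (spls s) (spls t).
Proof.
elim: s => [|k s IH] /=; first by rewrite Tens1f.
by rewrite IH TensA.
Qed.

Lemma mrgs_strip s : mrgs (strip s) === mrgs s.
Proof.
elim: s => [|[|k] s IH] //=; first by rewrite Tens1f.
by rewrite IH.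
Qed.

Lemma spls_strip s : spls (strip s) === spls s.
Proof.
elim: s => [|[|k] s IH] //=; first by rewrite Tens1f.
by rewrite IH.
Qed.

Definition facts s : nat := \prod_(k <- s) k`!.

Lemma facts_neq0 s : (facts s)%:R != 0 :> K.
Proof.
apply: natr_neq0 => //; rewrite /facts big_seq_cond; apply: prodn_gt0 => k.
exact: fact_gt0.
Qed.

Lemma mrgs_spls s : Comp (mrgs s) (spls s) === Scale (facts s)%:R (Id (strip s)).
Proof.
rewrite /facts; elim: s => [|k s IH]; first by rewrite big_nil Scale1 /= Comp1f.
rewrite big_cons /= -Tens_Comp ?src_mrg ?tgt_spl ?src_mrgs ?tgt_spls //.
by rewrite IH mrg_spl Tens_Scalel Tens_Scaler ScaleA Tens1 -natrM -strip_cons.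
Qed.

Lemma alg_flattens s : alg (sumn s) (Comp (spls s) (mrgs s)).
Proof.
elim: s => [|k s IH] /=; first by apply: alg_eqd (alg_id _ 0) _; rewrite Comp1f.
apply: alg_eqd (alg_tens (alg_flatten char0 k) IH) _.
by rewrite Tens_Comp ?tgt_mrg ?src_spl ?tgt_mrgs ?src_spls.
Qed.

Lemma mrgs_typedc a : typed (ones (sumn a)) a (mrgs a).
Proof. by rewrite -{2}(stripK a); apply: mrgs_typed. Qed.

Lemma spls_typedc a : typed a (ones (sumn a)) (spls a).
Proof. by rewrite -{1}(stripK a); apply: spls_typed. Qed.

(** The diagram f with both ends flattened.  As a merge after a split is an
    invertible scalar, f can be recovered from it; see unred. *)
Definition red a b f : diag K := Comp (spls b) (Comp f (mrgs a)).

#[local] Instance red_m a b : Proper (@eqd K ==> @eqd K) (red a b).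
Proof. by move=> f g e; apply: eqd_Comp => //; apply: eqd_Comp. Qed.

Lemma red_Zero a b : red a b (Zero a b) === Zero (ones (sumn a)) (ones (sumn b)).
Proof. by rewrite /red (Zero_Comp _ (mrgs_typedc a)) (Comp_Zero _ (spls_typedc b)). Qed.

Lemma red_Comp a b c g f : typed b c g -> typed a b f ->
  Scale (facts b)%:R (red a c (Comp g f)) === Comp (red b c g) (red a b f).
Proof.
move=> /typedP[_ sg tg] /typedP[_ sf tf].
transitivity (Comp (spls c) (Comp g (Comp (Comp (mrgs b) (spls b)) (Comp f (mrgs a)))));
  last by rewrite /red !CompA.
rewrite mrgs_spls stripK Comp_Scalel !Comp_Scaler Comp1f; last by rewrite /= tf.
by rewrite /red !CompA.
Qed.

Lemma red_Tens a b c d f g : typed a b f -> typed c d g ->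
  red (catc a c) (catc b d) (Tens f g) === Tens (red a b f) (red c d g).
Proof.
move=> /typedP[_ sf tf] /typedP[_ sg tg]; rewrite /red mrgs_cat spls_cat.
rewrite -Tens_Comp ?tgt_mrgs ?stripK ?sf ?sg //.
by rewrite -Tens_Comp //= ?src_spls ?stripK ?tf ?tg.
Qed.

(** By induction on f.  A composition is flattened by inserting a split
    and a merge at the middle object; a merge or a split becomes an iterated
    merge followed by an iterated split.  The second part says that there are no
    morphisms between objects of different degrees. *)
Lemma red_alg f a b : typed a b f ->
  (sumn a = sumn b -> alg (sumn a) (red a b f)) /\
  (sumn a != sumn b -> f === Zero a b).
Proof.
have zero_alg g a' b' : g === Zero a' b' -> sumn a' = sumn b' -> alg (sumn a') (red a' b' g).
  by move=> g0 e; apply: alg_eqd (alg_zero _ _) _; rewrite g0 red_Zero e.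
elim: f a b => [c|k l|k l|g IHg f IHf|f IHf g IHg|c d|f IHf g IHg|k f IHf] a b.
- move=> /typedP[_ /= <- <-]; rewrite eqxx; split=> // _.
  by apply: alg_eqd (alg_flattens c) _; rewrite /red Comp1f // tgt_mrgs stripK.
- move=> /typedP[_ /= <- <-]; rewrite !sumn_strip /= !addn0 eqxx; split=> // _.
  apply: alg_eqd (alg_flatten char0 (k + l)) _.
  rewrite /red mrgs_strip spls_strip /= !Tensf1 Merge_mrg //.
- move=> /typedP[_ /= <- <-]; rewrite !sumn_strip /= !addn0 eqxx; split=> // _.
  apply: alg_eqd (alg_flatten char0 (k + l)) _.
  by rewrite /red mrgs_strip spls_strip /= !Tensf1 CompA Split_spl.
- move=> /typedP[/= /and3P[wg wf /eqP e] <- <-].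
  have tf : typed (src f) (src g) f by apply/typedP; rewrite e.
  have tg : typed (src g) (tgt g) g by apply/typedP.
  have [af zf] := IHf _ _ tf; have [ag zg] := IHg _ _ tg.
  have [ef|nf] := eqVneq (sumn (src f)) (sumn (src g)); last first.
    have f0 : Comp g f === Zero (src f) (tgt g).
      exact: eqd_trans (eqd_Comp (eqd_refl _) (zf nf)) (Comp_Zero _ tg).
    by split=> // e'; apply: zero_alg.
  have [eg|ng] := eqVneq (sumn (src g)) (sumn (tgt g)); last first.
    have g0 : Comp g f === Zero (src f) (tgt g).
      exact: eqd_trans (eqd_Comp (zg ng) (eqd_refl _)) (Zero_Comp _ tf).
    by split=> // e'; apply: zero_alg.
  rewrite ef eg eqxx; split=> // _.
  move: (af ef) (ag eg); rewrite ef eg => algf algg.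
  apply: alg_eqd (alg_scale (facts (src g))%:R^-1 (alg_comp algg algf)) _.
  by rewrite -red_Comp // ScaleA mulVf ?facts_neq0 // Scale1.
- move=> /typedP[/= /andP[wf wg] <- <-].
  have tf := wf_typed wf; have tg := wf_typed wg.
  have [af zf] := IHf _ _ tf; have [ag zg] := IHg _ _ tg.
  have [ef|nf] := eqVneq (sumn (src f)) (sumn (tgt f)); last first.
    have f0 : Tens f g === Zero (catc (src f) (src g)) (catc (tgt f) (tgt g)).
      exact: eqd_trans (eqd_Tens (zf nf) (eqd_refl _)) (Tens_Zerol _ _ tg).
    by split=> // e'; apply: zero_alg.
  have [eg|ng] := eqVneq (sumn (src g)) (sumn (tgt g)); last first.
    have g0 : Tens f g === Zero (catc (src f) (src g)) (catc (tgt f) (tgt g)).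
      exact: eqd_trans (eqd_Tens (eqd_refl _) (zg ng)) (Tens_Zeror _ _ tf).
    by split=> // e'; apply: zero_alg.
  rewrite /= !sumn_cat -ef -eg eqxx; split=> // _.
  by apply: alg_eqd (alg_tens (af ef) (ag eg)) _; rewrite red_Tens.
- by move=> /typedP[_ /= <- <-]; split=> //; apply: zero_alg.
- move=> /typedP[/= /and4P[wf wg /eqP es /eqP et] <- <-].
  have tf := wf_typed wf; have tg : typed (src f) (tgt f) g by apply/typedP.
  have [af zf] := IHf _ _ tf; have [ag zg] := IHg _ _ tg.
  split=> [e|ne]; last first.
    exact: eqd_trans (eqd_Add (zf ne) (zg ne)) (Add0f (typed_zero _ _ _)).
  apply: alg_eqd (alg_add (af e) (ag e)) _.
  rewrite /red Comp_Addl // Comp_Addr //.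
- move=> tf; have [af zf] := IHf _ _ tf.
  split=> [e|ne]; last exact: eqd_trans (eqd_Scale _ (zf ne)) (Scale_Zero _ _ _).
  apply: alg_eqd (alg_scale k (af e)) _.
  by rewrite /red Comp_Scalel Comp_Scaler.
Qed.

End Reduction.

(** * The Coxeter presentation of the symmetric group *)

Section Words.
Local Open Scope nat_scope.
Implicit Types (u v w : seq nat) (i j n p : nat).

Definition swap i p : nat :=
  if p == i then i.+1 else if p == i.+1 then i else p.

(** Words act on all natural numbers, which spares the bounds that
    permutations of ordinals would carry. *)
Definition act w p : nat := foldr swap p w.

(** The congruence generated by the Coxeter relations between letters below
    n. *)
Inductive cox n : seq nat -> seq nat -> Prop :=
  | cox_refl u : cox n u u
  | cox_sym u v : cox n u v -> cox n v u
  | cox_trans u v w : cox n u v -> cox n v w -> cox n u w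
  | cox_cat u u' v v' : cox n u u' -> cox n v v' -> cox n (u ++ v) (u' ++ v')
  | cox_sq i : i < n -> cox n [:: i; i] [::]
  | cox_comm i j : i.+1 < j -> j < n -> cox n [:: i; j] [:: j; i]
  | cox_braid i : i.+1 < n -> cox n [:: i; i.+1; i] [:: i.+1; i; i.+1].

Ltac cases_eq := rewrite /swap /=;
  repeat (match goal with |- context [@eq_op _ ?a ?b] =>
    lazymatch a with context [if _ then _ else _] => fail | _ => case: (a =P b) => ? //= end
  end);
  try lia.

Lemma swapK i : involutive (swap i).
Proof. by move=> p; cases_eq. Qed.

Lemma act_cat u v p : act (u ++ v) p = act u (act v p).
Proof. by rewrite /act foldr_cat. Qed.

Lemma act_revK w p : act (rev w) (act w p) = p.
Proof.
elim: w p => //= i w IH p; rewrite rev_cons -cats1 act_cat /= swapK; exact: IH.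
Qed.

Lemma act_Krev w p : act w (act (rev w) p) = p.
Proof. by rewrite -{1}(revK w) act_revK. Qed.

Lemma act_inj w : injective (act w).
Proof. exact: can_inj (act_revK w). Qed.

Lemma act_fix n w p : all (ltn^~ n) w -> n < p -> act w p = p.
Proof.
by elim: w => //= i w IH /andP[i_n /IH{}IH] np; rewrite IH //; cases_eq.
Qed.

Lemma act_iota j m : act (iota j m) (j + m) = j.
Proof.
elim: m j => [|m IH] j /=; first by rewrite addn0.
by rewrite -addSnnS IH; cases_eq.
Qed.

Lemma cox_act n u v : cox n u v -> act u =1 act v.
Proof.
elim=> {u v} [u|u v _ e|u v w _ e _ e'|u u' v v' _ e _ e'|i _|i j ij _|i _] p //.
- by rewrite e e'.
- by rewrite !act_cat e' e.
- by rewrite /= swapK.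
- by rewrite /=; cases_eq.
- by rewrite /=; cases_eq.
Qed.

Lemma cox_le m n u v : m <= n -> cox m u v -> cox n u v.
Proof.
move=> mn; elim=> {u v} [u|u v _|u v w _ e _|u u' v v' _ e _|i im|i j ij jm|i im].
- exact: cox_refl.
- exact: cox_sym.
- exact: cox_trans e.
- exact: cox_cat.
- by apply: cox_sq; apply: leq_trans mn.
- by apply: cox_comm => //; apply: leq_trans mn.
- by apply: cox_braid; apply: leq_trans mn.
Qed.

Lemma cox_comm_all n i w : i < n -> all (fun j => (j < n) && ((i.+1 < j) || (j.+1 < i))) w ->
  cox n (i :: w) (rcons w i).
Proof.
move=> i_n; elim: w => [_|j w IH /= /andP[/andP[jn ij] /IH{}IH]]; first exact: cox_refl.
apply: cox_trans (cox_cat (cox_refl _ [:: j]) IH).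
apply: (cox_cat (u := [:: i; j]) (u' := [:: j; i])) (cox_refl _ w).
by case/orP: ij => ij; [apply: cox_comm | apply: cox_sym; apply: cox_comm].
Qed.

(** The words j (j + 1) ... (n - 1) represent the cosets of the symmetric
    group on 0, ..., n - 1 in the one on 0, ..., n.  Multiplying such a word by
    a letter i either changes j by one, or moves the letter across by
    commutations and, when i > j, one braid relation. *)
Lemma cox_step n i j : i < n -> j <= n ->
  exists k w, [/\ k <= n, all (ltn^~ n.-1) w
    & cox n (i :: iota j (n - j)) (iota k (n - k) ++ w)].
Proof.
move=> i_n jn; have [ij|ji|e] := ltngtP i j.
- have [e|ne] := eqVneq i.+1 j.
    exists i, [::]; split=> //; first exact: ltnW.
    by rewrite -e cats0 -(subnSK i_n); apply: cox_refl.
  exists j, [:: i]; split=> //=; first by rewrite andbT; lia.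
  rewrite cats1; apply: cox_comm_all => //; apply/allP => k.
  by rewrite mem_iota; lia.
- exists j, [:: i.-1]; split=> //=; first by rewrite andbT; lia.
  have -> : iota j (n - j) = iota j (i.-1 - j) ++ [:: i.-1; i] ++ iota i.+1 (n - i.+1).
    have -> : n - j = (i.-1 - j) + (2 + (n - i.+1)) by lia.
    by rewrite !iotaD /=; congr (_ ++ [:: _, _ & iota _ _]); lia.
  set a := iota j _; set b := iota i.+1 _.
  have c1 : cox n (i :: a) (rcons a i).
    by apply: cox_comm_all => //; apply/allP => k; rewrite mem_iota; lia.
  have c2 : cox n (i.-1 :: b) (rcons b i.-1).
    by apply: cox_comm_all => //; [lia|]; apply/allP => k; rewrite mem_iota; lia.
  apply: cox_trans (cox_cat c1 (cox_refl _ ([:: i.-1; i] ++ b))) _.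
  rewrite -cats1 -!catA; apply: cox_cat (cox_refl _ a) _.
  have c3 : cox n [:: i; i.-1; i] [:: i.-1; i; i.-1].
    have {1 3 5}-> : i = i.-1.+1 by lia.
    by apply: cox_sym; apply: cox_braid; lia.
  apply: cox_trans (cox_cat c3 (cox_refl _ b)) _.
  by rewrite -cats1 in c2; apply: (cox_cat (cox_refl _ [:: i.-1; i]) c2).
- subst j; exists i.+1, [::]; split=> //; rewrite cats0 -(subnSK i_n) /=.
  apply: (cox_cat (u := [:: i; i]) (u' := [::])) (cox_refl _ _); exact: cox_sq.
Qed.

Lemma cox_normal n w : all (ltn^~ n) w ->
  exists j v, [/\ j <= n, all (ltn^~ n.-1) v & cox n w (iota j (n - j) ++ v)].
Proof.
elim: w => [_|i w IH /= /andP[i_n /IH[j [v [jn vn wv]]]]].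
  by exists n, [::]; split=> //; rewrite subnn; apply: cox_refl.
have [k [u [kn un iu]]] := cox_step i_n jn.
exists k, (u ++ v); split=> //; first by rewrite all_cat un.
apply: cox_trans (cox_cat (cox_refl _ [:: i]) wv) _.
by rewrite !catA; apply: cox_cat iu (cox_refl _ v).
Qed.

(** The Coxeter relations present the symmetric group.  In a normal form
    the index j of the coset word is the image of n, so two words with the same
    action have the same j, and the remaining words are equivalent by
    induction. *)
Theorem cox_complete n u v : all (ltn^~ n) u -> all (ltn^~ n) v ->
  act u =1 act v -> cox n u v.
Proof.
elim: n u v => [|n IH] u v un vn e.
  case: u un e => // _; case: v vn => // _ _; exact: cox_refl.
have [j [u' [jn un' uu']]] := cox_normal un; have [k [v' [kn vn' vv']]] := cox_normal vn.
have e' p : act (iota j (n.+1 - j) ++ u') p = act (iota k (n.+1 - k) ++ v') p.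
  by rewrite -(cox_act uu') -(cox_act vv').
have jk : j = k.
  have a m (mn : m <= n.+1) : act (iota m (n.+1 - m)) n.+1 = m.
    by rewrite -{2}(subnKC mn) act_iota.
  by have := e' n.+1; rewrite !act_cat (act_fix un') // (act_fix vn') // !a.
subst k; apply: cox_trans uu' (cox_trans _ (cox_sym vv')).
apply: cox_cat (cox_refl _ _) (cox_le (leqnSn n) _); apply: IH => // p.
by have := e' p; rewrite !act_cat => /act_inj.
Qed.

(** The coset word of g n, inverted, brings g back to a permutation that
    fixes n. *)
Lemma act_onto n (g : nat -> nat) : injective g -> (forall p, n < p -> g p = p) ->
  exists2 w, all (ltn^~ n) w & act w =1 g.
Proof.
elim: n g => [|n IH] g gi gf.
  exists [::] => // p /=; case: p => [|p]; last by rewrite gf.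
  by case E: (g 0) => [//|q]; have := gf q.+1 isT; rewrite -E => /gi.
have gn : g n.+1 <= n.+1.
  by case: leqP => // lt_gn; have := gi _ _ (gf _ lt_gn); lia.
pose c := iota (g n.+1) (n.+1 - g n.+1).
have cn : all (ltn^~ n.+1) c by apply/allP => k; rewrite mem_iota /=; lia.
have ce : act c n.+1 = g n.+1 by rewrite -{1}(subnKC gn) act_iota.
have [|p np|w wn we] := IH (act (rev c) \o g).
- exact: inj_comp (@act_inj (rev c)) gi.
- have [e|ne] := eqVneq p n.+1; first by rewrite e /= -ce act_revK.
  have np' : n.+1 < p by lia.
  by rewrite /= gf // (act_fix (n := n.+1)) // all_rev.
exists (c ++ w) => [|p]; last by rewrite act_cat we act_Krev.
by rewrite all_cat cn; apply: sub_all wn => i /=; lia.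
Qed.

End Words.

(** * Classes of diagrams *)

Section Classes.
Variable K : fieldType.
Implicit Types (f g h : diag K) (a b c : composition).
Local Notation "f === g" := (@eqd K f g) (at level 70, no associativity).

(** The class of a diagram, extended by 0 to ill-typed diagrams so that
    it can be rewritten without carrying typing proofs. *)
Definition cls a b f : sphom K a b :=
  if typed a b f =P true is ReflectT t then spcls t else 0.

Lemma clsE a b f (t : typed a b f) : cls a b f = spcls t.
Proof.
rewrite /cls; case: eqP => [t'|]; last by rewrite t.
by congr spcls; apply: bool_irrelevance.
Qed.

Lemma cls_eqd a b f g : f === g -> cls a b f = cls a b g.
Proof.
move=> fg; have [tf|nf] := boolP (typed a b f).
  by rewrite (clsE tf) (clsE (eqd_typed fg tf)); apply/spclsP/eqd_deq.
have ng : ~~ typed a b g.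
  by apply: contra nf; apply: eqd_typed; apply: eqd_sym.
rewrite /cls; case: eqP => [t|_]; first by rewrite t in nf.
by case: eqP => [t|_] //; rewrite t in ng.
Qed.

Lemma cls_inj a b f g : typed a b f -> typed a b g -> cls a b f = cls a b g -> f === g.
Proof. by move=> tf tg; rewrite (clsE tf) (clsE tg) => /spclsP/deq_eqd. Qed.

Lemma sprepE a b (x : sphom K a b) : cls a b (sprep x) = x.
Proof. by rewrite (clsE (sprep_typed x)) sprepK. Qed.

Lemma sprep_clsE a b f : typed a b f -> sprep (cls a b f) === f.
Proof. by move=> tf; rewrite (clsE tf); apply: deq_eqd (sprep_cls _). Qed.

Lemma cls_Comp a b c g f : typed b c g -> typed a b f ->
  cls a c (Comp g f) = spcomp (cls b c g) (cls a b f).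
Proof.
move=> tg tf; rewrite (clsE (typed_comp tg tf)); apply/spclsP.
apply: eqd_deq (typed_comp tg tf) _.
by apply: eqd_Comp; apply: eqd_sym; apply: sprep_clsE.
Qed.

Lemma cls_Tens a b c d f g : typed a b f -> typed c d g ->
  cls (catc a c) (catc b d) (Tens f g) = sptens (cls a b f) (cls c d g).
Proof.
move=> tf tg; rewrite (clsE (typed_tens tf tg)); apply/spclsP.
apply: eqd_deq (typed_tens tf tg) _.
by apply: eqd_Tens; apply: eqd_sym; apply: sprep_clsE.
Qed.

Lemma cls_Add a b f g : typed a b f -> typed a b g ->
  cls a b (Add f g) = cls a b f + cls a b g.
Proof.
move=> tf tg; rewrite (clsE (typed_add tf tg)); apply/spclsP.
apply: eqd_deq (typed_add tf tg) _.
by apply: eqd_Add; apply: eqd_sym; apply: sprep_clsE.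
Qed.

Lemma cls_Scale a b k f : typed a b f -> cls a b (Scale k f) = k *: cls a b f.
Proof.
move=> tf; rewrite (clsE (typed_scale k tf)); apply/spclsP.
apply: eqd_deq (typed_scale k tf) _.
by apply: eqd_Scale; apply: eqd_sym; apply: sprep_clsE.
Qed.

Lemma cls_Zero a b : cls a b (Zero a b) = 0.
Proof. exact: clsE. Qed.

Lemma cls_Id a : cls a a (Id a) = spid K a.
Proof. exact: clsE. Qed.

End Classes.

(** An alias of the endomorphisms of a, to carry their ring structure. *)
Definition spend (K : fieldType) (a : composition) : Type := sphom K a a.

HB.instance Definition _ (K : fieldType) (a : composition) :=
  GRing.Lmodule.on (spend K a).

Section EndRing.
Variables (K : fieldType) (a : composition).

Let mul (x y : spend K a) : spend K a := spcomp x y.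
Let one : spend K a := spid K a.

Lemma spend_mulA : associative mul.
Proof. by move=> x y z; exact: (@mcompA K (sp_data K) (sp_axioms K) a a a a x y z). Qed.
Lemma spend_mul1 : left_id one mul.
Proof. by move=> x; exact: (@mcomp1f K (sp_data K) (sp_axioms K) a a x). Qed.
Lemma spend_mulr1 : right_id one mul.
Proof. by move=> x; exact: (@mcompf1 K (sp_data K) (sp_axioms K) a a x). Qed.
Lemma spend_mulDl : left_distributive mul +%R.
Proof.
move=> x y z; have := @mcomp_linl K (sp_data K) (sp_axioms K) a a a z 1 x y.
by rewrite !scale1r.
Qed.
Lemma spend_mulDr : right_distributive mul +%R.
Proof.
move=> x y z; have := @mcomp_linr K (sp_data K) (sp_axioms K) a a a x 1 y z.
by rewrite !scale1r.
Qed.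

HB.instance Definition _ := GRing.Zmodule_isPzRing.Build (spend K a)
  spend_mulA spend_mul1 spend_mulr1 spend_mulDl spend_mulDr.

Lemma spend_scalel (k : K) (x y : spend K a) : (k *: x) * y = k *: (x * y).
Proof.
rewrite -[k *: x]addr0.
apply: etrans (@mcomp_linl K (sp_data K) (sp_axioms K) a a a y k x 0) _.
by rewrite -[RHS]addr0; congr (_ + _); apply: (@mul0r (spend K a)).
Qed.

Lemma spend_scaler (k : K) (x y : spend K a) : x * (k *: y) = k *: (x * y).
Proof.
rewrite -[k *: y]addr0.
apply: etrans (@mcomp_linr K (sp_data K) (sp_axioms K) a a a x k y 0) _.
by rewrite -[RHS]addr0; congr (_ + _); apply: (@mulr0 (spend K a)).
Qed.

End EndRing.

(** * Crossings *)

Section Crossings.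
Variable K : fieldType.
Hypothesis char0 : forall n, n.+1%:R != 0 :> K.
Implicit Types (f g h : diag K) (a b c : composition) (i j m n d : nat).
Local Notation "f === g" := (@eqd K f g) (at level 70, no associativity).
Local Notation X := (mergesplit K).
Local Notation End d := (spend K (ones d)).
Local Notation endo d := (typed (ones d) (ones d)).
Local Notation "[ f ]_ d" := (cls (ones d) (ones d) f : End d) (format "[ f ]_ d").

Definition pad i f j : diag K := Tens (Id (ones i)) (Tens f (Id (ones j))).

Lemma pad_typed i f j p : endo p f -> endo (i + (p + j))%N (pad i f j).
Proof.
move=> tf; rewrite !onesD; apply: typed_tens (typed_id _ _) _.
exact: typed_tens tf (typed_id _ _).
Qed.

Lemma X_typed : endo 2 X. Proof. exact/typedP. Qed.

#[local] Instance pad_m i : Proper (@eqd K ==> eq ==> @eqd K) (pad i).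
Proof. by move=> f g e j _ <-; apply: eqd_Tens => //; apply: eqd_Tens. Qed.

Lemma pad_Comp i j p g f : endo p g -> endo p f ->
  pad i (Comp g f) j === Comp (pad i g j) (pad i f j).
Proof.
move=> /typedP[_ sg tg] /typedP[_ sf tf].
rewrite /pad TensId_Comp ?sg ?tf // IdTens_Comp //=.
by rewrite sg tf.
Qed.

Lemma pad_Scale i j k f : pad i (Scale k f) j === Scale k (pad i f j).
Proof. by rewrite /pad Tens_Scalel Tens_Scaler. Qed.

Lemma pad_Add i j p g f : endo p g -> endo p f ->
  pad i (Add g f) j === Add (pad i g j) (pad i f j).
Proof.
move=> /typedP[_ sg tg] /typedP[_ sf tf].
by rewrite /pad Tens_Addl ?sg ?tg // Tens_Addr //= ?sg ?tg ?sf ?tf.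
Qed.

Lemma pad_Tensl m i f j : Tens (Id (ones m)) (pad i f j) === pad (m + i) f j.
Proof. by rewrite /pad TensA Tens1 -onesD. Qed.

Lemma pad_Tensr i f j n : Tens (pad i f j) (Id (ones n)) === pad i f (j + n).
Proof. by rewrite /pad -!TensA Tens1 -onesD. Qed.

Lemma pad_pad i k f l j : pad i (pad k f l) j === pad (i + k) f (l + j).
Proof. by rewrite {1}/pad pad_Tensr pad_Tensl. Qed.

Lemma Tens_Id_slide m n f g : endo m f -> endo n g ->
  Tens f g === Comp (Tens f (Id (ones n))) (Tens (Id (ones m)) g).
Proof.
move=> /typedP[_ sf tf] /typedP[_ sg tg].
by rewrite -Tens_Comp ?sf ?tg // Compf1 // Comp1f.
Qed.

Lemma Tens_Id_slide' m n f g : endo m f -> endo n g ->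
  Tens f g === Comp (Tens (Id (ones m)) g) (Tens f (Id (ones n))).
Proof.
move=> /typedP[_ sf tf] /typedP[_ sg tg].
by rewrite -Tens_Comp ?tf ?sg // Compf1 // Comp1f.
Qed.

(** The square on the strands i and i + 1 of d; d - i.+2 strands are left
    to its right. *)
Definition xdiag d i : diag K := pad i X (d - i.+2).

Lemma xdiag_typed d i : (i.+1 < d)%N -> endo d (xdiag d i).
Proof.
move=> id_; have := pad_typed i (d - i.+2) X_typed.
by rewrite (_ : i + (2 + _) = d)%N //; lia.
Qed.

Lemma xdiag_sq d i : Comp (xdiag d i) (xdiag d i) === Scale 2%:R (xdiag d i).
Proof. by rewrite -(pad_Comp _ _ X_typed X_typed) X_X pad_Scale. Qed.

Lemma xdiag_comm d i j : (i.+1 < j)%N -> (j.+1 < d)%N ->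
  Comp (xdiag d i) (xdiag d j) === Comp (xdiag d j) (xdiag d i).
Proof.
move=> ij jd; pose k := (j - i.+2)%N; pose l := (d - j.+2)%N.
have ei : xdiag d i === Tens (pad i X k) (Id (ones (0 + (2 + l)))).
  by rewrite pad_Tensr /xdiag (_ : (d - i.+2 = k + (0 + (2 + l)))%N) // /k /l; lia.
have ej : xdiag d j === Tens (Id (ones (i + (2 + k)))) (pad 0 X l).
  by rewrite pad_Tensl /xdiag /l (_ : (i + (2 + k) + 0 = j)%N) // /k; lia.
have tk := pad_typed i k X_typed; have tl := pad_typed 0 l X_typed.
by rewrite ei ej -(Tens_Id_slide tk tl) -(Tens_Id_slide' tk tl).
Qed.

Lemma xdiag_braid d i (x := xdiag d i) (y := xdiag d i.+1) : (i.+2 < d)%N ->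
  Add (Comp x (Comp y x)) y === Add (Comp y (Comp x y)) x.
Proof.
move=> id_; pose l := (d - i.+3)%N.
pose x1 : diag K := Tens X (Id (strip [:: 1%N])); pose x2 : diag K := Tens (Id (strip [:: 1%N])) X.
have ex : x === pad i x1 l.
  have -> : x1 === pad 0 X 1 by rewrite /pad Tens1f.
  by rewrite pad_pad addn0 /x /xdiag (_ : (d - i.+2 = 1 + l)%N) // /l; lia.
have ey : y === pad i x2 l.
  have -> : x2 === pad 1 X 0 by rewrite /pad Tensf1.
  by rewrite pad_pad addn1.
have t1 : endo 3 x1 by apply: (typed_tens X_typed (typed_id _ (ones 1))).
have t2 : endo 3 x2 by apply: (typed_tens (typed_id _ (ones 1)) X_typed).
rewrite ex ey -!(pad_Comp _ _ (p := 3)) //; try exact: typed_comp.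
rewrite -!(pad_Add _ _ (p := 3)) //; try by do 2?apply: typed_comp.
by rewrite braid_X.
Qed.

End Crossings.

(** * Words in the crossings span *)

Section Span.
Variable K : fieldType.
Hypothesis char0 : forall n, n.+1%:R != 0 :> K.
Implicit Types (f g h : diag K) (a b c : composition) (i j m n d : nat).
Local Notation "f === g" := (@eqd K f g) (at level 70, no associativity).
Local Notation X := (mergesplit K).
Local Notation End d := (spend K (ones d)).
Local Notation endo d := (typed (ones d) (ones d)).
Local Notation "[ f ]_ d" := (cls (ones d) (ones d) f : End d) (format "[ f ]_ d").

Lemma endcls_Comp d g f : endo d g -> endo d f -> [Comp g f]_d = [g]_d * [f]_d.
Proof. exact: cls_Comp. Qed.

Lemma endcls_Id d : [Id (ones d)]_d = 1.
Proof. exact: cls_Id. Qed.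

Definition xgen d i : End d := [xdiag K d i]_d.

(** The crossing of the strands i and i + 1. *)
Definition sgen d i : End d := xgen d i - 1.

Definition sword d (v : seq nat) : End d := \prod_(i <- v) sgen d i.

Lemma xgen_sq d i : (i.+1 < d)%N -> xgen d i * xgen d i = xgen d i *+ 2.
Proof.
move=> id_; have tx := xdiag_typed K id_.
rewrite -endcls_Comp // (cls_eqd _ _ (xdiag_sq _ _ _)) cls_Scale //.
by rewrite scaler_nat.
Qed.

Lemma xgen_comm d i j : (i.+1 < j)%N -> (j.+1 < d)%N ->
  xgen d i * xgen d j = xgen d j * xgen d i.
Proof.
move=> ij jd; have ti := xdiag_typed K (ltn_trans ij (ltnW jd)).
have tj := xdiag_typed K jd.
by rewrite -!endcls_Comp // (cls_eqd _ _ (xdiag_comm _ ij jd)).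
Qed.

Lemma xgen_braid d i (x := xgen d i) (y := xgen d i.+1) : (i.+2 < d)%N ->
  x * (y * x) + y = y * (x * y) + x.
Proof.
move=> id_; have tx := xdiag_typed K (ltnW id_); have ty := xdiag_typed K id_.
have txy := typed_comp tx ty; have tyx := typed_comp ty tx.
have txyx := typed_comp tx tyx; have tyxy := typed_comp ty txy.
rewrite /x /y /xgen -!endcls_Comp // -!cls_Add //.
by rewrite (cls_eqd _ _ (xdiag_braid K id_)).
Qed.

Lemma sgen_sq d i : (i.+1 < d)%N -> sgen d i * sgen d i = 1.
Proof.
move=> id_; rewrite /sgen mulrBl mul1r mulrBr mulr1 xgen_sq // mulr2n.
by rewrite addrK opprB addrC subrK.
Qed.

Lemma sgen_comm d i j : (i.+1 < j)%N -> (j.+1 < d)%N ->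
  sgen d i * sgen d j = sgen d j * sgen d i.
Proof.
move=> ij jd; rewrite /sgen !mulrBl !mul1r !mulrBr !mulr1 xgen_comm //.
by rewrite !opprB -!addrA; congr (_ + _); rewrite addrCA [in RHS]addrCA; congr (_ + _); rewrite addrC.
Qed.

(** Both products expand to the triple products of squares plus terms that
    are symmetric in the two squares, so the braid relation of the squares
    suffices. *)
Lemma sgen_braid d i : (i.+2 < d)%N ->
  sgen d i * (sgen d i.+1 * sgen d i) = sgen d i.+1 * (sgen d i * sgen d i.+1).
Proof.
move=> id_; have := xgen_braid id_; have := xgen_sq (ltnW id_); have := xgen_sq id_.
rewrite /sgen; set x := xgen d i; set y := xgen d i.+1 => y2 x2 br.
have E (u v : End d) : u * u = u *+ 2 ->
    (u - 1) * ((v - 1) * (u - 1)) = (u * (v * u) + v) - (u * v + v * u) - 1.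
  move=> u2; rewrite mulrBl mul1r [(v - 1) * _]mulrBl mul1r !mulrBr !mulr1 u2 mulr2n addrK.
  move: (u * v) (v * u) => q r; move: (u * r) => p.
  rewrite opprB addrA [p - q - u + _]addrA subrK opprB opprD.
  by rewrite (AC (3*2)%AC ((1*4)*(2*5)*3)%AC).
by rewrite (E x y) // (E y x) // br [x * y + _]addrC.
Qed.

Lemma cox_sword d u v : cox d.-1 u v -> sword d u = sword d v.
Proof.
elim=> {u v} [u|u v _ e|u v w _ e _ e'|u u' v v' _ e _ e'|i id_|i j ij jd|i id_] //.
- by rewrite e.
- by rewrite /sword !big_cat /= -/(sword d u) -/(sword d v) e e'.
- by rewrite /sword !big_cons !big_nil mulr1 sgen_sq //; lia.
- by rewrite /sword !big_cons !big_nil !mulr1 sgen_comm //; lia.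
- by rewrite /sword !big_cons !big_nil !mulr1 sgen_braid //; lia.
Qed.

Inductive span d : End d -> Prop :=
  | span_word v : all (ltn^~ d.-1) v -> span (sword d v)
  | span_zero : span 0
  | span_lin k x y : span x -> span y -> span (k *: x + y).

Lemma span_scale d k (x : End d) : span x -> span (k *: x).
Proof. by move=> sx; rewrite -[_ *: _]addr0; apply: span_lin => //; apply: span_zero. Qed.

Lemma span_add d (x y : End d) : span x -> span y -> span (x + y).
Proof. by move=> sx sy; rewrite -[x]scale1r; apply: span_lin. Qed.

Lemma span_one d : span (1 : End d).
Proof. by have := @span_word d [::] isT; rewrite /sword big_nil. Qed.

Lemma span_sgen d i : (i.+1 < d)%N -> span (sgen d i).
Proof.
move=> id_; have := @span_word d [:: i]; rewrite /sword big_cons big_nil mulr1.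
by apply; rewrite /= andbT; lia.
Qed.

Lemma span_mul d (x y : End d) : span x -> span y -> span (x * y).
Proof.
move=> sx sy; elim: sx => [v vn||k x1 x2 _ s1 _ s2]; last first.
- rewrite mulrDl spend_scalel; exact: span_lin.
- rewrite mul0r; exact: span_zero.
elim: sy => [u un||k y1 y2 _ s1 _ s2]; last first.
- rewrite mulrDr spend_scaler; exact: span_lin.
- rewrite mulr0; exact: span_zero.
by rewrite /sword -big_cat; apply: span_word; rewrite all_cat vn.
Qed.

(** Stated for an operation F on diagrams, to serve both for adding
    strands on the right and for adding strands on the left, which shifts the
    letters. *)
Lemma span_map m n (F : diag K -> diag K) (r : nat -> nat) :
    (forall f g, f === g -> F f === F g) ->
    (forall f, endo m f -> endo n (F f)) ->
    (forall f g, endo m f -> endo m g -> F (Comp f g) === Comp (F f) (F g)) ->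
    (forall f g, endo m f -> endo m g -> F (Add f g) === Add (F f) (F g)) ->
    (forall k f, F (Scale k f) === Scale k (F f)) ->
    F (Id (ones m)) === Id (ones n) ->
    (forall i, (i.+1 < m)%N -> ((r i).+1 < n)%N /\ F (xdiag K m i) === xdiag K n (r i)) ->
  forall f, endo m f -> span [f]_m -> span [F f]_n.
Proof.
move=> Fe Ft Fc Fa Fs F1 Fx f tf.
suff H (x : End m) : span x -> span [F (sprep x)]_n.
  by move/H; rewrite (cls_eqd _ _ (Fe _ _ (sprep_clsE tf))).
have tp (y : End m) : endo m (sprep y) by apply: sprep_typed.
have FM (y z : End m) : [F (sprep (y * z))]_n = [F (sprep y)]_n * [F (sprep z)]_n.
  rewrite -endcls_Comp ?Ft //; apply: cls_eqd; rewrite -Fc //; apply: Fe.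
  by apply: deq_eqd (sprep_cls _).
have FL k (y z : End m) : [F (sprep (k *: y + z))]_n = k *: [F (sprep y)]_n + [F (sprep z)]_n.
  have ts : endo m (Scale k (sprep y)) := tp y.
  rewrite -cls_Scale ?Ft // -cls_Add; [|exact: Ft|exact: Ft].
  apply: cls_eqd; rewrite -Fs -Fa //; apply: Fe.
  exact: deq_eqd (sp_lin _ _ _).
have F1' : [F (sprep (1 : End m))]_n = 1.
  by rewrite -[RHS]endcls_Id; apply: cls_eqd; rewrite -F1; apply: Fe; apply: deq_eqd (sprep_cls _).
move=> sx; elim: x / sx => [v vm||k y z _ sy _ sz]; last by rewrite FL; apply: span_lin.
  elim: v vm => [_|i v IH /= /andP[im /IH{}IH]].
    by rewrite /sword big_nil F1'; apply: span_one.
  rewrite /sword big_cons FM; apply: span_mul IH.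
  have im' : (i.+1 < m)%N by lia.
  have [ri Fi] := Fx i im'.
  have -> : sgen m i = (-1) *: (1 : End m) + xgen m i by rewrite scaleN1r addrC.
  rewrite FL F1' (cls_eqd _ _ (Fe _ _ (sprep_clsE (xdiag_typed K im')))).
  by rewrite (cls_eqd _ _ Fi) scaleN1r addrC; apply: span_sgen.
have -> : (0 : End m) = (-1) *: (1 : End m) + 1 by rewrite scaleN1r addNr.
by rewrite FL F1' scaleN1r addNr; apply: span_zero.
Qed.

(** A product f (x) g is (f (x) 1)(1 (x) g). *)
Lemma span_Tens m n f g : endo m f -> endo n g -> span [f]_m -> span [g]_n ->
  span [Tens f g]_(m + n)%N.
Proof.
move=> tf tg sf sg.
have tl h : endo m h -> endo (m + n) (Tens h (Id (ones n))).
  by move=> th; rewrite onesD; apply: typed_tens th (typed_id _ _).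
have tr h : endo n h -> endo (m + n) (Tens (Id (ones m)) h).
  by move=> th; rewrite onesD; apply: typed_tens (typed_id _ _) th.
rewrite (cls_eqd _ _ (Tens_Id_slide tf tg)) endcls_Comp; [|exact: tl|exact: tr].
apply: span_mul.
- apply: (@span_map m (m + n) (fun h => Tens h (Id (ones n))) id) sf => //.
  + by move=> h h' e; apply: eqd_Tens.
  + move=> h h' /typedP[_ sh _] /typedP[_ _ th']; apply: TensId_Comp.
    by rewrite sh th'.
  + move=> h h' /typedP[_ sh th] /typedP[_ sh' th']; apply: Tens_Addl.
      by rewrite sh sh'.
    by rewrite th th'.
  + by move=> k h; apply: Tens_Scalel.
  + by rewrite Tens1 -onesD.
  + move=> i im; split; first by rewrite ltn_addr.
    by rewrite /xdiag pad_Tensr addnBAC.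
- apply: (@span_map n (m + n) (fun h => Tens (Id (ones m)) h) (addn m)) sg => //.
  + by move=> h h' e; apply: eqd_Tens.
  + move=> h h' /typedP[_ sh _] /typedP[_ _ th']; apply: IdTens_Comp.
    by rewrite sh th'.
  + move=> h h' /typedP[_ sh th] /typedP[_ sh' th']; apply: Tens_Addr.
      by rewrite sh sh'.
    by rewrite th th'.
  + by move=> k h; apply: Tens_Scaler.
  + by rewrite Tens1 -onesD.
  + move=> i im; split; first by rewrite -addnS ltn_add2l.
    by rewrite /xdiag pad_Tensl -!addnS subnDl.
Qed.

Lemma alg_span d f : alg d f -> span [f]_d.
Proof.
elim=> {d f} [d||d g f ag sg af sf|m n f g af sf ag sg|d|d f g af sf ag sg
  |d k f af sf|d f g af sf e].
- rewrite endcls_Id; exact: span_one.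
- have -> : [X]_2 = 1 *: sgen 2 0 + (1 : End 2).
    rewrite scale1r subrK /xgen; apply: cls_eqd.
    by rewrite /xdiag /pad Tens1f Tensf1.
  by apply: span_lin; [apply: span_sgen | apply: span_one].
- rewrite endcls_Comp; [exact: span_mul | exact: alg_typed | exact: alg_typed].
- by apply: span_Tens => //; apply: alg_typed.
- rewrite cls_Zero; exact: span_zero.
- by rewrite cls_Add ?alg_typed //; apply: span_add.
- by rewrite cls_Scale ?alg_typed //; apply: span_scale.
- by rewrite -(cls_eqd _ _ e).
Qed.

End Span.

(** * The symbol is faithful and full *)

Section PermWords.
Local Open Scope nat_scope.
Local Open Scope group_scope.
Variable d : nat.

(** Equal to 1 when i + 1 is out of range. *)
Definition adj i : 'S_d :=
  if (insub i, insub i.+1) is (Some a, Some b) then tperm a b else 1.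

Lemma adjE i (a b : 'I_d) : val a = i -> val b = i.+1 -> adj i = tperm a b.
Proof. by move=> <- e; rewrite /adj -e !valK. Qed.

Lemma adj_swap i (p : 'I_d) : i.+1 < d -> val (adj i p) = swap i p.
Proof.
move=> id_; rewrite (@adjE i (Ordinal (ltnW id_)) (Ordinal id_)) // /swap.
case: tpermP => [->|->|n1 n2] /=; rewrite ?eqxx //.
  by rewrite -[X in X == _]addn1 -[X in _ == X]addn0 eqn_add2l.
case: eqP => [e|_]; first by case: n1; apply: val_inj.
by case: eqP => // e; case: n2; apply: val_inj.
Qed.

Lemma adjV i : (adj i)^-1 = adj i.
Proof.
rewrite /adj; case: (insub i) => [a|]; last by rewrite invg1.
by case: (insub i.+1) => [b|]; rewrite ?tpermV ?invg1.
Qed.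

Definition pword (v : seq nat) : 'S_d := \prod_(i <- v) adj i.

(** Permutations compose from left to right and words act from right to
    left, whence the inverse. *)
Lemma pword_act v (p : 'I_d) : all (ltn^~ d.-1) v -> val ((pword v)^-1 p) = act v p.
Proof.
elim: v p => [|i v IH] p /=; first by rewrite /pword big_nil invg1 perm1.
move=> /andP[id_ vd]; rewrite /pword big_cons invMg permM adjV.
by rewrite adj_swap ?IH //; lia.
Qed.

Lemma pword_cox u v : all (ltn^~ d.-1) u -> all (ltn^~ d.-1) v ->
  pword u = pword v -> cox d.-1 u v.
Proof.
move=> ud vd e; apply: cox_complete => // p.
have [pd|dp] := ltnP p d; first by rewrite -!(pword_act (Ordinal pd)) // e.
case: (posnP d) => [d0|dgt0]; last by rewrite !(act_fix (n := d.-1)) //; lia.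
by move: ud vd {e}; rewrite d0; case: u => // _; case: v.
Qed.

Lemma pword_onto (w : 'S_d) : exists v, all (ltn^~ d.-1) v && (pword v == w).
Proof.
pose g p := if insub p is Some q then val (w^-1 (q : 'I_d)) else p.
have gE (q : 'I_d) : g q = val (w^-1 q) by rewrite /g valK.
have gd p : d <= p -> g p = p by rewrite /g => dp; rewrite insubF // ltnNge dp.
have [|p dp|v vd ve] := @act_onto d.-1 g.
- move=> p q; have [pd|dp] := ltnP p d; have [qd|dq] := ltnP q d.
  + have -> : p = Ordinal pd by []. have -> : q = Ordinal qd by [].
    by rewrite !gE => /val_inj/perm_inj ->.
  + rewrite (gd q) //; have := gE (Ordinal pd) => /= -> e.
    by have := ltn_ord (w^-1 (Ordinal pd)); rewrite [X in X < _]e ltnNge dq.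
  + rewrite (gd p) //; have := gE (Ordinal qd) => /= -> e.
    by have := ltn_ord (w^-1 (Ordinal qd)); rewrite -[X in X < _]e ltnNge dp.
  + by rewrite !gd.
- by apply: gd; lia.
exists v; rewrite vd; apply/eqP/invg_inj/permP => p; apply: val_inj.
by rewrite /= [LHS](pword_act _ vd) ve gE.
Qed.

Definition word (w : 'S_d) : seq nat := xchoose (pword_onto w).

Lemma word_lt w : all (ltn^~ d.-1) (word w).
Proof. by have /andP[] := xchooseP (pword_onto w). Qed.

Lemma pwordK w : pword (word w) = w.
Proof. by have /andP[_ /eqP] := xchooseP (pword_onto w). Qed.

End PermWords.

Section Faithful.
Variable K : fieldType.
Hypothesis char0 : forall n, n.+1%:R != 0 :> K.
Implicit Types (f g h : diag K) (a b c : composition) (i j m n d : nat).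
Local Notation "f === g" := (@eqd K f g) (at level 70, no associativity).
Local Notation X := (mergesplit K).
Local Notation End d := (spend K (ones d)).
Local Notation endo d := (typed (ones d) (ones d)).
Local Notation "[ f ]_ d" := (cls (ones d) (ones d) f : End d) (format "[ f ]_ d").

Definition evs a b (x : sphom K a b) : gfun K := ev (sprep x).

Lemma evs_cls a b f : typed a b f -> evs (cls a b f) = ev f.
Proof.
move=> tf; rewrite /evs; apply: (deq_ev char0).
by apply: eqd_deq (sprep_typed _) (sprep_clsE tf).
Qed.

Lemma evs_lin a b k (x y : sphom K a b) d (w : 'S_d) :
  evs (k *: x + y) w = k * evs x w + evs y w.
Proof. by rewrite /evs (deq_ev char0 (sp_lin k x y)). Qed.

Lemma evs_sum a b d (I : finType) (k : I -> K) (x : I -> sphom K a b) (w : 'S_d) :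
  evs (\sum_i k i *: x i) w = \sum_i k i * evs (x i) w.
Proof.
have e0 : evs (0 : sphom K a b) w = 0.
  by have := evs_lin (-1) (0 : sphom K a b) 0 w; rewrite scaler0 addr0 mulN1r addNr.
elim/big_rec2: _ => // i y z _ <-.
exact: evs_lin.
Qed.

Lemma ycard_ones d : ycard (ones d) = 1%N.
Proof.
elim: d => [|d IH]; last by rewrite onesS ycard_cat IH ycard1.
exact: (ycard1 0).
Qed.

Lemma evs_mul d (x y : End d) (w : 'S_d) : evs (x * y) w = gconv (evs x) (evs y) w.
Proof.
have -> : evs (x * y) = ev (Comp (sprep x) (sprep y)).
  exact: (deq_ev char0 (sprep_cls (typed_comp (sprep_typed x) (sprep_typed y)))).
rewrite ev_Comp; have /typedP[_ _ ->] := sprep_typed y.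
by rewrite ycard_ones invr1 mul1r.
Qed.

Lemma young_ones d (w : 'S_d) : (w \in young d (ones d)) = (w == 1%g).
Proof.
have := ycard_ones d; rewrite /ycard sumn_ones => /eqP/cards1P[u Yu].
have : (1%g : 'S_d) \in young d (ones d) by apply: group1.
by rewrite Yu !inE => /eqP<-.
Qed.

Lemma evs_one d (w : 'S_d) : evs (1 : End d) w = (w == 1%g)%:R.
Proof.
rewrite /evs [ev _](deq_ev char0 (sprep_cls (typed_id K (ones d)))) /= /gyoung.
by rewrite sumn_ones eqxx young_ones.
Qed.

(** The symbol of the square is the indicator of the Young subgroup with
    one block {i, i + 1}, a group of order 2. *)
Lemma evs_xgen d i (w : 'S_d) : (i.+1 < d)%N ->
  evs (xgen K d i) w = (w == 1%g)%:R + (w == adj d i)%:R.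
Proof.
move=> id_; rewrite evs_cls ?xdiag_typed //.
have evX : ev X = gyoung K (strip [:: 2%N]).
  apply: gfunP => n z; rewrite ev_Comp (gconv_young1l _ (gyoung_binv K _)).
  by rewrite mulKf // ycard_neq0.
pose j := (d - i.+2)%N.
have -> : ev (xdiag K d i) = gyoung K (catc (ones i) (catc (strip [:: 2%N]) (ones j))).
  by rewrite /xdiag /pad !ev_Tens evX -!gyoung_tens.
set s := catc _ _; have sd : sumn s = d.
  have sc b c : sumn (catc b c) = (sumn b + sumn c)%N := sumn_cat b c.
  by rewrite /s !sc !sumn_ones sumn_strip /= /j; lia.
rewrite /gyoung sd eqxx /=.
have Yc : #|young d s| = 2%N.
  have : ycard s = 2%N by rewrite !ycard_cat !ycard_ones ycard1.
  by rewrite /ycard sd.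
have adj1 : adj d i != 1%g.
  apply/eqP => /permP/(_ (Ordinal (ltnW id_))) /(congr1 val).
  by rewrite [LHS]adj_swap // perm1 /= /swap eqxx; lia.
have Ya : adj d i \in young d s.
  apply/youngP => p; rewrite [nat_of_ord (_ p)]adj_swap // /swap.
  have rE q : reshape_index s (i + q) = (size (ones i) + reshape_index (2%N :: ones j) q)%N.
    have := reshape_index_catr (ones i) (catc (strip [:: 2%N]) (ones j)) q.
    by rewrite sumn_ones.
  have r0 : reshape_index s i.+1 = reshape_index s i.
    by rewrite -[i.+1]addn1 -[in RHS](addn0 i) !rE.
  by case: eqP => [->|_] //; case: eqP => [->|_].
have -> : (w \in young d s) = (w \in [set 1%g; adj d i]).
  congr (w \in pred_of_set _); apply/esym/eqP; rewrite eqEcard Yc cards2 eq_sym adj1 leqnn andbT.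
  by apply/subsetP => u; rewrite in_set2 => /orP[/eqP->|/eqP->]; [apply: group1 | ].
rewrite !inE; case: (eqVneq w 1%g) => [->|_] /=; last by rewrite add0r.
by rewrite eq_sym (negPf adj1) addr0.
Qed.

Lemma evs_sgen d i (w : 'S_d) : (i.+1 < d)%N ->
  evs (sgen K d i) w = (w == adj d i)%:R.
Proof.
move=> id_; have -> : sgen K d i = (-1) *: (1 : End d) + xgen K d i.
  by rewrite scaleN1r addrC.
by rewrite evs_lin evs_one evs_xgen // mulN1r addKr.
Qed.

Lemma evs_sword d v (w : 'S_d) : all (ltn^~ d.-1) v ->
  evs (sword K d v) w = (w == pword d v)%:R.
Proof.
elim: v w => [|i v IH] w; first by rewrite /sword /pword !big_nil evs_one.
move=> /= /andP[id_ vd]; rewrite /sword /pword !big_cons evs_mul.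
rewrite -/(sword K d v) -/(pword d v).
rewrite /gconv (bigD1 (pword d v)) //= big1 => [|z /negPf nz]; last first.
  by rewrite IH // nz mulr0.
rewrite addr0 IH // eqxx mulr1 evs_sgen; last by lia.
by rewrite (can2_eq (mulgKV _) (mulgK _)).
Qed.

(** Words with the same permutation have the same class by the Coxeter
    presentation, and the symbol of a word is the indicator of its permutation,
    so the coefficients of a combination of words are the values of its
    symbol. *)
Lemma span_expand d (x : End d) : span x ->
  x = \sum_(w : 'S_d) evs x w *: sword K d (word w).
Proof.
have e0 (w : 'S_d) : evs (0 : End d) w = 0.
  by have := evs_lin (-1) (0 : End d) 0 w; rewrite scaler0 addr0 mulN1r addNr.
move=> sx; elim: x / sx => [v vd||k y z _ ey _ ez].
- rewrite (bigD1 (pword d v)) //= big1 => [|w /negPf nw]; last first.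
    by rewrite evs_sword // nw scale0r.
  rewrite addr0 evs_sword // eqxx scale1r; apply: cox_sword.
  by apply: pword_cox; rewrite ?word_lt ?pwordK.
- by rewrite big1 // => w _; rewrite e0 scale0r.
- rewrite {1}ey {1}ez scaler_sumr -big_split; apply: eq_bigr => w _ /=.
  by rewrite evs_lin scalerDl scalerA.
Qed.

Lemma unred a b f : typed a b f ->
  Comp (mrgs K b) (Comp (red a b f) (spls K a)) === Scale ((facts b)%:R * (facts a)%:R) f.
Proof.
move=> /typedP[_ sf tf].
transitivity (Comp (Comp (mrgs K b) (spls K b)) (Comp f (Comp (mrgs K a) (spls K a)))).
  by rewrite /red !CompA.
rewrite !mrgs_spls !stripK Comp_Scalel !Comp_Scaler ScaleA Compf1 // Comp1f //.
Qed.

(** The flattening of f is a combination of words with zero symbol, hence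
    zero; and f is recovered from its flattening. *)
Lemma ev_eq0 a b f : typed a b f -> (forall d (w : 'S_d), ev f w = 0) -> f === Zero a b.
Proof.
move=> tf f0; have [rf zf] := red_alg char0 tf.
have [e|ne] := eqVneq (sumn a) (sumn b); last exact: zf.
have ar := rf e; have tr := alg_typed ar.
have r0 : red a b f === Zero (ones (sumn a)) (ones (sumn b)).
  rewrite -e; apply: (cls_inj tr (typed_zero _ _ _)); rewrite cls_Zero.
  rewrite [LHS](span_expand (alg_span ar)) big1 // => w _.
  rewrite evs_cls // ev_Comp0r ?scale0r // => z; exact: ev_Comp0l.
have F0 : (facts b)%:R * (facts a)%:R != 0 :> K by rewrite mulf_neq0 // facts_neq0.
rewrite -(Scale1 f) -(mulVf F0) -ScaleA -(unred tf) r0.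
rewrite (Zero_Comp _ (spls_typedc K a)) (Comp_Zero _ (mrgs_typedc K b)).
exact: Scale_Zero.
Qed.

Theorem evs_inj a b (x y : sphom K a b) : evs x = evs y -> x = y.
Proof.
move=> xy; apply/eqP; rewrite -subr_eq0 -(sprepE (x - y)) -(cls_Zero K a b).
apply/eqP/cls_eqd/ev_eq0 => [|d w]; first exact: sprep_typed.
have := evs_lin (-1) y x w; rewrite scaleN1r addrC => E.
by rewrite -[LHS]/(evs (x - y) w) E xy mulN1r addNr.
Qed.

Lemma ev_mrg k : ev (mrg K k) = gyoung K (strip [:: k]).
Proof.
elim: k => [|k IH]; first by rewrite /= strip0.
apply: gfunP => d w; rewrite [mrg K k.+1]/= ev_Comp_Merge gyoung1 addn1.
case: eqP => [e|_]; last by rewrite mul0r.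
rewrite mul1r ev_Tens IH src_mrg [tgt _]/= tgt_mrg sumn_ones gyoung_tens2 /= ?addn0 //.
have -> : d = sumn (strip [:: k; 1%N]) by rewrite sumn_strip e /= addn1.
by rewrite gaug_young -strip2 mulfV ?ycard_neq0.
Qed.

Lemma ev_spl k : ev (spl K k) = gyoung K (strip [:: k]).
Proof.
elim: k => [|k IH]; first by rewrite /= strip0.
apply: gfunP => d w; rewrite [spl K k.+1]/= ev_Comp_Split gyoung1 addn1.
case: eqP => [e|_]; last by rewrite mul0r.
rewrite mul1r ev_Tens IH src_spl gyoung_tens2 ?sumn_strip //= ?addn0 //.
have -> : d = sumn (strip [:: k; 1%N]) by rewrite sumn_strip e /= addn1.
by rewrite gaug_young mulfV ?ycard_neq0.
Qed.

Lemma ev_mrgs (s : seq nat) : ev (mrgs K s) = gyoung K (strip s).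
Proof.
elim: s => [|k s IH] //; rewrite [mrgs K _]/= ev_Tens IH ev_mrg src_mrg src_mrgs !sumn_ones.
by rewrite gyoung_tens2 //= addn0.
Qed.

Lemma ev_spls (s : seq nat) : ev (spls K s) = gyoung K (strip s).
Proof.
elim: s => [|k s IH] //; rewrite [spls K _]/= ev_Tens IH ev_spl src_spl src_spls !sumn_strip.
by rewrite gyoung_tens2 //= addn0.
Qed.

(** A bi-invariant u is realized on thin strands by a combination of words;
    merging and splitting at the two ends multiplies the symbol by the
    indicators of the Young subgroups on both sides, that is, by the orders of
    these subgroups. *)
Theorem ev_onto a b (u : gfun K) : binv a b u -> exists2 f, typed a b f & ev f = u.
Proof.
move=> bu; have [ua ub _ _] := bu.
have [e|ne] := eqVneq (sumn a) (sumn b); last first.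
  exists (Zero a b); first exact: typed_zero.
  by apply: gfunP => d w; rewrite (binv_diff w bu ne).
pose d := sumn a.
pose h : End d := \sum_(w : 'S_d) u d w *: sword K d (word w).
have hE : ev (sprep h) = u.
  apply: gfunP => n w; have [nd|nd] := eqVneq n d; last first.
    by rewrite ua // (deg_typed _ (sprep_typed h)) // sumn_ones.
  subst n; rewrite -[LHS]/(evs h w) evs_sum (bigD1 w) //= big1 => [|z /negPf nz].
    by rewrite addr0 evs_sword ?word_lt // pwordK eqxx mulr1.
  by rewrite evs_sword ?word_lt // pwordK eq_sym nz mulr0.
have tf : typed a b (Comp (mrgs K b) (Comp (sprep h) (spls K a))).
  apply: typed_comp (mrgs_typedc K b) (typed_comp _ (spls_typedc K a)).
  by rewrite -e; apply: sprep_typed.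
exists (Scale ((ycard b)%:R * (ycard a)%:R)^-1 (Comp (mrgs K b) (Comp (sprep h) (spls K a)))) => //.
have inner : ev (Comp (sprep h) (spls K a)) = fun n w => (ycard a)%:R * u n w.
  apply: gfunP => n w; rewrite ev_Comp tgt_spls ycard_ones invr1 mul1r hE ev_spls stripK.
  exact: gconv_young1r bu.
apply: gfunP => n w; transitivity (((ycard b)%:R * (ycard a)%:R)^-1 *
  ev (Comp (mrgs K b) (Comp (sprep h) (spls K a))) w); first by [].
rewrite ev_Comp [tgt _]/=; have /typedP[_ _ ->] := sprep_typed h.
rewrite ycard_ones invr1 mul1r ev_mrgs stripK inner gconv_scaler.
rewrite (gconv_young1l _ bu) (mulrA (ycard a)%:R) (mulrC (ycard a)%:R) mulKf //.
by rewrite mulf_neq0 // ycard_neq0.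
Qed.

End Faithful.

(** * The isomorphism of categories *)

Lemma pshape_inj (a b : pob) : pshape a = pshape b -> a = b.
Proof.
case: a b => [m s sm] [n t tn] /= e; subst t; apply: pob_eq => //=.
by rewrite -(eqP sm) (eqP tn).
Qed.

Lemma pshape_Mob (s : seq nat) : pshape (Mob s) = strip s.
Proof. by []. Qed.

Lemma pshape_Mobc (a : composition) : pshape (Mob a) = a.
Proof. exact: stripK. Qed.

Lemma sumn_pshape (a : pob) : sumn (pshape a) = pdeg a.
Proof. exact: eqP (pob_sum a). Qed.

Section EvsLaws.
Variable K : fieldType.
Hypothesis char0 : forall n, n.+1%:R != 0 :> K.
Implicit Types (a b c : composition).

Lemma evs_binv a b (x : sphom K a b) : binv a b (evs x).
Proof. exact: ev_binv_typed (sprep_typed x). Qed.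

Lemma evs_spcls a b (f : diag K) (tf : typed a b f) : evs (spcls tf) = ev f.
Proof. exact: (deq_ev char0 (sprep_cls tf)). Qed.

Lemma evs_spid a : evs (spid K a) = gyoung K a.
Proof. exact: evs_spcls. Qed.

Lemma evs_spcomp a b c (g : sphom K b c) (f : sphom K a b) :
  evs (spcomp g f) = fun d w => (ycard b)%:R^-1 * gconv (evs g) (evs f) w.
Proof.
rewrite evs_spcls; apply: gfunP => d w; rewrite ev_Comp.
by have /typedP[_ _ ->] := sprep_typed f.
Qed.

Lemma evs_sptens a b c d (f : sphom K a b) (g : sphom K c d) :
  evs (sptens f g) = gtens (sumn a) (sumn c) (evs f) (evs g).
Proof.
rewrite evs_spcls ev_Tens; have /typedP[_ -> _] := sprep_typed f.
by have /typedP[_ -> _] := sprep_typed g.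
Qed.

Lemma Arr_evs a b a' b' (x : sphom K a b) (x' : sphom K a' b') :
  a = a' -> b = b' -> evs x = evs x' ->
  @Arr K (sp_data K) a b x = @Arr K (sp_data K) a' b' x'.
Proof. by move=> ea eb; subst => /(evs_inj char0)->. Qed.

End EvsLaws.

Section Gamma.
Variable K : fieldType.
Hypothesis char0 : forall n, n.+1%:R != 0 :> K.
Implicit Types (a b c : composition) (p q : pob).

Lemma gamma_subproof a b (x : sphom K a b) :
  exists f : phom K (Mob a) (Mob b), hsym f = evs x.
Proof. by apply: hsym_surj => //; rewrite !pshape_Mobc; apply: evs_binv. Qed.

(** Both hom spaces are identified with the same space of
    bi-invariant functions by their symbols, so a morphism and its image are
    matched by having equal symbols.  All functor laws then follow from the
    formulas for symbols. *)
Definition gamma_mor a b (x : sphom K a b) : phom K (Mob a) (Mob b) :=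
  projT1 (cid (gamma_subproof x)).

Lemma hsym_gamma a b (x : sphom K a b) : hsym (gamma_mor x) = evs x.
Proof. exact: projT2 (cid (gamma_subproof x)). Qed.

Lemma gamma_linear a b : linear (@gamma_mor a b).
Proof.
move=> k x y; apply: hsym_inj; apply: gfunP => d w.
by rewrite hsym_lin !hsym_gamma evs_lin.
Qed.

HB.instance Definition _ a b :=
  GRing.isLinear.Build K (sphom K a b) (phom K (Mob a) (Mob b)) *:%R
    (@gamma_mor a b) (@gamma_linear a b).

Lemma gamma_id a : gamma_mor (spid K a) = pid K (Mob a).
Proof. by apply: hsym_inj; rewrite hsym_gamma hsym_id evs_spid // pshape_Mobc. Qed.

Lemma gamma_comp a b c (g : sphom K b c) (f : sphom K a b) :
  gamma_mor (spcomp g f) = pcomp (gamma_mor g) (gamma_mor f).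
Proof.
apply: hsym_inj; apply: gfunP => d w.
by rewrite hsym_gamma evs_spcomp // hsym_comp // !hsym_gamma pshape_Mobc.
Qed.

Lemma Mob_strip (s : seq nat) : Mob (strip s) = Mob s.
Proof. by apply: pshape_inj; rewrite pshape_Mobc. Qed.

Lemma Mob_catc a b : Mob (catc a b) = pprod (Mob a) (Mob b).
Proof. by apply: pshape_inj; rewrite pshape_Mobc /= !stripK. Qed.

Lemma gamma_tens a b c d (f : sphom K a b) (g : sphom K c d) :
  @Arr K (perm_data K) _ _ (gamma_mor (sptens f g)) =
  @Arr K (perm_data K) _ _ (ptens (gamma_mor f) (gamma_mor g)).
Proof.
apply: Arr_phi; rewrite ?Mob_catc //.
by rewrite hsym_gamma evs_sptens // hsym_tens // !hsym_gamma.
Qed.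

Definition gamma_functor : lmfunctor (SpPerm K) (Perm K) :=
  @LMFunctor K (SpPerm K) (Perm K) (fun a : composition => Mob a)
    (fun a b => @gamma_mor a b : {linear _ -> _})
    gamma_id gamma_comp (Mob_strip [::]) Mob_catc gamma_tens.

Lemma gamma_spec : Gamma_spec gamma_functor.
Proof.
split=> // k l; apply: Arr_phi; try exact: Mob_strip.
  by rewrite [LHS]hsym_gamma [LHS]evs_spcls // hsym_nabla.
by rewrite [LHS]hsym_gamma [LHS]evs_spcls // hsym_delta.
Qed.

Lemma inv_subproof p q (f : phom K p q) :
  exists x : sphom K (pshape p) (pshape q), evs x = hsym f.
Proof.
have [g tg gE] := ev_onto char0 (hsym_binv f).
by exists (spcls tg); rewrite evs_spcls.
Qed.

Definition inv_mor p q (f : phom K p q) : sphom K (pshape p) (pshape q) :=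
  projT1 (cid (inv_subproof f)).

Lemma evs_inv_mor p q (f : phom K p q) : evs (inv_mor f) = hsym f.
Proof. exact: projT2 (cid (inv_subproof f)). Qed.

Lemma inv_linear p q : linear (@inv_mor p q).
Proof.
move=> k x y; apply: (evs_inj char0); apply: gfunP => d w.
by rewrite evs_lin // !evs_inv_mor hsym_lin.
Qed.

HB.instance Definition _ p q :=
  GRing.isLinear.Build K (phom K p q) (sphom K (pshape p) (pshape q)) *:%R
    (@inv_mor p q) (@inv_linear p q).

Lemma inv_id p : inv_mor (pid K p) = spid K (pshape p).
Proof. by apply: (evs_inj char0); rewrite evs_inv_mor hsym_id evs_spid. Qed.

Lemma inv_comp p q r (g : phom K q r) (f : phom K p q) :
  inv_mor (pcomp g f) = spcomp (inv_mor g) (inv_mor f).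
Proof.
apply: (evs_inj char0); apply: gfunP => d w.
by rewrite evs_inv_mor evs_spcomp // hsym_comp // !evs_inv_mor.
Qed.

Lemma inv_tens p q r t (f : phom K p q) (g : phom K r t) :
  @Arr K (sp_data K) _ _ (inv_mor (ptens f g)) =
  @Arr K (sp_data K) _ _ (sptens (inv_mor f) (inv_mor g)).
Proof.
apply: Arr_evs => //; rewrite evs_inv_mor evs_sptens // hsym_tens //.
by rewrite !evs_inv_mor !sumn_pshape.
Qed.

Definition inv_functor : lmfunctor (Perm K) (SpPerm K) :=
  @LMFunctor K (Perm K) (SpPerm K) pshape
    (fun a b : pob => @inv_mor a b : {linear phom K a b -> sphom K (pshape a) (pshape b)})
    inv_id inv_comp (erefl _) (fun _ _ => erefl _) inv_tens.

Lemma gamma_iso : lmiso gamma_functor.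
Proof.
exists inv_functor; split=> a b f.
  apply: (Arr_evs char0); try exact: pshape_Mobc.
  by rewrite [LHS]evs_inv_mor; apply: hsym_gamma.
apply: Arr_phi; try by apply: pshape_inj; apply: pshape_Mobc.
by rewrite [LHS]hsym_gamma; apply: evs_inv_mor.
Qed.

(** The values on merges and splits determine the symbols of all images, by
    induction on diagrams; symbols determine arrows. *)
Lemma hsym_spec (G : lmfunctor (SpPerm K) (Perm K)) : Gamma_spec G ->
  forall (f : diag K) a b, typed a b f -> hsym (fmor G a b (cls a b f)) = ev f.
Proof.
move=> [Gob Gm Gs]; have sh a : pshape (fob G a) = a by rewrite Gob pshape_Mobc.
have dg a : pdeg (fob G a) = sumn a by rewrite Gob.
elim=> [c|k l|k l|g IHg f IHf|f IHf g IHg|c d|f IHf g IHg|k f IHf] a b.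
- move=> /typedP[_ /= <- <-]; rewrite cls_Id (fmor_id G) [LHS]hsym_id.
  by rewrite sh.
- move=> /typedP[_ /= <- <-]; rewrite (clsE (typed_merge K k l)).
  by rewrite (hsym_Arr (Gm k l)) hsym_nabla.
- move=> /typedP[_ /= <- <-]; rewrite (clsE (typed_split K k l)).
  by rewrite (hsym_Arr (Gs k l)) hsym_delta.
- move=> /typedP[/= /and3P[wg wf /eqP e] <- <-].
  have tf : typed (src f) (src g) f by apply/typedP; rewrite e.
  have tg : typed (src g) (tgt g) g by apply/typedP.
  rewrite (cls_Comp tg tf) (fmor_comp G); apply: gfunP => d w.
  by rewrite [LHS]hsym_comp // IHf // IHg // sh e.
- move=> /typedP[/= /andP[wf wg] <- <-].
  have tf := wf_typed wf; have tg := wf_typed wg.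
  rewrite (cls_Tens tf tg) (hsym_Arr (fmor_tens G _ _)) [LHS]hsym_tens //.
  by rewrite IHf // IHg // !dg.
- move=> /typedP[_ /= <- <-]; rewrite cls_Zero linear0.
  by apply: gfunP => n w; rewrite hsym0 // => v; rewrite lfunE.
- move=> /typedP[/= /and4P[wf wg /eqP es /eqP et] <- <-].
  have tf := wf_typed wf; have tg : typed (src f) (tgt f) g by apply/typedP.
  rewrite cls_Add // -[cls _ _ f]scale1r linearP; apply: gfunP => n w.
  by rewrite [LHS]hsym_lin IHf // IHg // mul1r.
- move=> tf; rewrite cls_Scale // -[_ *: _]addr0 linearP linear0.
  apply: gfunP => n w; rewrite [LHS]hsym_lin IHf // hsym0 ?addr0 // => v.
  by rewrite lfunE.
Qed.

Lemma gamma_unique (G : lmfunctor (SpPerm K) (Perm K)) : Gamma_spec G ->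
  forall a b (f : @mhom K (SpPerm K) a b),
    Arr (fmor G a b f) = Arr (fmor gamma_functor a b f).
Proof.
move=> sG a b f; have [Gob _ _] := sG.
apply: Arr_phi; try exact: Gob.
rewrite -(sprepE f) (hsym_spec sG (sprep_typed f)).
by rewrite (hsym_spec gamma_spec (sprep_typed f)).
Qed.

(** Identities are generated because nabla k 0 is one. *)
Lemma generated_id (s : seq nat) :
  generated (@nabla_delta K) (@Arr K (Perm K) _ _ (pid K (Mob s))).
Proof.
elim: s => [|k s IH].
  have <- : @Arr K (Perm K) _ _ (nabla K 0 0) = @Arr K (Perm K) _ _ (pid K (Mob [::])).
    by apply: Arr_phi; rewrite ?hsym_nabla ?hsym_id //; apply: pshape_inj; apply: val_inj.
  by apply: gen_base; apply: nd_nabla.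
have <- : @Arr K (Perm K) _ _ (@mtens K (Perm K) _ _ _ _ (nabla K k 0) (pid K (Mob s)))
    = @Arr K (Perm K) _ _ (pid K (Mob (k :: s))).
  apply: Arr_phi.
  - by apply: pshape_inj; apply: val_inj => /=; case: eqP.
  - by apply: pshape_inj; apply: val_inj => /=; rewrite addn0; case: eqP.
  rewrite [LHS]hsym_tens // hsym_nabla !hsym_id addn0.
  by rewrite gyoung_tens2 //= addn0.
by apply: gen_tens IH; apply: gen_base; apply: nd_nabla.
Qed.

(** By induction on a diagram with the same symbol as u.  Since symbols
    determine maps, u is built from nabla and delta in the way the diagram is
    built from merges and splits. *)
Lemma generated_ev (f : diag K) p q (u : phom K p q) :
  typed (pshape p) (pshape q) f -> hsym u = ev f ->
  generated (@nabla_delta K) (@Arr K (Perm K) _ _ u).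
Proof.
have get a b (g : diag K) : typed a b g -> exists v : phom K (Mob a) (Mob b), hsym v = ev g.
  by move=> tg; apply: hsym_surj => //; rewrite !pshape_Mobc; apply: ev_binv_typed.
have getp r t (g : diag K) : typed (pshape r) (pshape t) g -> exists v : phom K r t, hsym v = ev g.
  by move=> tg; apply: hsym_surj => //; apply: ev_binv_typed.
elim: f p q u => [c|k l|k l|g IHg f IHf|f IHf g IHg|c d|f IHf g IHg|k f IHf] p q u.
- move=> /typedP[_ /= cp cq] uE.
  have <- : @Arr K (Perm K) _ _ (pid K (Mob c)) = @Arr K (Perm K) _ _ u.
    apply: Arr_phi; try by apply: pshape_inj; rewrite pshape_Mobc.
    by rewrite hsym_id uE pshape_Mobc.
  exact: generated_id.
- move=> /typedP[_ /= cp cq] uE.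
  have <- : @Arr K (Perm K) _ _ (nabla K k l) = @Arr K (Perm K) _ _ u.
    by apply: Arr_phi; rewrite ?uE ?hsym_nabla //; apply: pshape_inj; rewrite pshape_Mob.
  by apply: gen_base; apply: nd_nabla.
- move=> /typedP[_ /= cp cq] uE.
  have <- : @Arr K (Perm K) _ _ (delta K k l) = @Arr K (Perm K) _ _ u.
    by apply: Arr_phi; rewrite ?uE ?hsym_delta //; apply: pshape_inj; rewrite pshape_Mob.
  by apply: gen_base; apply: nd_delta.
- move=> /typedP[/= /and3P[wg wf /eqP e] sf tg] uE.
  have tf' : typed (pshape p) (pshape (Mob (src g))) f by apply/typedP; rewrite pshape_Mobc.
  have tg' : typed (pshape (Mob (src g))) (pshape q) g by apply/typedP; rewrite pshape_Mobc.
  have [v vE] := getp _ _ _ tf'; have [v' v'E] := getp _ _ _ tg'.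
  have -> : u = pcomp v' v.
    apply: hsym_inj; apply: gfunP => d w.
    by rewrite uE hsym_comp // vE v'E pshape_Mobc /= e.
  by apply: (@gen_comp K (Perm K)); [apply: IHg | apply: IHf].
- move=> /typedP[/= /andP[wf wg] sp tq] uE.
  have tf := wf_typed wf; have tg := wf_typed wg.
  have [v vE] := get _ _ _ tf; have [v' v'E] := get _ _ _ tg.
  have <- : @Arr K (Perm K) _ _ (@mtens K (Perm K) _ _ _ _ v v') = @Arr K (Perm K) _ _ u.
    apply: Arr_phi; try by apply: pshape_inj; rewrite /= !stripK.
    by rewrite [LHS]hsym_tens // uE vE v'E.
  by apply: gen_tens; [apply: IHf | apply: IHg]; rewrite ?pshape_Mobc.
- move=> _ uE; have -> : u = 0.
    apply: hsym_inj; rewrite uE; apply: gfunP => d' w; rewrite hsym0 // => v.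
    by rewrite lfunE.
  exact: gen_zero.
- move=> /typedP[/= /and4P[wf wg /eqP es /eqP et] sf tf] uE.
  have tf' : typed (pshape p) (pshape q) f by apply/typedP.
  have tg' : typed (pshape p) (pshape q) g by apply/typedP; rewrite -es -et.
  have [v vE] := getp _ _ _ tf'; have [v' v'E] := getp _ _ _ tg'.
  have -> : u = 1 *: v + v'.
    by apply: hsym_inj; apply: gfunP => d w; rewrite uE hsym_lin vE v'E mul1r.
  by apply: (@gen_lin K (Perm K)); [apply: IHf | apply: IHg].
- move=> tf uE; have [v vE] := getp _ _ f tf.
  have -> : u = k *: v + 0.
    apply: hsym_inj; apply: gfunP => d w; rewrite uE hsym_lin vE hsym0 ?addr0 // => x.
    by rewrite lfunE.
  by apply: (@gen_lin K (Perm K)); [apply: IHf | apply: gen_zero].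
Qed.

Lemma generated_all (x : arrow (Perm K)) : generated (@nabla_delta K) x.
Proof.
case: x => -[p q] u; have [f tf fE] := ev_onto char0 (hsym_binv u).
by apply: (generated_ev (f := f)).
Qed.

End Gamma.

From mathcomp Require Import reals complex.

Theorem theorem3p1p1 (R : realType) :
  (exists Gamma : lmfunctor (SpPerm R[i]) (Perm R[i]),
    Gamma_spec Gamma
    /\ (forall Gamma' : lmfunctor (SpPerm R[i]) (Perm R[i]),
          Gamma_spec Gamma' ->
          forall (a b : mob (SpPerm R[i])) (f : mhom a b),
            Arr (fmor Gamma' a b f) = Arr (fmor Gamma a b f))
    /\ lmiso Gamma)
  /\ (forall x : arrow (Perm R[i]), generated (@nabla_delta R[i]) x).
Proof.
have char0 n : (n.+1%:R != 0 :> R[i])%R by rewrite Num.Theory.pnatr_eq0.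
split; last exact: (generated_all char0).
exists (gamma_functor char0); split; first exact: gamma_spec.
by split; [apply: gamma_unique | apply: gamma_iso].
Qed.
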